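(* Let $n\ge 5$ and let $W$ be the natural $2n$-dimensional representation of $Spin(2n)$. There exists a unique (up to scale) nonzero $Spin(2n)$-equivariant morphism $$\psi:\Delta_+\to\mathrm{Hom}(W_{\omega_{n-4}},W_{\omega_{n-5}+\omega_{n-1}}),\quad \delta\mapsto\psi_\delta,$$ and this morphism yields a matrix of linear forms of bounded rank (i.e. $\psi_\delta$ has a nontrivial kernel for every $\delta\in\Delta_+$). Indeed, for any $\delta\in\Delta_+$ we have $$\psi_\delta(a(\delta))=0,$$ where $a:\mathrm{Sym}^2(\Delta_+)\to\wedge^{n-4}W=W_{\omega_{n-4}}$ is the unique (up to scale) nonzero equivariant map and $a(\delta):=a(\delta^2)$.
   Context: Work over $\mathbb{C}$. $\omega_1,\dots,\omega_n$ are the fundamental weights of $Spin(2n)$ (with the convention $\omega_0=0$), and $W_\omega$ denotes the irreducible module of highest weight $\omega$. One has $W_{\omega_i}=\wedge^iW$ for $i\le n-2$, and the two half-spin representations are $\Delta_+=W_{\omega_n}$ and $\Delta_-=W_{\omega_{n-1}}$. The module $\wedge^{n-4}W$ appears with multiplicity one in $\mathrm{Sym}^2(\Delta_+)$, whence the map $a$. *)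

(* Defs.v *)
From mathcomp Require Import all_boot all_order all_algebra.

Set Implicit Arguments.
Unset Strict Implicit.
Unset Printing Implicit Defensive.

Import Order.TTheory GRing.Theory Num.Theory.

Local Open Scope ring_scope.

Section ExteriorAlgebra.
Variables (C : numClosedFieldType) (m : nat).

(* The exterior algebra of C^m: the function x stands for
   \sum_A x A *: e_A, where e_A = e_{a_1} /\ ... /\ e_{a_k} for
   A = {a_1 < ... < a_k}. *)
Local Notation exterior := {ffun {set 'I_m} -> C^o}.

Definition ext_basis (A : {set 'I_m}) : exterior := [ffun B => (B == A)%:R].

Definition ext_sign (i : 'I_m) (A : {set 'I_m}) : C :=
  (-1) ^+ #|[set j in A | (j < i)%N]|.

(* Left exterior multiplication by the vector v. *)
Definition wedge (v : 'rV[C]_m) (x : exterior) : exterior :=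
  [ffun A : {set 'I_m} => \sum_(i in A) ext_sign i A * v 0 i * x (A :\ i)].

(* Left interior multiplication by the linear form phi, given by its
   coordinates in the dual basis. *)
Definition contract (phi : 'rV[C]_m) (x : exterior) : exterior :=
  [ffun A : {set 'I_m} =>
     \sum_(i in ~: A) ext_sign i A * phi 0 i * x (i |: A)].

(* The algebra endomorphism of the exterior algebra extending f:
   e_A |-> f e_{a_1} /\ ... /\ f e_{a_k} (enum A is increasing). *)
Definition ext_map (f : 'End('rV[C]_m)) : 'End(exterior) :=
  linfun (fun x : exterior => \sum_(A : {set 'I_m}) x A *:
    foldr (fun i y => wedge (f (delta_mx 0 i)) y) (ext_basis set0) (enum A)).

Definition ext_power (k : nat) : {vspace exterior} :=
  <<[seq ext_basis A | A in [set A : {set 'I_m} | #|A| == k]]>>%VS.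

End ExteriorAlgebra.

Arguments ext_basis C {m} A.

Section Spin.
Variables (C : numClosedFieldType) (n : nat).

(* W = E (+) E^* with E = C^n; the coordinates of row_mx x phi are those of
   x on the basis e_0, ..., e_{n-1} of E, and those of phi on the dual basis
   f_0, ..., f_{n-1}. The quadratic form is q(x + phi) = phi(x). *)
Local Notation natural := 'rV[C]_(n + n).

Definition quad (w : natural) : C :=
  \sum_(i < n) lsubmx w 0 i * rsubmx w 0 i.

Definition vec_e (i : 'I_n) : natural := row_mx (delta_mx 0 i) 0.
Definition vec_f (i : 'I_n) : natural := row_mx 0 (delta_mx 0 i).

(* The full spinor module /\E. It is faithful and irreducible over the
   Clifford algebra Cl(W, q), which it identifies with 'End(spinor). *)
Local Notation spinor := {ffun {set 'I_n} -> C^o}.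

Definition clifford_fun (w : natural) (x : spinor) : spinor :=
  wedge (lsubmx w) x + contract (rsubmx w) x.

(* Clifford multiplication by a vector; it satisfies
   clifford w \o clifford w = quad w *: \1. *)
Definition clifford (w : natural) : 'End(spinor) := linfun (clifford_fun w).

(* Spin(2n) inside the Clifford algebra: the products of an even number of
   vectors of norm 1. *)
Definition spin (g : 'End(spinor)) : Prop :=
  exists s : seq natural,
    [/\ all (fun w => quad w == 1) s, ~~ odd (size s)
      & g = foldr (fun w h => (clifford w \o h)%VF) \1%VF s].

(* Only the values of an action at elements g such that spin g matter. *)
Definition spin_action (V : vectType C) : Type := 'End(spinor) -> 'End(V).

(* The vector representation: g acts by w |-> g w g^-1, computed in the
   Clifford algebra (clifford is injective, so that its inverse as a linear
   function is a left inverse). *)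
Definition natural_act : spin_action natural := fun g =>
  linfun (fun w : natural =>
    ((linfun clifford)^-1)%VF (g \o clifford w \o g^-1)%VF).

Definition sub_act (V : vectType C) (r : spin_action V) (U : {vspace V}) :
  spin_action (subvs_of U) := fun g =>
  linfun (fun u : subvs_of U => vsproj U (r g (vsval u))).

Definition hom_act (U V : vectType C) (r : spin_action U) (s : spin_action V) :
  spin_action 'Hom(U, V) := fun g =>
  linfun (fun f : 'Hom(U, V) => (s g \o f \o (r g)^-1)%VF).

(* Delta_+: the half of /\E that contains e_0 /\ ... /\ e_{n-1}, a vector of
   weight omega_n = (1/2, ..., 1/2). *)
Definition half_spin_plus : {vspace spinor} :=
  <<[seq ext_basis C A | A in [set A : {set 'I_n} | odd #|A| == odd n]]>>%VS.

Definition Delta_plus : vectType C := subvs_of half_spin_plus.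

Definition Delta_plus_act : spin_action Delta_plus :=
  sub_act (fun g => g) half_spin_plus.

Definition wedge_natural (k : nat) : vectType C :=
  subvs_of (ext_power C (n + n) k).

Definition wedge_natural_act (k : nat) : spin_action (wedge_natural k) :=
  sub_act (fun g => ext_map (natural_act g)) (ext_power C (n + n) k).

Inductive polynomial_fun (V : vectType C) : (V -> C) -> Prop :=
| PolyConst (c : C) : polynomial_fun (fun _ => c)
| PolyLinear (l : 'Hom(V, C^o)) : polynomial_fun (fun v => l v)
| PolyAdd (p q : V -> C) : polynomial_fun p -> polynomial_fun q ->
    polynomial_fun (fun v => p v + q v)
| PolyMul (p q : V -> C) : polynomial_fun p -> polynomial_fun q ->
    polynomial_fun (fun v => p v * q v).

(* Spin(2n) is Zariski closed in 'End(spinor), so that its regular functions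
   are the restrictions of the polynomial functions on 'End(spinor). *)
Definition rational_representation (V : vectType C) (r : spin_action V) :
  Prop :=
  [/\ r \1%VF = \1%VF,
      forall g h, spin g -> spin h -> r (g \o h)%VF = (r g \o r h)%VF
    & forall (l : 'Hom(V, C^o)) (v : V),
        exists2 p : 'End(spinor) -> C,
          polynomial_fun p & forall g, spin g -> l (r g v) = p g].

Definition irreducible (V : vectType C) (r : spin_action V) : Prop :=
  (fullv : {vspace V}) != 0%VS /\
  forall U : {vspace V},
    (forall g, spin g -> (r g @: U <= U)%VS) -> U = 0%VS \/ U = fullv.

(* The image in W of torus i c is diagonal: it maps e_i to c ^+ 2 *: e_i and
   f_i to c ^- 2 *: f_i, and fixes the other basis vectors. The elements
   torus i c generate the maximal torus, whose characters are written in the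
   basis eps_0, ..., eps_{n-1} formed by the weights of e_0, ..., e_{n-1}. *)
Definition torus (i : 'I_n) (c : C) : 'End(spinor) :=
  c *: (clifford (vec_e i) \o clifford (vec_f i))%VF
  + c^-1 *: (clifford (vec_f i) \o clifford (vec_e i))%VF.

(* The root subgroups of the positive roots eps_i - eps_j and eps_i + eps_j,
   for i < j. *)
Definition root_minus (i j : 'I_n) (c : C) : 'End(spinor) :=
  \1%VF + c *: (clifford (vec_e i) \o clifford (vec_f j))%VF.
Definition root_plus (i j : 'I_n) (c : C) : 'End(spinor) :=
  \1%VF + c *: (clifford (vec_e i) \o clifford (vec_e j))%VF.

(* Weights are represented by TWICE their coordinates in the basis eps; thus
   torus i c acts on a vector of weight omega by c ^ omega i. *)
Definition weight : Type := 'I_n -> int.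

Definition add_weight (lambda mu : weight) : weight :=
  fun i => lambda i + mu i.

Definition highest_weight_vector (V : vectType C) (r : spin_action V)
  (omega : weight) (v : V) : Prop :=
  [/\ v != 0,
      forall i c, c != 0 -> r (torus i c) v = (c ^ omega i) *: v
    & forall (i j : 'I_n) c, (i < j)%N ->
        r (root_minus i j c) v = v /\ r (root_plus i j c) v = v].

(* V, with the action r, is the irreducible module W_omega. *)
Definition irreducible_of_highest_weight (V : vectType C) (r : spin_action V)
  (omega : weight) : Prop :=
  [/\ rational_representation r, irreducible r
    & exists v, highest_weight_vector r omega v].

(* omega_k = eps_0 + ... + eps_{k-1} for k <= n - 2 (so that omega_0 = 0),
   omega_{n-1} = (eps_0 + ... + eps_{n-2} - eps_{n-1}) / 2 and
   omega_n = (eps_0 + ... + eps_{n-1}) / 2. *)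
Definition fundamental_weight (k : nat) : weight := fun i =>
  if k == n then 1
  else if k == n.-1 then (if i == n.-1 :> nat then -1 else 1)
  else if (i < k)%N then 2 else 0.

Definition equivariant (U V : vectType C) (r : spin_action U)
  (s : spin_action V) (f : U -> V) : Prop :=
  forall g, spin g -> forall u, f (r g u) = s g (f u).

(* Equivariant linear maps from Sym^2 U to V, as symmetric bilinear maps; the
   image of u^2 is a u u. *)
Definition sym2_equivariant (U V : vectType C) (r : spin_action U)
  (s : spin_action V) (a : 'Hom(U, 'Hom(U, V))) : Prop :=
  (forall u u', a u u' = a u' u) /\
  forall g, spin g -> forall u u', a (r g u) (r g u') = s g (a u u').

End Spin.

Arguments Delta_plus_act C n : clear implicits.
Arguments wedge_natural_act C n k : clear implicits.
Arguments fundamental_weight n k : clear implicits.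

Definition unique_up_to_scale (K : fieldType) (V : lmodType K)
  (P : V -> Prop) : Prop :=
  exists v, [/\ v != 0, P v & forall w, P w -> exists c, w = c *: v].

(* Main.v *)
(* A vector v of highest weight in a representation V carries a companion linear
   form l, invariant under the negative root subgroups and of the same weight,
   with l v = 1: the translates of v by products of negative root elements span
   the module generated by v, and contracting by the torus shows that the sum of
   the coefficients of a combination of translates is well defined. When V is
   irreducible, l does not vanish on any nonzero submodule, so that an
   equivariant map f to V is determined by l o f.
   Existence: a representation with an adjunction-compatible Hermitian form,
   such as S (x) /\W and S (x) S, maps equivariantly to V as soon as it has a
   nonzero vector of the same highest weight. Such vectors are
   sum_a (w_a' eta) (x) (w_a /\ e_0 /\ ... /\ e_{n-6}), where (w_a), (w_a') are
   dual bases of W, and the tensor of e_0 ... e_{n-5} in End(S) = S (x) S.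
   Uniqueness: weights and the invariance of l o f leave one free coefficient.
   Vanishing: l (psi_x (a (y, z))), symmetrized, is a symmetric trilinear form of
   weight omega_{n-5} + omega_{n-1} on Delta_+ that is invariant under the
   negative root subgroups; by weights and invariance, all its coefficients
   vanish.
   Kernels: if psi_u is injective then a (u, u) = 0, and the terms of low order
   of psi_(u + c w) (a (u + c w, u + c w)) = 0 force a (w, w) = 0 for all w. *)

From HB Require Import structures.
Require Import Defs.
From mathcomp Require Import all_boot all_order all_algebra.
From mathcomp Require Import complex.
From mathcomp Require Import reals.
From mathcomp Require boolp.
From mathcomp Require Import ring zify.

Set Implicit Arguments.
Unset Strict Implicit.
Unset Printing Implicit Defensive.

Import Order.TTheory GRing.Theory Num.Theory.
Local Open Scope ring_scope.

(** * Exterior algebra *)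

(** V is known only through its characterization as an irreducible module: no model of it is built,
    so a statement about a map into V becomes a statement about the scalar l on translates. Two
    substitutes shape the argument. Complete reducibility is replaced by adjoints: the group is
    closed under Hermitian adjunction, so the orthogonal of a stable subspace is stable. The Lie
    algebra is replaced by comparing coefficients of polynomials in the parameter of a root
    subgroup. The group is defined through unit vectors, whereas highest weights are expressed by
    root and torus elements; the two descriptions must first be reconciled, by showing that all unit
    vectors are conjugate. The cubic identity alone does not give a kernel at every delta: a
    vanishes on the highest weight vector of Delta_+, because 2 omega_n is not a weight of the
    exterior power of degree n - 4. This is why the kernels need a deformation argument of their
    own. *)

Section Exterior.
Variables (C : numClosedFieldType) (m : nat).
Local Notation ext := {ffun {set 'I_m} -> C^o}.
Local Notation sgn := (ext_sign C).
Implicit Types (v w : 'rV[C]_m) (x y : ext) (A B : {set 'I_m}).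

Lemma ext_sign_sqr i A : sgn i A * sgn i A = 1.
Proof. by rewrite /ext_sign -exprD addnn -muln2 exprM sqrr_sign. Qed.

Lemma ext_signD1 i j A : i \in A ->
  sgn j (A :\ i) = sgn j A * (-1) ^+ (i < j)%N.
Proof.
move=> iA; rewrite /ext_sign -exprD.
have -> : [set k in A :\ i | (k < j)%N] = [set k in A | (k < j)%N] :\ i.
  by apply/setP=> k; rewrite !inE andbA.
rewrite (cardsD1 i [set k in A | (k < j)%N]) !inE iA /=.
set q := #|_|; case: (i < j)%N; rewrite /= ?addn0 //.
by rewrite addnC addnA exprD expr2 mulrNN !mulr1 mul1r.
Qed.

Lemma ext_signU1 i j A : i \notin A ->
  sgn j (i |: A) = sgn j A * (-1) ^+ (i < j)%N.
Proof.
move=> iA; have iiA : i \in i |: A by rewrite setU11.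
have := @ext_signD1 i j _ iiA; rewrite setU1K // => ->.
by case: (i < j)%N; rewrite ?expr1 ?expr0 ?mulr1 // -mulrA mulrNN !mulr1.
Qed.

Lemma sign_lt_swap (i j : 'I_m) : i != j ->
  (-1) ^+ (i < j)%N = - (-1) ^+ (j < i)%N :> C.
Proof.
by rewrite -val_eqE /=; case: ltngtP => //= _ _; rewrite ?expr1 ?expr0 ?opprK.
Qed.

Lemma wedge_is_linear v : linear (wedge v : ext -> ext).
Proof.
move=> c x y; apply/ffunP=> A; rewrite !ffunE /GRing.scale /= mulr_sumr -big_split /=.
by apply: eq_bigr => i _; rewrite !ffunE /GRing.scale /=; ring.
Qed.
HB.instance Definition _ v := GRing.isLinear.Build C ext ext _ _ (wedge_is_linear v).

Lemma contract_is_linear v : linear (contract v : ext -> ext).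
Proof.
move=> c x y; apply/ffunP=> A; rewrite !ffunE /GRing.scale /= mulr_sumr -big_split /=.
by apply: eq_bigr => i _; rewrite !ffunE /GRing.scale /=; ring.
Qed.
HB.instance Definition _ v := GRing.isLinear.Build C ext ext _ _ (contract_is_linear v).

Lemma wedgeDl c v w x : wedge (c *: v + w) x = c *: wedge v x + wedge w x.
Proof.
apply/ffunP=> A; rewrite !ffunE /GRing.scale /= mulr_sumr -big_split /=.
by apply: eq_bigr => i _; rewrite !mxE; ring.
Qed.

Lemma contractDl c v w x :
  contract (c *: v + w) x = c *: contract v x + contract w x.
Proof.
apply/ffunP=> A; rewrite !ffunE /GRing.scale /= mulr_sumr -big_split /=.
by apply: eq_bigr => i _; rewrite !mxE; ring.
Qed.

Lemma wedge_anticomm v w x : wedge v (wedge w x) = - wedge w (wedge v x).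
Proof.
apply/ffunP=> A; rewrite !ffunE.
under eq_bigr => i iA do rewrite ffunE mulr_sumr.
under [in RHS]eq_bigr => i iA do rewrite ffunE mulr_sumr.
rewrite (exchange_big_dep (mem A)) /=; last by move=> i j _; rewrite !inE => /andP[].
rewrite -sumrN; apply: eq_bigr => j jA; rewrite -sumrN.
apply: eq_big => [i|i].
  by rewrite !inE jA andbT eq_sym andbC.
rewrite !inE => /andP[iA /andP[ji _]].
rewrite [A :\ i :\ j]setDDl [A :\ j :\ i]setDDl [in RHS]setUC.
rewrite !ext_signD1 // (sign_lt_swap ji). ring.
Qed.

Lemma contract_anticomm v w x :
  contract v (contract w x) = - contract w (contract v x).
Proof.
apply/ffunP=> A; rewrite !ffunE.
under eq_bigr => i iA do rewrite ffunE mulr_sumr.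
under [in RHS]eq_bigr => i iA do rewrite ffunE mulr_sumr.
rewrite (exchange_big_dep (mem (~: A))) /=; last first.
  by move=> i j _; rewrite !inE negb_or => /andP[].
rewrite -sumrN; apply: eq_bigr => j; rewrite !inE => jA; rewrite -sumrN.
apply: eq_big => [i|i].
  by rewrite !inE !negb_or jA andbT eq_sym andbC.
rewrite !inE !negb_or => /andP[iA /andP[ji _]].
rewrite [in RHS]setUCA !ext_signU1 // (sign_lt_swap ji); ring.
Qed.

Definition rdot k (v w : 'rV[C]_k) : C := \sum_i v 0 i * w 0 i.

(** On the left the diagonal terms run over i outside A, on the right over i inside A, and together
    they make up the dot product. The remaining terms exchange an index of A with one outside it;
    the two orders of the operations give them opposite signs. *)
Lemma contract_wedge v w x :
  contract v (wedge w x) = rdot v w *: x - wedge w (contract v x).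
Proof.
apply/ffunP=> A; rewrite !ffunE /GRing.scale /=.
have L : \sum_(i in ~: A) sgn i A * v 0 i * wedge w x (i |: A) =
  (\sum_(i in ~: A) v 0 i * w 0 i) * x A +
  \sum_(i in ~: A) \sum_(j in A) sgn i A * sgn j A * (-1) ^+ (i < j)%N
     * v 0 i * w 0 j * x ((i |: A) :\ j).
  rewrite mulr_suml -big_split /=; apply: eq_bigr => i; rewrite inE => iA.
  rewrite ffunE (bigD1 i) ?setU11 //= setU1K // mulrDr; congr (_ + _).
    rewrite ext_signU1 // ltnn expr0 mulr1.
    have := ext_sign_sqr i A; set s := sgn i A => ss.
    by transitivity ((s * s) * (v 0 i * w 0 i * x A)); [ring | rewrite ss mul1r].
  rewrite mulr_sumr; apply: eq_big => [j|j].
    rewrite !inE; case: eqP => //= [->|]; last by rewrite andbT.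
    by rewrite (negPf iA).
  by rewrite !inE => /andP[_ ji]; rewrite ext_signU1 //; ring.
rewrite {}L.
have -> : \sum_(i in A) sgn i A * w 0 i * contract v x (A :\ i) =
  (\sum_(i in A) v 0 i * w 0 i) * x A -
  \sum_(j in A) \sum_(i in ~: A) sgn i A * sgn j A * (-1) ^+ (i < j)%N
     * v 0 i * w 0 j * x ((i |: A) :\ j).
  rewrite mulr_suml -sumrB; apply: eq_bigr => j jA.
  rewrite ffunE (bigD1 j) ?inE ?eqxx //= setD1K // mulrDr; congr (_ + _).
    rewrite ext_signD1 // ltnn expr0 mulr1.
    have := ext_sign_sqr j A; set s := sgn j A => ss.
    by transitivity ((s * s) * (v 0 j * w 0 j * x A)); [ring | rewrite ss mul1r].
  rewrite mulr_sumr -sumrN; apply: eq_big => [i|i].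
    rewrite !inE; case: eqP => //= [->|]; last by rewrite andbT.
    by rewrite jA.
  rewrite !inE => /andP[_ ij].
  have -> : i |: A :\ j = (i |: A) :\ j.
    apply/setP=> k; rewrite !inE; case: eqP => [->|] //=; by rewrite ij.
  by rewrite ext_signD1 // (sign_lt_swap ij); ring.
rewrite [X in _ = _ - (_ - X)]exchange_big /=.
have -> : rdot v w =
    \sum_(i in A) v 0 i * w 0 i + \sum_(i in ~: A) v 0 i * w 0 i.
  by rewrite /rdot (bigID (mem A)) /=; congr (_ + _); apply: eq_bigl => i; rewrite inE.
ring.
Qed.

Lemma wedge_basis i A : i \notin A ->
  wedge (delta_mx 0 i) (ext_basis C A) = sgn i A *: ext_basis C (i |: A).
Proof.
move=> iA; apply/ffunP=> B; rewrite !ffunE /GRing.scale /=.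
case: (eqVneq B (i |: A)) => [->|neB].
  rewrite (bigD1 i) ?setU11 //= ffunE setU1K // eqxx mxE !eqxx big1 ?addr0.
    by rewrite ext_signU1 // ltnn expr0 !mulr1.
  by move=> j /andP[_ ji]; rewrite mxE eqxx (negPf ji) mulr0 mul0r.
rewrite mulr0 big1 // => j jB; rewrite ffunE mxE eqxx /=.
case: eqP => [ji|]; last by rewrite mulr0 mul0r.
case: eqP => [BA|]; last by rewrite mulr0.
by case/eqP: neB; rewrite -BA -ji setD1K.
Qed.

Lemma wedge_basis_in i A : i \in A ->
  wedge (delta_mx 0 i) (ext_basis C A) = 0.
Proof.
move=> iA; apply/ffunP=> B; rewrite !ffunE big1 // => j jB.
rewrite mxE eqxx ffunE; case: eqP => [ji|]; last by rewrite mulr0 mul0r.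
case: eqP => [BA|]; last by rewrite mulr0.
by move: iA; rewrite -BA ji !inE eqxx.
Qed.

Lemma contract_basis i A : i \in A ->
  contract (delta_mx 0 i) (ext_basis C A) = sgn i A *: ext_basis C (A :\ i).
Proof.
move=> iA; apply/ffunP=> B; rewrite !ffunE /GRing.scale /=.
case: (eqVneq B (A :\ i)) => [->|neB].
  rewrite (bigD1 i) ?inE ?eqxx //= ffunE setD1K // eqxx mxE !eqxx big1 ?addr0.
    by rewrite ext_signD1 // ltnn expr0 !mulr1 -?mulrA ?mulr1.
  by move=> j /andP[_ ji]; rewrite mxE eqxx (negPf ji) mulr0 mul0r.
rewrite mulr0 big1 // => j; rewrite inE => jB; rewrite ffunE mxE eqxx /=.
case: eqP => [ji|]; last by rewrite mulr0 mul0r.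
case: eqP => [BA|]; last by rewrite mulr0.
by case/eqP: neB; rewrite -BA -ji setU1K.
Qed.

Lemma contract_basis_notin i A : i \notin A ->
  contract (delta_mx 0 i) (ext_basis C A) = 0.
Proof.
move=> iA; apply/ffunP=> B; rewrite !ffunE big1 // => j jB.
rewrite mxE eqxx ffunE; case: eqP => [ji|]; last by rewrite mulr0 mul0r.
case: eqP => [BA|]; last by rewrite mulr0.
by move: iA; rewrite -BA ji !inE eqxx.
Qed.

Lemma ext_basis_sum x : x = \sum_A x A *: ext_basis C A.
Proof.
apply/ffunP=> B; rewrite sum_ffunE (bigD1 B) //= !ffunE eqxx /GRing.scale /= mulr1.
by rewrite big1 ?addr0 // => A; rewrite !ffunE eq_sym => /negPf-> /=; rewrite /GRing.scale /= mulr0.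
Qed.

End Exterior.

(** * The standard Hermitian form and functoriality of the exterior algebra *)

Section Hermitian.
Variables (C : numClosedFieldType) (K : finType).
Local Notation sp := {ffun K -> C^o}.
Implicit Types (x y z : sp).

Definition herm x y : C := \sum_k x k * (y k)^*.

Lemma hermDl c x y z : herm (c *: x + y) z = c * herm x z + herm y z.
Proof.
rewrite /herm mulr_sumr -big_split /=; apply: eq_bigr => k _.
by rewrite !ffunE /GRing.scale /=; ring.
Qed.

Lemma herm0l y : herm 0 y = 0.
Proof. by rewrite /herm big1 // => k _; rewrite ffunE mul0r. Qed.

Lemma herm_suml (I : Type) (r : seq I) (P : pred I) (F : I -> sp) y :
  herm (\sum_(i <- r | P i) F i) y = \sum_(i <- r | P i) herm (F i) y.
Proof.
elim/big_rec2: _ => [|i a b _ <-]; first exact: herm0l.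
by rewrite -[F i]scale1r hermDl mul1r scale1r.
Qed.

Lemma hermC x y : herm x y = (herm y x)^*.
Proof.
rewrite /herm rmorph_sum /=; apply: eq_bigr => k _.
by rewrite rmorphM /= conjCK mulrC.
Qed.

Lemma hermDr c x y z : herm z (c *: x + y) = c^* * herm z x + herm z y.
Proof. by rewrite hermC hermDl rmorphD rmorphM /= -!hermC. Qed.

Lemma herm_eq0 x : (herm x x == 0) = (x == 0).
Proof.
apply/idP/eqP => [|->]; last by rewrite /herm big1 // => k _; rewrite ffunE mul0r.
rewrite psumr_eq0; last by move=> k _; rewrite -normCK exprn_ge0.
move/allP => h; apply/ffunP=> k; rewrite ffunE.
by have := h k (mem_index_enum k); rewrite -normCK expf_eq0 /= normr_eq0 => /eqP.
Qed.

Lemma herm_ext x y : (forall z, herm z x = herm z y) -> x = y.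
Proof.
move=> h; apply/eqP; rewrite -subr_eq0 -herm_eq0.
have -> : herm (x - y) (x - y) = herm (x - y) (-1 *: y + x).
  by congr herm; rewrite scaleN1r addrC.
by rewrite hermDr rmorphN rmorph1 mulN1r h addNr.
Qed.

End Hermitian.

Section ExtMap.
Variables (C : numClosedFieldType) (m : nat).
Local Notation ext := {ffun {set 'I_m} -> C^o}.
Implicit Types (v w : 'rV[C]_m) (x y : ext) (A B : {set 'I_m}).

Lemma wedge_adj v x y :
  herm (wedge v x) y = herm x (contract (map_mx Num.conj v) y).
Proof.
rewrite /herm.
under eq_bigr => A _ do rewrite ffunE mulr_suml.
under [RHS]eq_bigr => A _ do rewrite ffunE rmorph_sum mulr_sumr.
rewrite (exchange_big_dep xpredT) //= [RHS](exchange_big_dep xpredT) //=.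
apply: eq_bigr => i _.
rewrite (reindex_onto (fun A => i |: A) (fun A => A :\ i)) /=; last first.
  by move=> A iA; rewrite setD1K.
apply: eq_big => [A|A /andP[_ /eqP e]].
  rewrite setU11 inE /=; apply/eqP/idP => [<-|iA]; last by rewrite setU1K.
  by rewrite !inE eqxx.
have iA : i \notin A by rewrite -e !inE eqxx.
rewrite setU1K // ext_signU1 // ltnn expr0 mulr1 !rmorphM /= mxE conjCK.
by rewrite /ext_sign rmorphXn rmorphN rmorph1; ring.
Qed.

Definition wedges (s : seq 'rV[C]_m) : ext :=
  foldr (fun v y => wedge v y) (ext_basis C set0) s.

Lemma sgn_unit i A : ext_sign C i A != 0.
Proof. by rewrite /ext_sign signr_eq0. Qed.

Lemma wedges_uniq (s : seq 'I_m) : uniq s ->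
  exists2 c : C, c != 0 &
  wedges [seq delta_mx 0 i | i <- s] = c *: ext_basis C [set i in s].
Proof.
elim: s => [_|i s IH] /=.
  exists 1; rewrite ?oner_eq0 // scale1r; congr (ext_basis C _).
case/andP=> is_ /IH[c c0 e]; exists (c * ext_sign C i [set i in s]).
  by rewrite mulf_neq0 // sgn_unit.
rewrite e linearZ /= wedge_basis ?inE //.
by rewrite scalerA; congr (_ *: ext_basis C _); apply/setP=> j; rewrite !inE.
Qed.

(** Every basis vector is, up to a nonzero scalar, an iterated wedge of basis vectors of W applied
    to the unit. Identities between linear maps are then checked without coordinates. *)
Lemma ext_ind (P : ext -> Prop) :
  P (ext_basis C set0) -> (forall v x, P x -> P (wedge v x)) ->
  (forall c x y, P x -> P y -> P (c *: x + y)) -> forall x, P x.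
Proof.
move=> P0 Pw PD x; rewrite (ext_basis_sum x).
have Pz : P 0 by have := PD (-1) _ _ P0 P0; rewrite scaleN1r addNr.
have PB A : P (ext_basis C A).
  have [c c0 e] := wedges_uniq (enum_uniq (mem A)).
  have : P (wedges [seq delta_mx 0 i | i <- enum A]).
    by elim: (enum A) => //= i s; apply: Pw.
  rewrite e => /(PD c^-1 _ _)-/(_ _ Pz); rewrite addr0 scalerA mulVf // scale1r.
  by congr P; congr (ext_basis C _); apply/setP=> i; rewrite inE mem_enum.
elim/big_ind: _ => // [y z Py Pz'|A _].
  by have := PD 1 _ _ Py Pz'; rewrite scale1r.
by have := PD (x A) _ _ (PB A) Pz; rewrite addr0.
Qed.

End ExtMap.

(** Serves the maps whose linearity is a proved proposition and not a declared structure, such as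
    the actions of the definitions. *)
Lemma linfunE (K : fieldType) (U V : vectType K) (f : U -> V) :
  linear f -> linfun f =1 f.
Proof.
move=> lf u.
pose F : {linear U -> V} := HB.pack f (GRing.isLinear.Build K U V *:%R f lf).
exact: (lfunE F).
Qed.

Section ExtMap.
Variables (C : numClosedFieldType) (m : nat).
Local Notation ext := {ffun {set 'I_m} -> C^o}.
Implicit Types (v w : 'rV[C]_m) (x y : ext) (A B : {set 'I_m}).

Lemma wedge0l x : wedge 0 x = 0.
Proof.
by apply/ffunP=> A; rewrite !ffunE big1 // => i _; rewrite mxE mulr0 mul0r.
Qed.

Lemma contract0l x : contract 0 x = 0.
Proof.
by apply/ffunP=> A; rewrite !ffunE big1 // => i _; rewrite mxE mulr0 mul0r.
Qed.

Lemma wedge_sq v x : wedge v (wedge v x) = 0.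
Proof.
have /eqP := wedge_anticomm v v x; rewrite -subr_eq0 opprK -mulr2n -scaler_nat.
by rewrite scaler_eq0 pnatr_eq0 /= => /eqP.
Qed.

Lemma wedge_wedges_mem v (s : seq 'rV[C]_m) : v \in s -> wedge v (wedges s) = 0.
Proof.
elim: s => //= w s IH; rewrite inE => /orP[/eqP->|/IH e]; first exact: wedge_sq.
by rewrite wedge_anticomm e linear0 oppr0.
Qed.

Lemma wedge_wedges_cat v (s t : seq 'rV[C]_m) :
  wedge v (wedges (s ++ t)) = (-1) ^+ size s *: wedges (s ++ v :: t).
Proof.
elim: s => [|w s IH] /=; first by rewrite scale1r.
by rewrite wedge_anticomm IH linearZ /= exprS mulN1r scaleNr.
Qed.

(** As [enum] is increasing, i is inserted after the elements of A below it. Their number is the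
    exponent in [ext_sign i A], so the sign of [wedge_basis] is the cost of moving a factor into its
    place. *)
Lemma enum_setU1 i A : i \notin A ->
  exists s t, [/\ enum A = s ++ t, enum (i |: A) = s ++ i :: t
    & size s = #|[set j in A | (j < i)%N]|].
Proof.
move=> iA; pose s := [seq j : 'I_m <- enum A | (j < i)%N].
pose t := [seq j : 'I_m <- enum A | (i < j)%N].
pose r (a b : 'I_m) := (a < b)%N.
have rt : transitive r by move=> a b c; apply: ltn_trans.
have ri : irreflexive r by move=> a; apply: ltnn.
have so B : sorted r (enum B).
  apply: (sorted_filter rt); rewrite -enumT.
  have := iota_ltn_sorted 0 m; rewrite -val_enum_ord sorted_map; exact.
have ss : sorted r s by rewrite sorted_filter.
have st : sorted r t by rewrite sorted_filter.
have ms j : (j \in s) = (j \in A) && (j < i)%N.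
  by rewrite mem_filter mem_enum andbC.
have mt j : (j \in t) = (j \in A) && (i < j)%N.
  by rewrite mem_filter mem_enum andbC.
exists s, t; split.
- apply: (irr_sorted_eq rt ri) => //.
    rewrite sorted_pairwise // pairwise_cat -!sorted_pairwise // ss st !andbT.
    apply/allrelP=> a b; rewrite ms mt => /andP[_ ai] /andP[_ ib].
    exact: ltn_trans ai ib.
  move=> j; rewrite mem_cat ms mt mem_enum -andb_orr.
  by case: (ltngtP j i) => [||/val_inj->]; rewrite ?andbT ?(negPf iA).
- apply: (irr_sorted_eq rt ri) => //.
    rewrite sorted_pairwise // pairwise_cat pairwise_cons -!sorted_pairwise //.
    rewrite ss st !andbT; apply/andP; split.
      apply/allrelP=> a b; rewrite ms inE mt => /andP[_ ai] /orP[/eqP->//|/andP[_ ib]].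
      exact: ltn_trans ai ib.
    by apply/allP=> b; rewrite mt => /andP[].
  move=> j; rewrite mem_cat inE ms mt mem_enum !inE.
  case: (eqVneq j i) => [->|ji] /=; first by rewrite orbT.
  by rewrite -andb_orr; move: ji; rewrite -val_eqE /=; case: ltngtP; rewrite ?andbT.
- have : uniq s by rewrite filter_uniq // enum_uniq.
  move/card_uniqP <-; apply: eq_card => j; by rewrite !inE ms.
Qed.

Section Map.
Variable f : 'End('rV[C]_m).

Lemma ext_mapE x :
  ext_map f x = \sum_A x A *: wedges [seq f (delta_mx 0 i) | i <- enum A].
Proof.
rewrite /ext_map linfunE.
  apply: eq_bigr => A _; congr (_ *: _).
  by elim: (enum A) => //= i s ->.
move=> c y z; rewrite scaler_sumr -big_split /=; apply: eq_bigr => A _.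
by rewrite !ffunE scalerDl scalerA.
Qed.

Lemma ext_map_basis A :
  ext_map f (ext_basis C A) = wedges [seq f (delta_mx 0 i) | i <- enum A].
Proof.
rewrite ext_mapE (bigD1 A) //= ffunE eqxx scale1r big1 ?addr0 // => B /negPf e.
by rewrite ffunE e scale0r.
Qed.

Lemma wedge_suml (I : Type) (r : seq I) (F : I -> 'rV[C]_m) x :
  wedge (\sum_(i <- r) F i) x = \sum_(i <- r) wedge (F i) x.
Proof.
elim/big_rec2: _ => [|i a b _ <-]; first exact: wedge0l.
by rewrite -[F i]scale1r wedgeDl !scale1r.
Qed.

Lemma wedgeZl c v x : wedge (c *: v) x = c *: wedge v x.
Proof. by rewrite -[c *: v]addr0 wedgeDl wedge0l addr0. Qed.

(** On basis vectors: if i lies in A, both sides vanish because f e_i occurs twice; otherwise the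
    sign from inserting i in A is the sign from moving f e_i into the product of the images. *)
Lemma ext_map_wedge v x :
  ext_map f (wedge v x) = wedge (f v) (ext_map f x).
Proof.
rewrite {1}(row_sum_delta v) [in RHS](row_sum_delta v) linear_sum !wedge_suml !linear_sum.
apply: eq_bigr => i _; rewrite linearZ /= !wedgeZl linearZ /=; congr (_ *: _).
rewrite (ext_basis_sum x) !linear_sum; apply: eq_bigr => A _.
rewrite !linearZ /=; congr (_ *: _).
case: (boolP (i \in A)) => iA.
  rewrite wedge_basis_in // linear0 ext_map_basis wedge_wedges_mem //.
  by apply: map_f; rewrite mem_enum.
rewrite wedge_basis // linearZ /= !ext_map_basis.
have [s [t [-> -> e]]] := enum_setU1 iA.
by rewrite !map_cat /= wedge_wedges_cat size_map e.
Qed.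

End Map.

Lemma ext_map_lin_eq (f g : 'Hom(ext, ext)) :
  f (ext_basis C set0) = g (ext_basis C set0) ->
  (forall v x, f x = g x -> f (wedge v x) = g (wedge v x)) -> f = g.
Proof.
move=> e0 ew; apply/lfunP=> x; elim/ext_ind: x => // c x y ex ey.
by rewrite !linearD !linearZ /= ex ey.
Qed.

Lemma ext_map0 f : ext_map f (ext_basis C set0) = ext_basis C set0 :> ext.
Proof. by rewrite ext_map_basis enum_set0. Qed.

Lemma ext_map_comp (f g : 'End('rV[C]_m)) :
  ext_map (f \o g)%VF = (ext_map f \o ext_map g)%VF.
Proof.
apply: ext_map_lin_eq => [|v x]; first by rewrite lfunE /= !ext_map0.
by rewrite !lfunE /= !ext_map_wedge lfunE /= => ->.
Qed.

Lemma ext_map1 : ext_map \1%VF = \1%VF :> 'End(ext).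
Proof.
apply: ext_map_lin_eq => [|v x]; first by rewrite ext_map0 lfunE.
by rewrite ext_map_wedge !lfunE /= => ->.
Qed.

(** The row is the transpose of f applied to v. Both sides satisfy the same recursion under [wedge],
    by [contract_wedge]. *)
Lemma contract_ext_map (f : 'End('rV[C]_m)) v x :
  contract v (ext_map f x) =
  ext_map f (contract (\row_i rdot v (f (delta_mx 0 i))) x).
Proof.
have hw w : rdot (\row_i rdot v (f (delta_mx 0 i))) w = rdot v (f w).
  rewrite {2}(row_sum_delta w) linear_sum /rdot; under [RHS]eq_bigr do rewrite summxE mulr_sumr.
  rewrite exchange_big /=; apply: eq_bigr => i _; rewrite mxE mulr_suml.
  by apply: eq_bigr => j _; rewrite linearZ /= mxE; ring.
elim/ext_ind: x => [|w x IH|c x y IHx IHy].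
- have e u : contract u (ext_basis C set0) = 0 :> ext.
    apply/ffunP=> A; rewrite !ffunE big1 // => i _.
    by rewrite ffunE -cards_eq0 cardsU1 -cardsU1 cards_eq0 setU_eq0 -cards_eq0 cards1 /= mulr0.
  by rewrite ext_map0 !e linear0.
- by rewrite ext_map_wedge !contract_wedge IH linearB linearZ /= ext_map_wedge hw.
- by rewrite !linearD !linearZ /= IHx IHy.
Qed.

Lemma herm_basis A y : herm (ext_basis C A) y = (y A)^*.
Proof.
rewrite /herm (bigD1 A) //= ffunE eqxx mul1r big1 ?addr0 // => B /negPf e.
by rewrite ffunE e mul0r.
Qed.

Lemma ext_map_adj (f f' : 'End('rV[C]_m)) :
  (forall v u, rdot (f v) (map_mx Num.conj u) = rdot v (map_mx Num.conj (f' u))) ->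
  forall x y, herm (ext_map f x) y = herm x (ext_map f' y).
Proof.
move=> ff' x; elim/ext_ind: x => [|w x IH|c x z IHx IHy] y.
- rewrite ext_map0 !herm_basis; congr (_^*); rewrite ext_mapE sum_ffunE (bigD1 set0) //= big1 ?addr0.
    by rewrite enum_set0 !ffunE /= eqxx /GRing.scale /= mulr1.
  move=> A; rewrite -card_gt0 cardE; case: (enum A) => //= i s _.
  by rewrite !ffunE big1 ?scaler0 // => j; rewrite inE.
- rewrite ext_map_wedge !wedge_adj IH contract_ext_map; congr (herm _ (ext_map _ (contract _ _))).
  apply/rowP=> i; rewrite !mxE.
  have := ff' w (delta_mx 0 i); rewrite {1}/rdot (bigD1 i) //= !mxE !eqxx rmorph1 mulr1.
  rewrite big1 ?addr0 => [->|j /negPf ji]; last by rewrite !mxE ji andbF rmorph0 mulr0.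
  rewrite /rdot rmorph_sum; apply: eq_bigr => j _.
  by rewrite rmorphM /= !mxE conjCK.
- by rewrite linearD linearZ /= !hermDl IHx IHy.
Qed.

End ExtMap.

(** * Clifford algebra, root subgroups and torus *)

Section Letters.
Variable n : nat.
Local Notation letter := 'I_(n + n).
Implicit Types a b : letter.

(** Exchanges e_i and f_i: the dual basis vector for the polar form [bil], whose weight is the
    opposite one. *)
Definition bar a : letter :=
  match split a with inl i => rshift n i | inr i => lshift n i end.

Lemma bar_l i : bar (lshift n i) = rshift n i.
Proof. by rewrite /bar (unsplitK (inl i)). Qed.
Lemma bar_r i : bar (rshift n i) = lshift n i.
Proof. by rewrite /bar (unsplitK (inr i)). Qed.

Variant letter_spec : letter -> Type :=
 | LetterE i : letter_spec (lshift n i)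
 | LetterF i : letter_spec (rshift n i).
Lemma letterP a : letter_spec a.
Proof. by case: (split_ordP a) => i ->; constructor. Qed.

Lemma barK : involutive bar.
Proof. by move=> a; case: (letterP a) => i; rewrite ?(bar_l, bar_r). Qed.
Lemma bar_inj : injective bar. Proof. exact: inv_inj barK. Qed.
Lemma bar_neq a : bar a != a.
Proof.
by case: (letterP a) => i; rewrite ?(bar_l, bar_r) ?eq_lrshift ?eq_rlshift.
Qed.
Lemma bar_eq a b : (bar a == b) = (a == bar b).
Proof. by rewrite -(inj_eq bar_inj) barK. Qed.

(** The weight of a evaluated on the regular dominant cocharacter (n, n-1, ..., 1). Heights of
    distinct letters differ and no root has height 0, so the sign of the height separates positive
    from negative roots. *)
Definition height a : int :=
  match split a with inl i => (n - i)%:Z | inr i => - (n - i)%:Z end.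
Lemma height_l i : height (lshift n i) = (n - i)%:Z.
Proof. by rewrite /height (unsplitK (inl i)). Qed.
Lemma height_r i : height (rshift n i) = - (n - i)%:Z.
Proof. by rewrite /height (unsplitK (inr i)). Qed.
Lemma height_bar a : height (bar a) = - height a.
Proof. by case: (letterP a) => i; rewrite ?(bar_l, bar_r, height_l, height_r) ?opprK. Qed.
Lemma height_inj a b : height a = height b -> a = b.
Proof.
case: (letterP a) (letterP b) => i [] j; rewrite ?(height_l, height_r);
have := ltn_ord i; have := ltn_ord j => lj li.
- by move=> e; congr lshift; apply: val_inj => /=; lia.
- lia.
- lia.
- by move=> e; congr rshift; apply: val_inj => /=; lia.
Qed.

Definition root_pair a b := (a != b) && (a != bar b).
Lemma root_pairC a b : root_pair a b = root_pair b a.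
Proof. by rewrite /root_pair eq_sym -bar_eq [bar a == b]eq_sym. Qed.
Lemma root_height_neq0 a b : root_pair a b -> height a + height b != 0.
Proof.
case/andP=> _; apply: contraNneq => e; apply/eqP/height_inj; rewrite height_bar.
by apply/eqP; rewrite -subr_eq0 opprK e.
Qed.

(** The coordinates are the true ones, not the doubled ones of [weight]; hence the factors 2 in the
    exponents below. *)
Definition wt (i : 'I_n) a : int := (a == lshift n i)%:Z - (a == rshift n i)%:Z.
End Letters.

Section Clifford.
Variables (C : numClosedFieldType) (n : nat).
Local Notation letter := 'I_(n + n).
Local Notation natural := 'rV[C]_(n + n).
Local Notation spinor := {ffun {set 'I_n} -> C^o}.
Implicit Types (v w : natural) (x y : spinor) (a b p q : letter) (c d z : C).

Lemma cliffordE w x : clifford w x = wedge (lsubmx w) x + contract (rsubmx w) x.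
Proof.
rewrite /clifford linfunE // => c y z; rewrite /clifford_fun !linearD !linearZ /=.
by rewrite addrACA.
Qed.

Lemma clifford_linear : linear (@clifford C n).
Proof.
move=> c v w; apply/lfunP=> x; rewrite !lfunE /= lfunE /= !cliffordE !linearD !linearZ /=.
by rewrite wedgeDl contractDl addrACA.
Qed.
HB.instance Definition _ := GRing.isLinear.Build C natural 'End(spinor) *:%R (@clifford C n) clifford_linear.

Definition bil v w : C := \sum_a v 0 a * w 0 (bar a).

Lemma bilE v w : bil v w =
  rdot (lsubmx v) (rsubmx w) + rdot (rsubmx v) (lsubmx w).
Proof.
rewrite /bil big_split_ord /=; congr (_ + _); apply: eq_bigr => i _;
by rewrite !mxE ?bar_l ?bar_r.
Qed.

Lemma bilC v w : bil v w = bil w v.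
Proof.
rewrite /bil (reindex_inj (@bar_inj n)) /=; apply: eq_bigr => a _.
by rewrite barK mulrC.
Qed.

Lemma bilDl c v w u : bil (c *: v + w) u = c * bil v u + bil w u.
Proof.
rewrite /bil mulr_sumr -big_split /=; apply: eq_bigr => a _.
by rewrite !mxE; ring.
Qed.

Lemma bilDr c v w u : bil u (c *: v + w) = c * bil u v + bil u w.
Proof. by rewrite ![bil u _]bilC bilDl. Qed.

Lemma bil_delta a v : bil (delta_mx 0 a) v = v 0 (bar a).
Proof.
rewrite /bil (bigD1 a) //= mxE !eqxx mul1r big1 ?addr0 // => b /negPf ba.
by rewrite mxE ba andbF mul0r.
Qed.

Lemma quadE w : quad w = rdot (lsubmx w) (rsubmx w).
Proof. by []. Qed.

Lemma bil_quad w : bil w w = 2 * quad w.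
Proof.
rewrite bilE quadE /rdot -big_split mulr_sumr /=; apply: eq_bigr => i _; ring.
Qed.

Lemma clifford_anticomm v w x :
  clifford v (clifford w x) = bil v w *: x - clifford w (clifford v x).
Proof.
rewrite !cliffordE !linearD /= (wedge_anticomm (lsubmx v)).
rewrite (contract_anticomm (rsubmx v)) !contract_wedge bilE.
have -> : rdot (lsubmx v) (rsubmx w) = rdot (rsubmx w) (lsubmx v).
  by apply: eq_bigr => i _; rewrite mulrC.
rewrite scalerDl.
apply/ffunP=> A; rewrite !ffunE /GRing.scale /=; ring.
Qed.

Lemma clifford_sq w x : clifford w (clifford w x) = quad w *: x.
Proof.
have := clifford_anticomm w w x; rewrite bil_quad => /eqP.
rewrite -subr_eq0 opprB addrA -mulr2n subr_eq0 -scaler_nat -scalerA.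
by move/eqP/(scalerI _)-> => //; rewrite pnatr_eq0.
Qed.

(** The anticommutator of v with a letter is a scalar operator, and that scalar is a coordinate of
    v. *)
Lemma clifford_inj : injective (@clifford C n).
Proof.
move=> v w e; apply/rowP=> a; rewrite -[a]barK -!bil_delta.
have := clifford_anticomm (delta_mx 0 (bar a)) v (ext_basis C set0).
rewrite e clifford_anticomm => /addIr /ffunP /(_ set0).
by rewrite !ffunE eqxx /GRing.scale /= !mulr1 => ->.
Qed.

Definition cl a x : spinor := clifford (delta_mx 0 a) x.
Lemma clD a x y : cl a (x + y) = cl a x + cl a y.
Proof. exact: linearD. Qed.
Lemma clZ a c x : cl a (c *: x) = c *: cl a x.
Proof. exact: linearZ. Qed.
Lemma clN a x : cl a (- x) = - cl a x.
Proof. exact: linearN. Qed.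
Lemma cl0 a : cl a 0 = 0.
Proof. exact: linear0. Qed.

Lemma bil_letters a b : bil (delta_mx 0 a) (delta_mx 0 b) = (a == bar b)%:R.
Proof. by rewrite bil_delta mxE eqxx bar_eq. Qed.

Lemma cl_anti a b x : a != bar b -> cl a (cl b x) = - cl b (cl a x).
Proof.
by move=> h; rewrite /cl clifford_anticomm bil_letters (negPf h) scale0r add0r.
Qed.
Lemma cl_sq a x : cl a (cl a x) = 0.
Proof.
rewrite /cl clifford_sq; have := bil_letters a a; rewrite bil_quad.
rewrite eq_sym (negPf (bar_neq a)) => /eqP; rewrite mulf_eq0 pnatr_eq0 /= => /eqP->.
by rewrite scale0r.
Qed.
Lemma cl_bar a x : cl a (cl (bar a) x) = x - cl (bar a) (cl a x).
Proof. by rewrite /cl clifford_anticomm bil_letters barK eqxx scale1r. Qed.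

(* Letters index the basis e_0, ..., e_{n-1}, f_0, ..., f_{n-1} of W; the roots
   are the sums of the weights of two letters a, b with [root_pair a b]. *)
Definition rootel a b c : 'End(spinor) :=
  \1%VF + c *: (clifford (delta_mx 0 a) \o clifford (delta_mx 0 b))%VF.
Lemma rootelE a b c x : rootel a b c x = x + c *: cl a (cl b x).
Proof. by rewrite /rootel add_lfunE scale_lfunE comp_lfunE id_lfunE. Qed.

(** Extends [torus] to all letters, the dual letter giving the inverse element ([torel_bar]), so
    that the identities on roots need not distinguish e from f. *)
Definition torel a z : 'End(spinor) :=
  z *: (clifford (delta_mx 0 a) \o clifford (delta_mx 0 (bar a)))%VF
  + z^-1 *: (clifford (delta_mx 0 (bar a)) \o clifford (delta_mx 0 a))%VF.
Lemma torelE a z x : torel a z x = z *: cl a (cl (bar a) x) + z^-1 *: cl (bar a) (cl a x).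
Proof. by rewrite /torel add_lfunE !scale_lfunE !comp_lfunE. Qed.

Lemma vec_eE i : vec_e C i = delta_mx 0 (lshift n i).
Proof.
apply/rowP=> a; rewrite /vec_e; case: (letterP a) => j; rewrite ?row_mxEl ?row_mxEr !mxE !eqxx /=.
  by rewrite eq_lshift.
by rewrite eq_rlshift.
Qed.
Lemma vec_fE i : vec_f C i = delta_mx 0 (rshift n i).
Proof.
apply/rowP=> a; rewrite /vec_f; case: (letterP a) => j; rewrite ?row_mxEl ?row_mxEr !mxE !eqxx /=.
  by rewrite eq_lrshift.
by rewrite eq_rshift.
Qed.

Lemma torusE i z : torus i z = torel (lshift n i) z.
Proof. by rewrite /torus vec_eE vec_fE /torel bar_l. Qed.
Lemma root_minusE i j c : root_minus i j c = rootel (lshift n i) (rshift n j) c.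
Proof. by rewrite /root_minus vec_eE vec_fE. Qed.
Lemma root_plusE i j c : root_plus i j c = rootel (lshift n i) (lshift n j) c.
Proof. by rewrite /root_plus !vec_eE. Qed.

Lemma rootelC a b c : a != bar b -> rootel a b c = rootel b a (- c).
Proof.
by move=> h; apply/lfunP=> x; rewrite !rootelE cl_anti // scalerN scaleNr.
Qed.

Lemma rootelD a b c d : a != bar b ->
  (rootel a b c \o rootel a b d)%VF = rootel a b (c + d).
Proof.
move=> h; apply/lfunP=> x; rewrite lfunE /= !rootelE !clD !clZ (cl_anti _ (_ : b != bar a)).
  by rewrite clN cl_sq oppr0 scaler0 addr0 scalerDl addrA addrAC.
by rewrite eq_sym bar_eq.
Qed.

Lemma rootel0 a b : rootel a b 0 = \1%VF.
Proof. by rewrite /rootel scale0r addr0. Qed.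

Lemma rootel_comm a b p q c d :
  p != bar a -> p != bar b -> q != bar a -> q != bar b ->
  (rootel a b c \o rootel p q d)%VF = (rootel p q d \o rootel a b c)%VF.
Proof.
move=> pa pb qa qb; apply/lfunP=> x; rewrite !lfunE /= !rootelE !clD !clZ.
have -> : cl a (cl b (cl p (cl q x))) = cl p (cl q (cl a (cl b x))).
  rewrite (cl_anti _ qa) clN (cl_anti _ pa) opprK; congr cl.
  by rewrite (cl_anti _ qb) clN (cl_anti _ pb) opprK.
by apply/ffunP=> A; rewrite !ffunE /GRing.scale /=; ring.
Qed.

End Clifford.

Section RootElements.
Variables (C : numClosedFieldType) (n : nat).
Local Notation letter := 'I_(n + n).
Local Notation natural := 'rV[C]_(n + n).
Local Notation spinor := {ffun {set 'I_n} -> C^o}.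
Implicit Types (v w : natural) (x y : spinor) (a b p q : letter) (c d z : C).

Lemma neq_barC a b : (a != bar b) = (b != bar a).
Proof. by rewrite -bar_eq eq_sym. Qed.

Lemma clNsq a x : - cl a (cl a x) = 0.
Proof. by apply/eqP; rewrite oppr_eq0 cl_sq. Qed.

(** The commutator relation of a simply laced root system: the weights of (a, b) and (bar b, q) add
    up to that of (a, q). The case q = a is included; the sum is then not a root and [rootel a q] is
    the identity. *)
Lemma rootel_bracket a b q c d :
  root_pair a b -> q != bar a -> q != b -> q != bar b ->
  (rootel a b c \o rootel (bar b) q d)%VF =
  (rootel (bar b) q d \o (rootel a q (c * d) \o rootel a b c))%VF.
Proof.
case/andP=> ab abb qa qb qbb; apply/lfunP=> x; rewrite !comp_lfunE !rootelE.
have EF y : cl a (cl b (cl (bar b) (cl q y))) =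
    cl a (cl q y) + cl (bar b) (cl q (cl a (cl b y))).
  rewrite cl_bar clD clN; congr (_ + _).
  rewrite [cl b (cl q _)]cl_anti 1?neq_barC //.
  rewrite !clN opprK [cl a (cl (bar b) _)]cl_anti ?barK //.
  by rewrite [cl a (cl q _)]cl_anti 1?neq_barC // clN opprK.
have KE y : cl a (cl q (cl a (cl b y))) = 0.
  by rewrite [cl q (cl a _)]cl_anti // clN clNsq.
have FK y : cl (bar b) (cl q (cl a (cl q y))) = 0.
  by rewrite [cl q (cl a _)]cl_anti // cl_sq cl0 clN cl0; exact: oppr0.
rewrite !(clD, clZ) EF KE FK !cl0.
apply/ffunP=> A; rewrite !ffunE /GRing.scale /=; ring.
Qed.

Lemma cl_bar_sandwich a x : cl a (cl (bar a) (cl a x)) = cl a x.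
Proof. by rewrite cl_bar cl_sq cl0 subr0. Qed.

Lemma torel_bar a z : torel (bar a) z = torel a z^-1.
Proof. by apply/lfunP=> x; rewrite !torelE barK invrK addrC. Qed.

Lemma torel_cl a z x : z != 0 -> torel a z (cl a x) = z ^+ 2 *: cl a (torel a z x).
Proof.
move=> z0; rewrite !torelE cl_bar_sandwich !(clD, clZ) !cl_sq cl_bar_sandwich cl0.
rewrite !scaler0 addr0 add0r scalerA; congr (_ *: _).
by rewrite expr2 mulfK.
Qed.

Lemma torel_cl_other a b z x : b != a -> b != bar a ->
  torel a z (cl b x) = cl b (torel a z x).
Proof.
move=> ba bba; rewrite !torelE !(clD, clZ).
have h y : cl a (cl b y) = - cl b (cl a y) by rewrite cl_anti // -bar_eq eq_sym.
have h' y : cl (bar a) (cl b y) = - cl b (cl (bar a) y).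
  by rewrite cl_anti // (inj_eq (@bar_inj n)) eq_sym.
by rewrite !(h, h', clN, opprK).
Qed.

Lemma torel_wt i a z x : z != 0 ->
  torel (lshift n i) z (cl a x) = z ^ (2 * wt i a) *: cl a (torel (lshift n i) z x).
Proof.
move=> z0; rewrite /wt; case: (eqVneq a (lshift n i)) => [->|al].
  by rewrite eq_lrshift /= subr0 mulr1 torel_cl.
case: (eqVneq a (rshift n i)) => [->|ar].
  have z1 : z^-1 != 0 by rewrite invr_eq0.
  have := torel_cl (rshift n i) x z1; rewrite -bar_l torel_bar invrK => ->.
  by rewrite exprVn sub0r mulrN1.
by rewrite subr0 mulr0 expr0z scale1r torel_cl_other // bar_l.
Qed.

Lemma torel_rootel i a b c z : z != 0 ->
  (torel (lshift n i) z \o rootel a b c)%VF =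
  (rootel a b (c * z ^ (2 * (wt i a + wt i b))) \o torel (lshift n i) z)%VF.
Proof.
move=> z0; apply/lfunP=> x; rewrite !comp_lfunE !rootelE linearD linearZ /=.
rewrite !torel_wt // clZ !scalerA -mulrA; congr (_ + (_ * _) *: _).
by rewrite -expfzDr // -mulrDr.
Qed.

Lemma torel_torel a z (u : C) x : torel a z (torel a u x) = torel a (z * u) x.
Proof.
 rewrite !torelE !(clD, clZ, clN) !cl_bar_sandwich !cl_sq.
rewrite !cl0 !scaler0 add0r addr0 !scalerA invfM.
by rewrite [z^-1 * _]mulrC.
Qed.

Lemma torelV a z : z != 0 -> (torel a z \o torel a z^-1)%VF = \1%VF.
Proof.
move=> z0; apply/lfunP=> x; rewrite comp_lfunE torel_torel mulfV //.
by rewrite torelE invr1 !scale1r cl_bar subrK lfunE.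
Qed.

Lemma rootelV a b c : a != bar b -> (rootel a b c \o rootel a b (- c))%VF = \1%VF.
Proof. by move=> h; rewrite rootelD // addrN rootel0. Qed.

(** In the SL_2 of a root, upper times lower unipotent equals lower times diagonal times upper as
    soon as 1 + c d is invertible. A square root of it enters because [torel a z] acts on W through
    z ^+ 2. *)
Lemma rootel_opp a b c d z : root_pair a b -> z != 0 -> z ^+ 2 = 1 + c * d ->
  (rootel a b c \o rootel (bar b) (bar a) d)%VF =
  (rootel (bar b) (bar a) (d / z ^+ 2) \o
   ((torel a z \o torel b z) \o rootel a b (c / z ^+ 2)))%VF.
Proof.
case/andP=> ab abb z0 zcd; apply/lfunP=> x.
(* E and F are the two root vectors, and P e is the projection onto the image of [cl e]. Everything
   reduces to E F = P a P b and F E = (1 - P a) (1 - P b). *)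
pose E y := cl a (cl b y); pose F y := cl (bar b) (cl (bar a) y).
pose P e y := cl e (cl (bar e) y).
have bba : b != bar a by rewrite neq_barC.
have an y : cl a (cl b y) = - cl b (cl a y) by rewrite cl_anti.
have anb y : cl a (cl (bar b) y) = - cl (bar b) (cl a y) by rewrite cl_anti ?barK.
have bna y : cl (bar a) (cl b y) = - cl b (cl (bar a) y).
  by rewrite cl_anti // (inj_eq (@bar_inj n)).
have bnb y : cl (bar a) (cl (bar b) y) = - cl (bar b) (cl (bar a) y).
  by rewrite cl_anti // barK eq_sym.
have Tx e y : torel e z y = z *: P e y + z^-1 *: (y - P e y).
  by rewrite torelE /P [in X in _ = _ + X]cl_bar opprB addrCA subrr addr0.
have PP y : P a (P b y) = E (F y).
  by rewrite /P /E /F bna bnb !clN opprK.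
have FE y : F (E y) = y - P a y - P b y + P a (P b y).
  have -> : F (E y) = cl (bar a) (cl a (cl (bar b) (cl b y))).
    by rewrite /F /E anb clN bnb opprK.
  have q e u : cl (bar e) (cl e u) = u - P e u.
    by rewrite /P [in RHS]cl_bar subKr.
  rewrite !q /P !(clD, clN); apply/ffunP=> A; rewrite !ffunE; ring.
have ED y y' : E (y + y') = E y + E y' by rewrite /E !clD.
have EZ k y : E (k *: y) = k *: E y by rewrite /E !clZ.
have FD y y' : F (y + y') = F y + F y' by rewrite /F !clD.
have FZ k y : F (k *: y) = k *: F y by rewrite /F !clZ.
have PD e y y' : P e (y + y') = P e y + P e y' by rewrite /P !clD.
have PN e y : P e (- y) = - P e y by rewrite /P !clN.
have PZ e k y : P e (k *: y) = k *: P e y by rewrite /P !clZ.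
have PaE y : P a (E y) = E y by rewrite /P /E cl_bar_sandwich.
have PbE y : P b (E y) = E y by rewrite /P /E an !clN cl_bar_sandwich.
have Fa y : F (P a y) = F y.
  rewrite /F /P; congr cl; rewrite -{2}[a]barK; exact: cl_bar_sandwich.
have FPb y : F (P b y) = F y.
  by rewrite /F /P bna bnb !clN opprK -{2}[b]barK cl_bar_sandwich.
rewrite !comp_lfunE !rootelE -!/(F _) -!/(E _).
have -> : torel a z (torel b z (x + (c / z ^+ 2) *: E x)) =
  x + c *: E x + (z ^+ 2 - 1) *: E (F x) + (z ^- 2 - 1) *: F (E x).
  rewrite !Tx !(PD, PZ, PN) !(PbE, PaE) FE -PP.
  by apply/ffunP=> A; rewrite !ffunE /GRing.scale /=; field.
have FF y : F (F y) = 0.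
  by rewrite /F bnb clN cl_sq; apply/eqP; rewrite oppr_eq0.
have FEF y : F (E (F y)) = F y by rewrite -PP Fa FPb.
rewrite !(ED, FD, EZ, FZ) FEF FF.
apply/ffunP=> A; rewrite !ffunE /GRing.scale /=.
have zz : 1 + c * d != 0 by rewrite -zcd expf_neq0.
rewrite zcd; field.
exact: zz.
Qed.

End RootElements.

Lemma inv_lfun_uniq (K : fieldType) (V : vectType K) (g h : 'End(V)) :
  (g \o h)%VF = \1%VF -> (h \o g)%VF = \1%VF -> g^-1%VF = h.
Proof.
move=> gh hg; have k0 : lker g == 0%VS.
  apply/lker0P=> x y e; rewrite -[x]id_lfunE -[y]id_lfunE -hg !comp_lfunE.
  by rewrite e.
by rewrite -[h]comp_lfun1l -(lker0_compVf k0) -comp_lfunA gh comp_lfun1r.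
Qed.

(** * Generation of the spin group by root and torus elements *)

Section SpinGroup.
Variables (C : numClosedFieldType) (n : nat).
Local Notation letter := 'I_(n + n).
Local Notation natural := 'rV[C]_(n + n).
Local Notation spinor := {ffun {set 'I_n} -> C^o}.
Implicit Types (v w : natural) (x y : spinor) (a b p q : letter) (c d z : C).
Implicit Types (g h k : 'End(spinor)) (s t : seq natural).

Definition prodcl s : 'End(spinor) :=
  foldr (fun w h => (clifford w \o h)%VF) \1%VF s.
Local Notation units := (all (fun w => quad w == 1)).

Lemma prodcl_cat s t : prodcl (s ++ t) = (prodcl s \o prodcl t)%VF.
Proof.
elim: s => [|w s IH] /=; first by rewrite comp_lfun1l.
by rewrite IH comp_lfunA.
Qed.

Lemma clifford_unit w : quad w == 1 -> (clifford w \o clifford w)%VF = \1%VF.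
Proof.
by move/eqP=> e; apply/lfunP=> x; rewrite comp_lfunE clifford_sq e scale1r lfunE.
Qed.

Lemma prodcl_revK s : units s -> (prodcl s \o prodcl (rev s))%VF = \1%VF.
Proof.
elim: s => [_|w s IH] /=; first by rewrite comp_lfun1l.
case/andP=> w1 /IH e; rewrite rev_cons -cats1 prodcl_cat /= comp_lfun1r.
by rewrite -comp_lfunA [(prodcl s \o _)%VF]comp_lfunA e comp_lfun1l clifford_unit.
Qed.

Lemma spin1 : spin (\1%VF : 'End(spinor)).
Proof. by exists [::]. Qed.

Lemma spinM g h : spin g -> spin h -> spin (g \o h)%VF.
Proof.
case=> s [us os ->] [t [ut ot ->]]; exists (s ++ t); split.
- by rewrite all_cat us.
- by rewrite size_cat oddD (negPf os) (negPf ot).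
- by rewrite -!/(prodcl _) prodcl_cat.
Qed.

Lemma spinV g : spin g ->
  [/\ spin g^-1%VF, (g \o g^-1)%VF = \1%VF & (g^-1 \o g)%VF = \1%VF].
Proof.
case=> s [us os ->]; rewrite -/(prodcl s).
have e1 := prodcl_revK us.
have us' : units (rev s) by rewrite all_rev.
have e2 := prodcl_revK us'; rewrite revK in e2.
rewrite (inv_lfun_uniq e1 e2); split=> //.
by exists (rev s); rewrite size_rev.
Qed.

Lemma bilZl c v w : bil (c *: v) w = c * bil v w.
Proof.
by rewrite /bil mulr_sumr; apply: eq_bigr => i _; rewrite mxE mulrA.
Qed.
Lemma bilAl v w u : bil (v + w) u = bil v u + bil w u.
Proof. by rewrite -[v]scale1r bilDl mul1r scale1r. Qed.
Lemma bilZr c v w : bil v (c *: w) = c * bil v w.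
Proof. by rewrite bilC bilZl bilC. Qed.
Lemma bilAr v w u : bil u (v + w) = bil u v + bil u w.
Proof. by rewrite bilC bilAl ![bil _ u]bilC. Qed.

Lemma quad_bil w : quad w = bil w w / 2.
Proof. by rewrite bil_quad mulrC mulKf // pnatr_eq0. Qed.

Lemma letter_nbar a : (a == bar a) = false.
Proof. by rewrite eq_sym (negPf (bar_neq a)). Qed.

Definition hyp a z : natural := z *: delta_mx 0 a + z^-1 *: delta_mx 0 (bar a).
Lemma quad_hyp a z : z != 0 -> quad (hyp a z) = 1.
Proof.
move=> z0; rewrite quad_bil /hyp !(bilAl, bilAr, bilZl, bilZr) !bil_letters barK.
rewrite !letter_nbar eqxx [bar a == a]eq_sym letter_nbar /=.
by rewrite !eqxx /=; field.
Qed.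

Lemma quad_hypD a b z c : z != 0 -> root_pair a b ->
  quad (hyp b z + c *: delta_mx 0 a) = 1.
Proof.
move=> z0 /andP[ab abb]; rewrite -(quad_hyp b z0) !quad_bil; congr (_ / _).
rewrite !(bilAl (hyp b z)) !(bilAr (hyp b z)) [bil (_ *: _) (hyp b z)]bilC /hyp.
rewrite !(bilAl, bilAr, bilZl, bilZr) !bil_letters !barK !letter_nbar.
have -> : (b == bar a) = false by apply: negbTE; rewrite neq_barC.
have -> : (bar b == bar a) = false.
  by rewrite (inj_eq (@bar_inj n)) eq_sym (negPf ab).
by rewrite /= !(mulr0, addr0).
Qed.

Lemma cliffordD v w x : clifford (v + w) x = clifford v x + clifford w x.
Proof. by rewrite raddfD add_lfunE. Qed.
Lemma cliffordZ c v x : clifford (c *: v) x = c *: clifford v x.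
Proof. by rewrite -[c *: v]addr0 clifford_linear raddf0 addr0 scale_lfunE. Qed.
Lemma cliffordN v x : clifford (- v) x = - clifford v x.
Proof. by rewrite raddfN opp_lfunE. Qed.

Lemma clvD v x y : clifford v (x + y) = clifford v x + clifford v y.
Proof. exact: linearD. Qed.
Lemma clvZ c v x : clifford v (c *: x) = c *: clifford v x.
Proof. exact: linearZ. Qed.

Lemma clE a x : clifford (delta_mx 0 a) x = cl a x.
Proof. by []. Qed.

Lemma clifford_sum v x : clifford v x = \sum_a v 0 a *: cl a x.
Proof.
rewrite {1}[v]row_sum_delta raddf_sum sum_lfunE; apply: eq_bigr => a _.
by rewrite cliffordZ.
Qed.

Lemma clifford_hyp a z x : clifford (hyp a z) x = z *: cl a x + z^-1 *: cl (bar a) x.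
Proof. by rewrite /hyp cliffordD !cliffordZ. Qed.

Lemma spin_rootel a b c : root_pair a b -> spin (rootel a b c : 'End(spinor)).
Proof.
move=> ab; have [/negPf nab /negPf nabb] := andP ab.
have n2 : (2 : C) != 0 by rewrite pnatr_eq0.
have n3 : (3 : C) != 0 by rewrite pnatr_eq0.
have n1 : (1 : C) != 0 by rewrite oner_eq0.
(* A pair (hyp b z + d a) (hyp b z) is 1 + d z (a b) + (d / z) (a bar b). For z = 2, d = 2 c / 3 and
   z = 1, d = - c / 3 the coefficients of a b add up to c and those of a bar b cancel. *)
pose v1 := hyp b 2 + (2 * c / 3) *: delta_mx 0 a.
pose v2 := hyp b 1 + (- c / 3) *: delta_mx 0 a.
exists [:: v1; hyp b 2; v2; hyp b 1]; split=> //.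
  by rewrite /= !quad_hyp // !quad_hypD // !eqxx.
apply/lfunP=> x; rewrite /= !comp_lfunE id_lfunE rootelE.
have step z d y : z != 0 -> clifford (hyp b z + d *: delta_mx 0 a) (clifford (hyp b z) y) =
    y + (d * z) *: cl a (cl b y) + (d / z) *: cl a (cl (bar b) y).
  move=> z0; rewrite cliffordD cliffordZ clifford_sq quad_hyp //.
  by rewrite clifford_hyp -/(cl a _) clD !clZ scalerDr !scalerA scale1r addrA.
rewrite !step // !(clD, clZ).
have ac y : cl b (cl a y) = - cl a (cl b y) by rewrite cl_anti // neq_barC nabb.
have acb y : cl (bar b) (cl a y) = - cl a (cl (bar b) y).
  by rewrite cl_anti // (inj_eq (@bar_inj n)) eq_sym nab.
rewrite !(ac, acb) !clN !cl_sq.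
apply/ffunP=> A; rewrite !ffunE /GRing.scale /=; field.
by rewrite ?n2 ?n3.
Qed.

Lemma spin_torel a z : z != 0 -> spin (torel a z : 'End(spinor)).
Proof.
move=> z0; exists [:: hyp a z; hyp a 1]; split=> //=.
  by rewrite !quad_hyp ?oner_eq0 // !eqxx.
apply/lfunP=> x; rewrite /= !comp_lfunE id_lfunE torelE !clifford_hyp invr1 !scale1r.
by rewrite !clD !cl_sq add0r addr0.
Qed.

(** The group generated by root and torus elements, the only ones on which a highest weight vector
    gives information. [spin_gen] shows that it contains the spin group. *)
Inductive gen : 'End(spinor) -> Prop :=
| Gen1 : gen \1%VF
| GenR a b c g : root_pair a b -> gen g -> gen (rootel a b c \o g)%VF
| GenT a z g : z != 0 -> gen g -> gen (torel a z \o g)%VF.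

Lemma genM g h : gen g -> gen h -> gen (g \o h)%VF.
Proof.
move=> gg gh; elim: gg => [|a b c k ab _ IH|a z k z0 _ IH].
- by rewrite comp_lfun1l.
- by rewrite -comp_lfunA; apply: GenR.
- by rewrite -comp_lfunA; apply: GenT.
Qed.

Lemma gen_rootel a b c : root_pair a b -> gen (rootel a b c).
Proof. by move=> ab; rewrite -[rootel _ _ _]comp_lfun1r; apply: GenR => //; exact: Gen1. Qed.
Lemma gen_torel a z : z != 0 -> gen (torel a z).
Proof. by move=> ab; rewrite -[torel _ _]comp_lfun1r; apply: GenT => //; exact: Gen1. Qed.

Lemma genV g : gen g -> exists h, [/\ gen h, (g \o h)%VF = \1%VF & (h \o g)%VF = \1%VF].
Proof.
elim=> [|a b c k ab _ [h [gh e1 e2]]|a z k z0 _ [h [gh e1 e2]]].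
- by exists \1%VF; rewrite comp_lfun1l; split=> //; exact: Gen1.
- have [_ abb] := andP ab.
  exists (h \o rootel a b (- c))%VF; split.
  + by apply: genM => //; exact: gen_rootel.
  + by rewrite -comp_lfunA [(k \o _)%VF]comp_lfunA e1 comp_lfun1l rootelV.
  + rewrite -comp_lfunA [(rootel _ _ _ \o _)%VF]comp_lfunA -{2}[c]opprK rootelV //.
    by rewrite comp_lfun1l.
- have z1 : z^-1 != 0 by rewrite invr_eq0.
  exists (h \o torel a z^-1)%VF; split.
  + by apply: genM => //; exact: gen_torel.
  + by rewrite -comp_lfunA [(k \o _)%VF]comp_lfunA e1 comp_lfun1l torelV.
  + rewrite -comp_lfunA [(torel _ _ \o _)%VF]comp_lfunA -{2}[z]invrK torelV //.
    by rewrite comp_lfun1l.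
Qed.

Lemma rootel_clifford a b c v : root_pair a b ->
  (rootel a b c \o clifford v)%VF =
  (clifford (v + c *: (v 0 (bar b) *: delta_mx 0 a - v 0 (bar a) *: delta_mx 0 b))
     \o rootel a b c)%VF.
Proof.
case/andP=> ab abb; apply/lfunP=> x; rewrite !comp_lfunE !rootelE.
rewrite cliffordD cliffordZ cliffordD cliffordN 2!cliffordZ 2!clE !(clD, clZ).
rewrite clvD clvZ.
have ve e y : cl e (clifford v y) = v 0 (bar e) *: y - clifford v (cl e y).
  by rewrite /cl clifford_anticomm bil_delta.
have ac y : cl b (cl a y) = - cl a (cl b y) by rewrite cl_anti // neq_barC.
rewrite !ve !(clD, clN, clZ) !ve ac !cl_sq cl0.
apply/ffunP=> A; rewrite !ffunE /GRing.scale /=; ring.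
Qed.

Lemma torel_clifford i z v : z != 0 ->
  (torel (lshift n i) z \o clifford v)%VF =
  (clifford (\row_a (z ^ (2 * wt i a) * v 0 a)) \o torel (lshift n i) z)%VF.
Proof.
move=> z0; apply/lfunP=> x; rewrite !comp_lfunE.
rewrite !clifford_sum raddf_sum /=; apply: eq_bigr => a _.
by rewrite linearZ /= torel_wt // mxE scalerA mulrC.
Qed.

(** Conjugacy of vectors inside the Clifford algebra, written without an inverse. *)
Definition orb w w' := exists2 g, gen g & (g \o clifford w)%VF = (clifford w' \o g)%VF.

Lemma orb_refl w : orb w w.
Proof. by exists \1%VF; [exact: Gen1 | rewrite comp_lfun1l comp_lfun1r]. Qed.

Lemma orb_trans w1 w2 w3 : orb w1 w2 -> orb w2 w3 -> orb w1 w3.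
Proof.
case=> g gg e [h gh f]; exists (h \o g)%VF; first exact: genM.
by rewrite -comp_lfunA e comp_lfunA f comp_lfunA.
Qed.

Lemma orb_quad w w' : orb w w' -> quad w = quad w'.
Proof.
case=> g /genV[h [_ _ hg]] e.
have e' x : g (clifford w x) = clifford w' (g x).
  by rewrite -[LHS]comp_lfunE e comp_lfunE.
have := clifford_sq w' (g (ext_basis C set0)); rewrite -!e' clifford_sq linearZ /=.
rewrite -!linearZ => /(congr1 h); rewrite -![h (g _)]comp_lfunE hg !id_lfunE.
by move/ffunP/(_ set0); rewrite !ffunE eqxx /GRing.scale /= !mulr1.
Qed.

Lemma orb_rootel a b c w : root_pair a b ->
  orb w (w + c *: (w 0 (bar b) *: delta_mx 0 a - w 0 (bar a) *: delta_mx 0 b)).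
Proof.
by move=> ab; exists (rootel a b c); [exact: gen_rootel | exact: rootel_clifford].
Qed.

Section Transitivity.
Variable i0 : 'I_n.
Let e0 : letter := lshift n i0.
Let f0 : letter := rshift n i0.
Let u0 : natural := delta_mx 0 e0 + delta_mx 0 f0.

Lemma orb_e0 w : quad w = 1 -> exists2 w', orb w w' & w' 0 e0 != 0.
Proof.
move=> q1; case: (eqVneq (w 0 e0) 0) => [we0|]; last by exists w => //; exact: orb_refl.
have [i wi] : exists i, w 0 (lshift n i) != 0.
  apply/existsP; apply: contraT; rewrite negb_exists => /forallP h.
  have := oner_neq0 C; rewrite -q1 /quad big1 ?eqxx // => i _.
  by have := h i; rewrite negbK !mxE => /eqP->; rewrite mul0r.
have ni : i0 != i by apply: contraNneq wi => <-; rewrite -/e0 we0.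
have rp : root_pair e0 (rshift n i).
  by rewrite /root_pair bar_r eq_lrshift eq_lshift.
eexists; first exact: (orb_rootel 1 w rp).
rewrite !mxE we0 add0r mul1r bar_r !eqxx mulr1 eq_lrshift /= mulr0 subr0.
by [].
Qed.

(** The root element of (b, f0) adds a multiple of the e0 coordinate to the b coordinate and
    otherwise changes only the f0 coordinate. Since the e0 coordinate is nonzero and stays fixed,
    the coordinates in l can be cleared one by one. *)
Lemma orb_clear w (l : seq letter) : w 0 e0 != 0 ->
  (forall b, b \in l -> (b != e0) && (b != f0)) ->
  exists w', [/\ orb w w', w' 0 e0 = w 0 e0, forall b, b \in l -> w' 0 b = 0 &
    forall b, b != e0 -> b != f0 -> w 0 b = 0 -> w' 0 b = 0].
Proof.
move=> we; elim: l => [_|b l IH hl]; first by exists w; split=> //; exact: orb_refl.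
have [|w1 [o1 e1 z1 k1]] := IH; first by move=> q ql; apply: hl; rewrite inE ql orbT.
have /andP[be bf] := hl b (mem_head _ _).
have rp : root_pair b f0 by rewrite /root_pair bf bar_r.
pose w2 := w1 + (- w1 0 b / w1 0 e0) *: (w1 0 (bar f0) *: delta_mx 0 b - w1 0 (bar b) *: delta_mx 0 f0).
have w2b : w2 0 b = 0.
  rewrite !mxE bar_r -/e0 !eqxx (negPf bf) mulr1 mulr0 subr0 mulfVK ?addrN //.
  by rewrite e1.
have w2o q : q != b -> q != f0 -> w2 0 q = w1 0 q.
  by move=> db df; rewrite !mxE (negPf db) (negPf df) !mulr0 subr0 mulr0 addr0.
exists w2; split.
- exact: orb_trans o1 (orb_rootel _ _ rp).
- by rewrite w2o ?e1 // 1?eq_sym // eq_sym /e0 /f0 eq_lrshift.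
- move=> d; rewrite inE => /orP[/eqP->//|dl].
  case: (eqVneq d b) => [->//|db]; rewrite w2o //; first exact: z1.
  by have /andP[] := hl d (mem_behead (s := b :: l) dl).
- move=> d de df wd; case: (eqVneq d b) => [->//|db]; rewrite w2o //; exact: k1.
Qed.

Lemma orb_u0 w : quad w == 1 -> orb w u0.
Proof.
move/eqP=> q1; have [w1 o1 n1] := orb_e0 q1.
have [|w2 [o2 _ z2 _]] := @orb_clear w1 [seq b <- enum 'I_(n + n) | (b != e0) && (b != f0)] n1.
  by move=> b; rewrite mem_filter => /andP[].
have {}z2 b : b != e0 -> b != f0 -> w2 0 b = 0.
  by move=> be bf; apply: z2; rewrite mem_filter be bf mem_enum.
have o := orb_trans o1 o2; have {}q1 : quad w2 = 1 by rewrite -(orb_quad o).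
have {}q1 : w2 0 e0 * w2 0 f0 = 1.
  rewrite -q1 /quad (bigD1 i0) //= !mxE big1 ?addr0 // => i ii.
  by rewrite !mxE z2 ?mul0r // ?eq_lshift // eq_lrshift.
have x0 : w2 0 e0 != 0 by apply: contra_eq_neq q1 => ->; rewrite mul0r eq_sym oner_eq0.
apply: orb_trans o _.
(* Only the e0 and f0 coordinates are left, and their product is 1. The torus multiplies them by z
   ^+ 2 and z ^- 2, so this z makes both equal to 1. *)
pose z := sqrtC (w2 0 e0)^-1.
have zz : z ^+ 2 = (w2 0 e0)^-1 by rewrite sqrtCK.
have z0 : z != 0 by rewrite -sqrf_eq0 zz invr_eq0.
exists (torel (lshift n i0) z); first exact: gen_torel.
rewrite torel_clifford //; congr (clifford _ \o _)%VF; apply/rowP=> a.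
rewrite !mxE eqxx /= /wt -/e0 -/f0.
case: (eqVneq a e0) => [->|ae].
  by rewrite eq_lrshift /= subr0 mulr1 -exprnP zz mulVf // addr0.
case: (eqVneq a f0) => [->|af].
  by rewrite sub0r mulrN1 -exprnN zz invrK q1 add0r.
by rewrite z2 // mulr0 addr0.
Qed.

End Transitivity.
End SpinGroup.

Section HermitianLinearity.
Variables (C : numClosedFieldType) (K : finType).
Implicit Types (x y z : {ffun K -> C^o}).
Lemma hermAl x y z : herm (x + y) z = herm x z + herm y z.
Proof. by rewrite -{1}[x]scale1r hermDl mul1r. Qed.
Lemma hermAr x y z : herm z (x + y) = herm z x + herm z y.
Proof. by rewrite -{1}[x]scale1r hermDr rmorph1 mul1r. Qed.
Lemma hermZl c x z : herm (c *: x) z = c * herm x z.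
Proof. by rewrite -[c *: x]addr0 hermDl herm0l addr0. Qed.
Lemma hermZr c x z : herm z (c *: x) = c^* * herm z x.
Proof. by rewrite hermC hermZl rmorphM /= -hermC. Qed.
End HermitianLinearity.

Section SpinRepresentations.
Variables (C : numClosedFieldType) (n : nat).
Local Notation letter := 'I_(n + n).
Local Notation natural := 'rV[C]_(n + n).
Local Notation spinor := {ffun {set 'I_n} -> C^o}.
Implicit Types (v w : natural) (x y : spinor) (a b p q : letter) (c d z : C).
Implicit Types (g h k : 'End(spinor)) (s t : seq natural).
Local Notation units := (all (fun w => quad w == 1)).

Section Generation.
Variable i0 : 'I_n.
Let e0 : letter := lshift n i0.
Let f0 : letter := rshift n i0.
Let u0 : natural := delta_mx 0 e0 + delta_mx 0 f0.
Let sw a : letter := if (a == e0) || (a == f0) then bar a else a.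
Let sg a : C := if (a == e0) || (a == f0) then 1 else -1.

Let swbar a : sw (bar a) = bar (sw a).
Proof.
by rewrite /sw !bar_eq /e0 /f0 bar_l bar_r orbC; case: ifP.
Qed.
Let sgbar a : sg (bar a) = sg a.
Proof. by rewrite /sg !bar_eq /e0 /f0 bar_l bar_r orbC. Qed.
Let sg2 a : sg a * sg a = 1.
Proof. by rewrite /sg; case: ifP; rewrite ?mulrNN mulr1. Qed.
Let swK : involutive sw.
Proof.
move=> a; rewrite {2}/sw; case: ifP => h; last by rewrite /sw h.
by rewrite swbar /sw h barK.
Qed.

Let u0_cl a x : clifford u0 (cl a x) = sg a *: cl (sw a) (clifford u0 x).
Proof.
rewrite /u0 !cliffordD !clE clD /sg /sw.
have ef : f0 = bar e0 by rewrite /e0 bar_l.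
have fe : e0 = bar f0 by rewrite ef barK.
case: (eqVneq a e0) => [->|ae] /=.
  by rewrite scale1r cl_sq add0r -ef cl_sq addr0.
case: (eqVneq a f0) => [->|af] /=.
  by rewrite scale1r cl_sq addr0 -fe cl_sq add0r.
rewrite scaleN1r opprD; congr (_ + _); apply: cl_anti.
  by rewrite neq_barC -ef.
by rewrite neq_barC -fe.
Qed.

(** Conjugation by u0 exchanges e0 and f0 and changes the sign of the other letters, so it permutes
    the root elements and the torus elements. *)
Lemma gen_conj_u0 g : gen g ->
  exists2 g', gen g' & (clifford u0 \o g)%VF = (g' \o clifford u0)%VF.
Proof.
elim=> [|a b c k ab _ [k' gk' e]|a z k z0 _ [k' gk' e]].
- by exists \1%VF; [exact: Gen1 | rewrite comp_lfun1l comp_lfun1r].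
- exists (rootel (sw a) (sw b) (sg a * sg b * c) \o k')%VF.
    apply: GenR => //; rewrite /root_pair -swbar !(inj_eq (can_inj swK)); exact: ab.
  rewrite -[RHS]comp_lfunA -e !comp_lfunA; congr (_ \o _)%VF.
  apply/lfunP=> x; rewrite !comp_lfunE !rootelE clvD clvZ !u0_cl !clZ !scalerA.
  by congr (_ + _ *: _); ring.
- exists (torel (sw a) z \o k')%VF; first exact: GenT.
  rewrite -[RHS]comp_lfunA -e !comp_lfunA; congr (_ \o _)%VF.
  apply/lfunP=> x; rewrite !comp_lfunE !torelE clvD !clvZ !u0_cl !clZ !scalerA.
  by rewrite !swbar !sgbar !sg2 !mulr1.
Qed.

Let quad_u0 : quad u0 == 1.
Proof.
have -> : u0 = hyp e0 1 by rewrite /hyp invr1 !scale1r /e0 bar_l.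
by rewrite quad_hyp ?oner_eq0.
Qed.

(** Writing v = g^-1 u0 g and w = h^-1 u0 h, the product is g^-1 (u0 g h^-1 u0) h, and u0 normalizes
    the generated group. *)
Lemma gen_pair v w : quad v == 1 -> quad w == 1 -> gen (clifford v \o clifford w)%VF.
Proof.
move=> v1 w1.
have [g gg eg] := orb_u0 i0 v1; have [h gh eh] := orb_u0 i0 w1.
have [g' [gg' gK1 gK2]] := genV gg; have [h' [gh' hK1 hK2]] := genV gh.
have [k gk ek] := gen_conj_u0 (genM gg gh').
have -> : (clifford v \o clifford w)%VF = (g' \o (k \o h))%VF; last by do 2?apply: genM.
have -> : clifford v = (g' \o (clifford u0 \o g))%VF.
  by rewrite -eg comp_lfunA gK2 comp_lfun1l.
have -> : clifford w = (h' \o (clifford u0 \o h))%VF.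
  by rewrite -eh comp_lfunA hK2 comp_lfun1l.
rewrite -!comp_lfunA; congr (_ \o _)%VF.
rewrite [(g \o _)%VF]comp_lfunA comp_lfunA ek -!comp_lfunA; congr (_ \o _)%VF.
by rewrite comp_lfunA clifford_unit ?quad_u0 // comp_lfun1l.
Qed.

Lemma spin_gen g : spin g -> gen g.
Proof.
case=> s [us os ->]; rewrite -/(prodcl s).
elim: (size s).+1 {-2}s (ltnSn (size s)) us os => // m IH [|v [|w t]] //= lt.
  by move=> _ _; exact: Gen1.
case/and3P=> v1 w1 t1; rewrite negbK => ot.
rewrite comp_lfunA; apply: genM; first exact: gen_pair.
by apply: IH => //; rewrite -ltnS (leq_trans _ lt).
Qed.

End Generation.

(** For w of norm 1 this is w v w^-1 in the Clifford algebra, hence minus the usual reflection. *)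
Definition refl w v : natural := bil w v *: w - v.

Lemma clifford_refl w v : quad w = 1 ->
  (clifford w \o clifford v)%VF = (clifford (refl w v) \o clifford w)%VF.
Proof.
move=> w1; apply/lfunP=> x; rewrite !comp_lfunE /refl cliffordD cliffordN cliffordZ.
by rewrite clifford_sq w1 scale1r clifford_anticomm.
Qed.

Lemma prodcl_clifford s v : units s ->
  (prodcl s \o clifford v)%VF = (clifford (foldr refl v s) \o prodcl s)%VF.
Proof.
elim: s => [_|w s IH] /=; first by rewrite comp_lfun1l comp_lfun1r.
case/andP=> /eqP w1 /IH e; rewrite -comp_lfunA e comp_lfunA clifford_refl //.
by rewrite comp_lfunA.
Qed.

(** Characterizes the vector representation by the relation g v = v' g, which spares the inverses of
    its definition from here on. *)
Lemma natural_act_eq g v v' : spin g ->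
  (g \o clifford v)%VF = (clifford v' \o g)%VF -> natural_act g v = v'.
Proof.
move=> /spinV[_ gV _] e; rewrite /natural_act linfunE; last first.
  move=> c u w; rewrite clifford_linear comp_lfunDr comp_lfunDl -comp_lfunZr -comp_lfunZl.
  exact: linearP.
rewrite e -comp_lfunA gV comp_lfun1r.
have k0 : lker (linfun (@clifford C n)) == 0%VS.
  by apply/lker0P=> u w; rewrite !linfunE; try exact: clifford_linear; exact: clifford_inj.
rewrite -{1}[clifford v'](linfunE (@clifford_linear C n)).
by rewrite lker0_lfunK.
Qed.

Lemma natural_act_prodcl s v : units s -> ~~ odd (size s) ->
  natural_act (prodcl s) v = foldr refl v s.
Proof.
by move=> us os; apply: natural_act_eq; [exists s | exact: prodcl_clifford].
Qed.

Lemma natural_actP g v : spin g ->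
  (g \o clifford v)%VF = (clifford (natural_act g v) \o g)%VF.
Proof.
by case=> s [us os ->]; rewrite -/(prodcl s) natural_act_prodcl // prodcl_clifford.
Qed.

Lemma natural_act_apply g v x : spin g ->
  g (clifford v x) = clifford (natural_act g v) (g x).
Proof. by move=> sg; rewrite -comp_lfunE natural_actP // comp_lfunE. Qed.

Lemma natural_act1 : natural_act (\1%VF : 'End(spinor)) = \1%VF.
Proof.
apply/lfunP=> v; rewrite lfunE; apply: natural_act_eq; first exact: spin1.
by rewrite comp_lfun1l comp_lfun1r.
Qed.

Lemma natural_actM g h : spin g -> spin h ->
  natural_act (g \o h)%VF = (natural_act g \o natural_act h)%VF.
Proof.
move=> sg sh; apply/lfunP=> v; rewrite comp_lfunE.
apply: natural_act_eq; first exact: spinM.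
by rewrite -comp_lfunA natural_actP // comp_lfunA natural_actP // comp_lfunA.
Qed.

Lemma natural_act_rootel a b c v : root_pair a b ->
  natural_act (rootel a b c) v =
  v + c *: (v 0 (bar b) *: delta_mx 0 a - v 0 (bar a) *: delta_mx 0 b).
Proof.
by move=> ab; apply: natural_act_eq; [exact: spin_rootel | exact: rootel_clifford].
Qed.

Lemma natural_act_torel i z v : z != 0 ->
  natural_act (torel (lshift n i) z) v = \row_a (z ^ (2 * wt i a) * v 0 a).
Proof.
by move=> ab; apply: natural_act_eq; [exact: spin_torel | exact: torel_clifford].
Qed.

Definition dag w : natural := \row_a (w 0 (bar a))^*.

Lemma clifford_adj w x y : herm (clifford w x) y = herm x (clifford (dag w) y).
Proof.
have cadj (v : 'rV[C]_n) x' y' : herm (contract v x') y' = herm x' (wedge (map_mx Num.conj v) y').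
  rewrite hermC [RHS]hermC wedge_adj; congr (_^*); congr (herm _ (contract _ _)).
  by apply/rowP=> i; rewrite !mxE conjCK.
have -> : clifford (dag w) y =
    wedge (map_mx Num.conj (rsubmx w)) y + contract (map_mx Num.conj (lsubmx w)) y.
  rewrite cliffordE; congr (wedge _ _ + contract _ _); apply/rowP=> i.
    by rewrite !mxE bar_l.
  by rewrite !mxE bar_r.
by rewrite cliffordE hermAl hermAr wedge_adj cadj addrC.
Qed.

Lemma quad_dag w : quad (dag w) = (quad w)^*.
Proof.
rewrite /quad rmorph_sum; apply: eq_bigr => i _.
by rewrite !mxE bar_l bar_r rmorphM mulrC.
Qed.

Lemma units_dag s : units s -> units (rev (map dag s)).
Proof.
rewrite all_rev all_map => us; apply: sub_all us => w /eqP e.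
by rewrite /= quad_dag e rmorph1.
Qed.

Lemma prodcl_adj s x y : herm (prodcl s x) y = herm x (prodcl (rev (map dag s)) y).
Proof.
elim: s x y => [|w s IH] x y /=; first by rewrite !lfunE.
rewrite comp_lfunE clifford_adj IH rev_cons -cats1 prodcl_cat comp_lfunE /=.
by rewrite comp_lfunE lfunE.
Qed.

Lemma refl_adj w v u : rdot (refl w v) (map_mx Num.conj u) =
  rdot v (map_mx Num.conj (refl (dag w) u)).
Proof.
have e1 : bil w v = rdot v (map_mx Num.conj (dag w)).
  by rewrite bilC /bil; apply: eq_bigr => a _; rewrite !mxE conjCK.
have e2 : (bil (dag w) u)^* = rdot w (map_mx Num.conj u).
  rewrite bilC /bil rmorph_sum; apply: eq_bigr => a _.
  by rewrite rmorphM !mxE /= conjCK barK mulrC.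
transitivity (bil w v * rdot w (map_mx Num.conj u) - rdot v (map_mx Num.conj u)).
  rewrite /rdot mulr_sumr -sumrB; apply: eq_bigr => a _; rewrite !mxE; ring.
rewrite e1 -e2 mulrC /rdot mulr_sumr -sumrB; apply: eq_bigr => a _.
by rewrite !mxE rmorphB rmorphM /=; ring.
Qed.

Definition isadj g g' := forall x y, herm (g x) y = herm x (g' y).

Lemma isadj_uniq g h h' : isadj g h -> isadj g h' -> h = h'.
Proof. by move=> e e'; apply/lfunP=> y; apply: herm_ext => z; rewrite -e -e'. Qed.

(** The adjoint of a product of unit vectors is the reversed product of the vectors [dag w], again
    of norm 1. With this closure, orthogonal complements of stable subspaces are stable. *)
Lemma spin_adj g : spin g -> exists2 g', spin g' & isadj g g'.
Proof.
case=> s [us os ->]; exists (prodcl (rev (map dag s))); last exact: prodcl_adj.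
by exists (rev (map dag s)); rewrite size_rev size_map units_dag.
Qed.

Lemma isadj_sym g g' : isadj g g' -> isadj g' g.
Proof. by move=> e x y; rewrite hermC -e -hermC. Qed.

Lemma natural_act_adj g g' : spin g -> isadj g g' -> forall v u,
  rdot (natural_act g v) (map_mx Num.conj u) =
  rdot v (map_mx Num.conj (natural_act g' u)).
Proof.
case=> s [us os ->]; rewrite -/(prodcl s) => ad v u.
have -> : g' = prodcl (rev (map dag s)) by apply: isadj_uniq ad _; exact: prodcl_adj.
have us' := units_dag us.
rewrite natural_act_prodcl // natural_act_prodcl ?size_rev ?size_map //.
elim: s {us os us' ad} v u => //= w s IH v u.
by rewrite refl_adj IH rev_cons foldr_rcons.
Qed.

Lemma cl_adj a x y : herm (cl a x) y = herm x (cl (bar a) y).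
Proof.
rewrite /cl clifford_adj; congr (herm _ (clifford _ _)).
by apply/rowP=> i; rewrite !mxE eqxx bar_eq rmorph_nat.
Qed.

Lemma rootel_adj a b c : isadj (rootel a b c) (rootel (bar b) (bar a) c^*).
Proof.
by move=> x y; rewrite !rootelE hermAl hermAr hermZl hermZr conjCK !cl_adj.
Qed.

Lemma torel_adj a z : isadj (torel a z) (torel a z^*).
Proof.
move=> x y; rewrite !torelE !hermAl !hermAr !hermZl !hermZr !cl_adj !barK conjCK.
by rewrite -fmorphV conjCK.
Qed.

End SpinRepresentations.

(** * Highest weight theory *)

Section LinearAlgebra.
Variable C : numClosedFieldType.
Implicit Types (U V W : vectType C) (c z : C).

Lemma poly_eq0_off (p : {poly C}) c0 : (forall c, c != c0 -> p.[c] = 0) -> p = 0.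
Proof.
move=> h; apply/eqP; apply: contraT => p0.
pose s := [seq c0 + i.+1%:R | i <- iota 0 (size p)].
have us : uniq s.
  by rewrite map_inj_uniq ?iota_uniq // => i j /addrI/eqP; rewrite eqr_nat => /eqP[].
have := max_poly_roots p0 _ us; rewrite size_map size_iota ltnn; apply.
apply/allP=> _ /mapP[i _ ->]; apply/eqP/h.
by rewrite -subr_eq0 addrAC addrN add0r pnatr_eq0.
Qed.

(** Polynomial maps from the line to V, as lists of monomials (degree, coefficient) with repetitions
    allowed: closure under sums, linear maps and bilinear maps is then list manipulation. *)
Definition pcurve V (F : C -> V) := exists l : seq (nat * V),
  forall c, F c = \sum_(t <- l) c ^+ t.1 *: t.2.

Lemma pcurve_ext V (F G : C -> V) : F =1 G -> pcurve F -> pcurve G.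
Proof. by move=> e [l h]; exists l => c; rewrite -e. Qed.

Lemma pcurve_const V (x : V) : pcurve (fun _ => x).
Proof. by exists [:: (0%N, x)] => c; rewrite big_seq1 expr0 scale1r. Qed.

Lemma pcurveD V (F G : C -> V) : pcurve F -> pcurve G -> pcurve (fun c => F c + G c).
Proof. by move=> [l h] [m k]; exists (l ++ m) => c; rewrite big_cat /= h k. Qed.

Lemma pcurve_lin V W (f : 'Hom(V, W)) (F : C -> V) :
  pcurve F -> pcurve (fun c => f (F c)).
Proof.
move=> [l h]; exists [seq (t.1, f t.2) | t <- l] => c.
by rewrite h linear_sum big_map; apply: eq_bigr => t _; rewrite linearZ.
Qed.

Lemma pcurve_bilin U V W (B : U -> V -> W) (F : C -> U) (G : C -> V) :
  (forall u, linear (B u)) -> (forall v, linear (B^~ v)) ->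
  pcurve F -> pcurve G -> pcurve (fun c => B (F c) (G c)).
Proof.
move=> Br Bl [l h] [m k].
exists [seq ((t.1 + u.1)%N, B t.2 u.2) | t <- l, u <- m] => c.
rewrite big_allpairs_dep h k /=.
have BD v : forall (I : Type) (r : seq I) (H : I -> U) (e : I -> C),
    B (\sum_(i <- r) e i *: H i) v = \sum_(i <- r) e i *: B (H i) v.
  move=> I r H e; elim/big_rec2: _ => [|i y x _ <-]; last by rewrite Bl.
  by have := Bl v (-1) 0 0; rewrite scaler0 addr0 scaleN1r addNr.
have BD' v : forall (I : Type) (r : seq I) (H : I -> V) (e : I -> C),
    B v (\sum_(i <- r) e i *: H i) = \sum_(i <- r) e i *: B v (H i).
  move=> I r H e; elim/big_rec2: _ => [|i y x _ <-]; last by rewrite Br.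
  by have := Br v (-1) 0 0; rewrite scaler0 addr0 scaleN1r addNr.
rewrite BD; apply: eq_bigr => t _; rewrite BD' scaler_sumr; apply: eq_bigr => u _.
by rewrite scalerA exprD.
Qed.

Lemma pcurve_scale V (F : C -> V) (k : nat) :
  pcurve F -> pcurve (fun c => c ^+ k *: F c).
Proof.
move=> [l h]; exists [seq ((k + t.1)%N, t.2) | t <- l] => c.
by rewrite h scaler_sumr big_map; apply: eq_bigr => t _; rewrite scalerA exprD.
Qed.

Lemma pcurve_apply V W (F : C -> 'Hom(V, W)) (G : C -> V) :
  pcurve F -> pcurve G -> pcurve (fun c => F c (G c)).
Proof.
move=> hF hG.
apply: (pcurve_bilin (B := fun (f : 'Hom(V, W)) (x : V) => f x) _ _ hF hG) => [f|v] a x y /=.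
  by rewrite linearP.
by rewrite add_lfunE scale_lfunE.
Qed.

Lemma pcurve_reparam V (F : C -> V) (k : C) (d : nat) :
  pcurve F -> pcurve (fun c => F (k * c ^+ d)).
Proof.
move=> [l h]; exists [seq ((d * t.1)%N, k ^+ t.1 *: t.2) | t <- l] => c.
rewrite h big_map; apply: eq_bigr => t _.
by rewrite exprMn -exprM scalerA mulrC.
Qed.

Lemma pcurve_sum V (I : Type) (r : seq I) (F : I -> C -> V) :
  (forall i, pcurve (F i)) -> pcurve (fun c => \sum_(i <- r) F i c).
Proof.
move=> h; elim: r => [|i r IH].
  by apply: pcurve_ext (pcurve_const 0) => c; rewrite big_nil.
by apply: pcurve_ext (pcurveD (h i) IH) => c; rewrite big_cons.
Qed.

Definition coordl V (i : 'I_(\dim (fullv : {vspace V}))) : V -> C :=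
  coord (vbasis fullv) i.

Lemma coordl_eq0 V (x : V) : (forall i, coordl i x = 0) -> x = 0.
Proof.
move=> h; rewrite (coord_vbasis (memvf x)) big1 // => i _.
by have := h i; rewrite /coordl => ->; rewrite scale0r.
Qed.

Lemma pcurve_vanish V (F : C -> V) c0 :
  pcurve F -> (forall c, c != c0 -> F c = 0) -> forall c, F c = 0.
Proof.
move=> [l h] F0 c; apply: coordl_eq0 => i.
pose p : {poly C} := \sum_(t <- l) coordl i t.2 *: 'X^(t.1).
have pE z : p.[z] = coordl i (F z).
  rewrite h /p horner_sum /coordl linear_sum; apply: eq_bigr => t _.
  by rewrite hornerZ hornerXn linearZ /= mulrC.
have p0 : p = 0.
  by apply: (poly_eq0_off (c0 := c0)) => z /F0 e; rewrite pE e /coordl linear0.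
by rewrite -pE p0 horner0.
Qed.

(** Takes the place of Zariski closedness of a subspace: apply [pcurve_vanish] to the curve composed
    with a linear map whose kernel is K. *)
Lemma pcurve_mem V (K : {vspace V}) (F : C -> V) c0 :
  pcurve F -> (forall c, c != c0 -> F c \in K) -> forall c, F c \in K.
Proof.
move=> hF FK c.
pose f : 'End(V) := (\1 - projv K)%VF.
have fK x : (f x == 0) = (x \in K).
  rewrite /f add_lfunE opp_lfunE id_lfunE subr_eq0; apply/eqP/idP => [->|xK].
    exact: memv_proj.
  by rewrite projv_id.
rewrite -fK; apply/eqP.
apply: (pcurve_vanish (c0 := c0) (F := fun c => f (F c))); first exact: pcurve_lin.
by move=> z /FK; rewrite -fK => /eqP.
Qed.

(** Adjoin vectors satisfying P as long as one lies outside the space built so far; the dimension of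
    V bounds the number of rounds. As P is undecided, excluded middle is used. *)
Lemma subspace_vspace V (P : V -> Prop) :
  P 0 -> (forall c x y, P x -> P y -> P (c *: x + y)) ->
  exists K : {vspace V}, forall x, x \in K <-> P x.
Proof.
move=> P0 PD.
have Ps x y : P x -> P y -> P (x + y) by move=> px py; rewrite -[x]scale1r; exact: PD.
have Pz c x : P x -> P (c *: x) by move=> px; rewrite -[_ *: _]addr0; exact: PD.
suff [K [KP PK]] : exists K : {vspace V}, (forall x, x \in K -> P x) /\
    forall x, P x -> x \in K by exists K => x; split; [exact: KP | exact: PK].
pose d := \dim (fullv : {vspace V}).
suff: forall m (K : {vspace V}), (forall x, x \in K -> P x) -> (d - \dim K < m)%N ->
   exists K : {vspace V}, (forall x, x \in K -> P x) /\ forall x, P x -> x \in K.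
  move/(_ (d - 0).+1 0%VS); apply; last by rewrite dimv0.
  by move=> x; rewrite memv0 => /eqP->.
elim=> // m IH K KP lt.
have [[x [px xK]]|nx] := boolp.EM (exists x, P x /\ x \notin K); last first.
  exists K; split=> // x px; apply: contraT => xK; case: nx; by exists x.
apply: (IH (K + <[x]>)%VS).
  by move=> y /memv_addP[u uK [w /vlineP[c ->] ->]]; apply: Ps; [exact: KP | exact: Pz].
have ds : (\dim K < \dim (K + <[x]>))%N.
  rewrite ltn_neqAle dimvS ?addvSl // andbT; apply: contraNneq xK => e.
  have : (K == K + <[x]>)%VS by rewrite eqEdim addvSl -e leqnn.
  by move/eqP->; apply: (subvP (addvSr _ _)); exact: memv_line.
have := dimvS (subvf (K + <[x]>)%VS); rewrite -/d => le.
by rewrite -ltnS (leq_trans _ lt) // ltnS ltn_sub2l // (leq_trans ds).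
Qed.

Lemma functional_sep V (K : {vspace V}) (v : V) : v \notin K ->
  exists l : 'Hom(V, C^o), l v = 1 /\ forall x, x \in K -> l x = 0.
Proof.
move=> vK; pose f : 'End(V) := (\1 - projv K)%VF.
have fK x : (f x == 0) = (x \in K).
  rewrite /f add_lfunE opp_lfunE id_lfunE subr_eq0; apply/eqP/idP => [->|xK].
    exact: memv_proj.
  by rewrite projv_id.
have [i ci] : exists i, coordl i (f v) != 0.
  apply/existsP; apply: contraNT vK; rewrite negb_exists => /forallP h.
  rewrite -fK; apply/eqP/coordl_eq0 => i; have := h i; by rewrite negbK => /eqP.
pose l : 'Hom(V, C^o) := linfun (fun x => (coordl i (f v))^-1 * coordl i (f x) : C^o).
have lE x : l x = (coordl i (f v))^-1 * coordl i (f x).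
  rewrite /l linfunE // => c y z; rewrite linearP /coordl linearP /=.
  by rewrite /GRing.scale /=; ring.
exists l; split; first by rewrite lE mulVf.
by move=> x; rewrite -fK lE => /eqP->; rewrite /coordl linear0 mulr0.
Qed.

End LinearAlgebra.

Section OrthogonalProjection.
Variables (C : numClosedFieldType) (T : finType).
Local Notation sp := {ffun T -> C^o}.

Lemma orth_proj_seq (s : seq sp) (x : sp) :
  exists2 p, p \in <<s>>%VS & forall y, y \in <<s>>%VS -> herm (x - p) y = 0.
Proof.
elim: s x => [|u s IH] x.
  exists 0; first exact: mem0v.
  by move=> y; rewrite span_nil memv0 => /eqP->; rewrite hermC herm0l rmorph0.
have [pu pus hu] := IH u; have [px pxs hx] := IH x.
have sub y : y \in <<s>>%VS -> y \in <<u :: s>>%VS.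
  by move=> ys; rewrite span_cons; apply: (subvP (addvSr _ _)).
have us : u \in <<u :: s>>%VS by apply: memv_span; exact: mem_head.
pose u' := u - pu.
(* Gram-Schmidt. If u already lies in the span, then u' = 0 and the division by 0 is harmless, since
   c multiplies u'. *)
pose c := herm x u' / herm u' u'.
have hu' y : y \in <<s>>%VS -> herm u' y = 0 by exact: hu.
have hpu' y : y \in <<s>>%VS -> herm y u' = 0 by move=> ys; rewrite hermC hu' // rmorph0.
exists (px + c *: u').
  apply: memvD; first exact: sub.
  by apply/memvZ/memvB => //; exact: sub.
move=> y; rewrite span_cons => /memv_addP[_ /vlineP[a ->] [t ts ->]].
have -> : a *: u + t = a *: u' + (a *: pu + t).
  by rewrite /u' scalerBr addrA subrK.
have ts' : a *: pu + t \in <<s>>%VS by rewrite memvD // memvZ.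
have -> : x - (px + c *: u') = (x - px) + (- c) *: u' by rewrite opprD addrA scaleNr.
move: (a *: pu + t) ts' => t' ts'.
rewrite hermAl hermZl !hermAr !hermZr. rewrite (hx _ ts') (hu' _ ts') !addr0.
have -> : herm (x - px) u' = herm x u'.
  by rewrite hermAl -scaleN1r hermZl (hpu' _ pxs) mulr0 addr0.
case: (eqVneq u' 0) => [->|n0].
  by rewrite herm0l [herm x 0]hermC herm0l rmorph0 !mulr0 addr0.
have h0 : herm u' u' != 0 by rewrite herm_eq0.
by rewrite /c; field.
Qed.

Lemma orth_proj (K : {vspace sp}) (x : sp) :
  exists2 p, p \in K & forall y, y \in K -> herm (x - p) y = 0.
Proof. by have := orth_proj_seq (vbasis K) x; rewrite (span_basis (vbasisP K)). Qed.

End OrthogonalProjection.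

Lemma height_step (x y z : int) (m : nat) :
  x + y < m.+1%:Z -> - y + z < 0 -> x + z < m%:Z.
Proof. by lia. Qed.

Lemma lt_absz_S (x : int) : x < (absz (x)%R).+1%:Z.
Proof. by lia. Qed.

Lemma double_neg (x : int) : x < 0 -> 2 * x = - (2 * (absz (x)%R))%N%:Z.
Proof. by lia. Qed.

(** * The module generated by a highest weight vector *)

Section HighestWeight.
Variables (C : numClosedFieldType) (n : nat).
Local Notation letter := 'I_(n + n).
Local Notation spinor := {ffun {set 'I_n} -> C^o}.
Implicit Types (a b p q : letter) (c d z : C) (g h k : 'End(spinor)).

Definition negpair a b := root_pair a b && (height a + height b < 0).
Definition pospair a b := root_pair a b && (0 < height a + height b).

(** Of rationality only polynomial dependence on the root parameters is kept; this form passes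
    easily to sums, tensor products and submodules. *)
Definition is_rep (V : vectType C) (r : 'End(spinor) -> 'End(V)) :=
  [/\ r \1%VF = \1%VF,
      forall g h, spin g -> spin h -> r (g \o h)%VF = (r g \o r h)%VF
    & forall a b, root_pair a b -> pcurve (fun c => r (rootel a b c))].

Definition hwv (V : vectType C) (r : 'End(spinor) -> 'End(V)) (lam : weight n) (v : V) :=
  (forall i z, z != 0 -> r (torel (lshift n i) z) v = z ^ lam i *: v) /\
  (forall a b c, pospair a b -> r (rootel a b c) v = v).

Definition letters := (letter * letter * C)%type.
Definition negword (w : seq letters) := all (fun t => negpair t.1.1 t.1.2) w.
Definition wact (w : seq letters) : 'End(spinor) :=
  foldr (fun t g => (rootel t.1.1 t.1.2 t.2 \o g)%VF) \1%VF w.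

Lemma spin_wact w : negword w -> spin (wact w).
Proof.
elim: w => [_|t w IH] /=; first exact: spin1.
by case/andP=> /andP[rp _] /IH sw; apply: spinM => //; exact: spin_rootel.
Qed.

Section Orbit.
Variables (V : vectType C) (r : 'End(spinor) -> 'End(V)) (lam : weight n) (v : V).
Hypotheses (hr : is_rep r) (hv : hwv r lam v).

Let rM g h x : spin g -> spin h -> r (g \o h)%VF x = r g (r h x).
Proof. by case: hr => _ hM _ sg sh; rewrite hM // comp_lfunE. Qed.
Let r1 x : r \1%VF x = x.
Proof. by case: hr => -> _ _; rewrite lfunE. Qed.

(** Depends on the formal combination and not on the vector that it represents; [comb_eq0_aug] is
    what turns it into a linear form on the module. *)
Definition aug (l : seq (C * seq letters)) : C := \sum_(t <- l) t.1.
Definition comb (l : seq (C * seq letters)) : V :=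
  \sum_(t <- l) t.1 *: r (wact t.2) v.
Definition goodl (l : seq (C * seq letters)) := all (fun t => negword t.2) l.

Lemma comb_lin (l m : seq (C * seq letters)) c : goodl l -> goodl m ->
  exists l', [/\ goodl l', comb l' = c *: comb l + comb m & aug l' = c * aug l + aug m].
Proof.
move=> gl gm; exists ([seq (c * t.1, t.2) | t <- l] ++ m); split.
- by rewrite /goodl all_cat all_map; apply/andP; split; [exact: gl | exact: gm].
- rewrite /comb big_cat big_map scaler_sumr /=; congr (_ + _).
  by apply: eq_bigr => t _; rewrite scalerA.
- by rewrite /aug big_cat big_map mulr_sumr.
Qed.

Lemma wact_nil_comb : comb [:: (1, [::])] = v.
Proof. by rewrite /comb big_seq1 scale1r r1. Qed.

Lemma orbit_space : exists K : {vspace V}, forall x, x \in K <->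
  exists l, goodl l /\ x = comb l.
Proof.
apply: subspace_vspace.
  by exists [::]; split=> //; rewrite /comb big_nil.
move=> c x y [l [gl ->]] [m [gm ->]].
by have [l' [gl' e _]] := comb_lin c gl gm; exists l'.
Qed.

Section Space.
Variable K : {vspace V}.
Hypothesis hK : forall x, x \in K <-> exists l, goodl l /\ x = comb l.

Let memw w : negword w -> r (wact w) v \in K.
Proof.
move=> hw; apply/hK; exists [:: (1, w)]; split; first by rewrite /goodl /= hw.
by rewrite /comb big_seq1 scale1r.
Qed.

Let closed (f : 'End(V)) :
  (forall w, negword w -> f (r (wact w) v) \in K) -> forall x, x \in K -> f x \in K.
Proof.
move=> h x /hK[l [gl ->]]; rewrite /comb linear_sum big_seq memv_suml // => t tl.
by rewrite linearZ memvZ // h //; exact: (allP gl).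
Qed.

Let neg_closed a b c x : negpair a b -> x \in K -> r (rootel a b c) x \in K.
Proof.
move=> ab; apply: closed => w hw.
rewrite -rM; [|by apply: spin_rootel; case/andP: ab|exact: spin_wact].
by apply: (memw (w := (a, b, c) :: w)); rewrite /= ab.
Qed.

Lemma torel_wact i z w : z != 0 -> negword w -> exists2 w', negword w' &
  (torel (lshift n i) z \o wact w)%VF = (wact w' \o torel (lshift n i) z)%VF.
Proof.
move=> z0; elim: w => [_|[[a b] c] w IH] /=.
  by exists [::]; rewrite //= comp_lfun1l comp_lfun1r.
case/andP=> ab /IH[w' hw' e].
exists ((a, b, c * z ^ (2 * (wt i a + wt i b))) :: w'); first by rewrite /= ab.
by rewrite /= comp_lfunA torel_rootel // -comp_lfunA e comp_lfunA.
Qed.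

Let torl_closed i z x : z != 0 -> x \in K -> r (torel (lshift n i) z) x \in K.
Proof.
move=> z0; apply: closed => w hw.
have [w' hw' e] := torel_wact i z0 hw.
have st : spin (torel (lshift n i) z : 'End(spinor)) by exact: spin_torel.
rewrite -(rM v st (spin_wact hw)) e (rM v (spin_wact hw') st).
by case: hv => -> // _; rewrite linearZ memvZ // memw.
Qed.

Let tor_closed a z x : z != 0 -> x \in K -> r (torel a z) x \in K.
Proof.
case: (letterP a) => i z0; first exact: torl_closed.
by rewrite -bar_l torel_bar; apply: torl_closed; rewrite invr_eq0.
Qed.

Let pcurve_r a b x : root_pair a b -> pcurve (fun c => r (rootel a b c) x).
Proof.
by move=> ab; apply: pcurve_apply; [case: hr => _ _; exact | exact: pcurve_const].
Qed.

(* Commuting a positive root element past a negative one only creates a root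
   element of smaller height, except for opposite roots. There SL_2 settles
   all but one parameter, and a polynomial curve lies in K as soon as it does
   so off one point. *)
Let step_core m a b q d y :
  (forall a b c x, pospair a b -> height a + height b < m%:Z -> x \in K -> r (rootel a b c) x \in K) ->
  pospair a b -> height a + height b < m.+1%:Z -> negpair (bar b) q ->
  (forall c, r (rootel a b c) y \in K) ->
  forall c, r (rootel a b c) (r (rootel (bar b) q d) y) \in K.
Proof.
move=> IHm pab hm nbq hy.
have /andP[rab h0] := pab; have /andP[rbq h1] := nbq.
have /andP[ab abb] := rab; have /andP[bq bqq] := rbq.
have sab c : spin (rootel a b c : 'End(spinor)) by exact: spin_rootel.
have sbq c : spin (rootel (bar b) q c : 'End(spinor)) by exact: spin_rootel.
rewrite height_bar in h1.
have qbb : q != bar b by rewrite eq_sym.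
have qb : q != b by rewrite eq_sym -(inj_eq (@bar_inj n)).
case: (eqVneq q (bar a)) => [qa|qa]; last first.
  move=> c; rewrite -rM // rootel_bracket // rM; [|exact: sbq|]; last first.
    apply: spinM => //; case: (eqVneq a q) => [->|aq].
      suff -> : rootel q q (c * d) = \1%VF :> 'End(spinor) by exact: spin1.
      by apply/lfunP=> x; rewrite rootelE cl_sq scaler0 addr0 lfunE.
    by apply: spin_rootel; rewrite /root_pair aq neq_barC.
  apply: neg_closed => //.
  case: (eqVneq a q) => [<-|aq].
    have -> : rootel a a (c * d) = \1%VF :> 'End(spinor).
      by apply/lfunP=> x; rewrite rootelE cl_sq scaler0 addr0 lfunE.
    by rewrite comp_lfun1l.
  have raq : root_pair a q by rewrite /root_pair aq neq_barC.
  rewrite rM //; last exact: spin_rootel.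
  case: (ltgtP (height a + height q) 0) => hq.
  - by apply: neg_closed => //; rewrite /negpair raq hq.
  - by apply: IHm => //; [rewrite /pospair raq hq | exact: height_step hm h1].
  - by have := root_height_neq0 raq; rewrite hq eqxx.
rewrite {}qa in nbq h1 rbq bq bqq sbq qbb qb *.
have off c : 1 + c * d != 0 -> r (rootel a b c) (r (rootel (bar b) (bar a) d) y) \in K.
  move=> cd; have [z zz] : exists z, z ^+ 2 = 1 + c * d by exists (sqrtC (1 + c * d)); rewrite sqrtCK.
  have z0 : z != 0 by rewrite -sqrf_eq0 zz.
  have sta : spin (torel a z : 'End(spinor)) by exact: spin_torel.
  have stb : spin (torel b z : 'End(spinor)) by exact: spin_torel.
  rewrite -rM // (rootel_opp rab z0 zz) !rM //; try by do ?apply: spinM.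
  by apply: neg_closed => //; do 2?[apply: tor_closed => //].
case: (eqVneq d 0) => [d0|d0] c; first by apply: off; rewrite d0 mulr0 addr0 oner_eq0.
apply: (pcurve_mem (F := fun c => r (rootel a b c) (r (rootel (bar b) (bar a) d) y))
   (c0 := - d^-1)); first exact: pcurve_r.
move=> c' hc; apply: off; apply: contraNneq hc => e.
by rewrite -[c'](mulfK d0) -(addKr 1 (c' * d)) e addr0 mulN1r.
Qed.

Let pairC a b : pospair a b = pospair b a.
Proof. by rewrite /pospair root_pairC addrC. Qed.
Let npairC a b : negpair a b = negpair b a.
Proof. by rewrite /negpair root_pairC addrC. Qed.

(** Outer induction on the height of the root, inner induction on the negative word. If no letter of
    the first factor (p, q) is dual to a or b, the two root elements commute; otherwise reordering
    the pairs leads to the situation of [step_core]. *)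
Let pos_closed m : forall a b c x, pospair a b -> height a + height b < m%:Z ->
  x \in K -> r (rootel a b c) x \in K.
Proof.
elim: m => [|m IHm] a b c x pab hm.
  by case/andP: pab => _ /lt_trans/(_ hm); rewrite ltxx.
apply: closed => w; elim: w c => [|[[p q] d] w IHw] c.
  by move=> _; rewrite r1; case: hv => _ -> //; apply/hK; exists [:: (1, [::])]; rewrite wact_nil_comb.
case/andP=> /= npq hw; set y := r (wact w) v.
have hy c' : r (rootel a b c') y \in K by exact: IHw.
have rpq : root_pair p q by case/andP: npq.
have rab : root_pair a b by case/andP: pab.
have sc e f : root_pair e f -> e != bar f by case/andP.
rewrite (rM v (spin_rootel d rpq) (spin_wact hw)) -/y.
have hy' c' : r (rootel b a c') y \in K by rewrite rootelC // sc // root_pairC.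
have pba : pospair b a by rewrite pairC.
have hm' : height b + height a < m.+1%:Z by rewrite addrC.
case: (eqVneq p (bar b)) => [pb|pb].
  by rewrite pb in npq *; exact: (@step_core m a b q d y IHm pab hm npq hy).
case: (eqVneq q (bar b)) => [qb|qb].
  rewrite [rootel p q d]rootelC ?sc //.
  by rewrite npairC in npq; rewrite qb in npq *; exact: (@step_core m a b p (- d) y IHm pab hm npq hy).
case: (eqVneq p (bar a)) => [pa|pa].
  rewrite [rootel a b c]rootelC ?sc //.
  by rewrite pa in npq *; exact: (@step_core m b a q d y IHm pba hm' npq hy').
case: (eqVneq q (bar a)) => [qa|qa].
  rewrite [rootel a b c]rootelC ?sc // [rootel p q d]rootelC ?sc //.
  by rewrite npairC in npq; rewrite qa in npq *; exact: (@step_core m b a p (- d) y IHm pba hm' npq hy').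
rewrite -rM; [|exact: spin_rootel..].
rewrite rootel_comm // rM; [|exact: spin_rootel..].
exact: neg_closed.
Qed.

Lemma gen_closed g : gen g -> spin g /\ forall x, x \in K -> r g x \in K.
Proof.
elim=> [|a b c k ab _ [sk IH]|a z k z0 _ [sk IH]].
- by split=> [|x]; [exact: spin1 | rewrite r1].
- have sr : spin (rootel a b c : 'End(spinor)) by exact: spin_rootel.
  split=> [|x xK]; first exact: spinM.
  rewrite rM //; case: (ltgtP (height a + height b) 0) => h.
  + by apply: neg_closed; [rewrite /negpair ab h | exact: IH].
  + apply: (pos_closed (m := (absz (height a + height b)%R).+1)); last exact: IH.
      by rewrite /pospair ab h.
    exact: lt_absz_S.
  + by have := root_height_neq0 ab; rewrite h eqxx.
- have sr : spin (torel a z : 'End(spinor)) by exact: spin_torel.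
  split=> [|x xK]; first exact: spinM.
  by rewrite rM //; apply: tor_closed => //; exact: IH.
Qed.

Lemma orbit_closed (i0 : 'I_n) g x : spin g -> x \in K -> r g x \in K.
Proof. by move=> /(spin_gen i0)/gen_closed[_]; apply. Qed.

End Space.

Lemma orbit_comb (i0 : 'I_n) g : spin g -> exists l, goodl l /\ r g v = comb l.
Proof.
move=> sg; have [K hK] := orbit_space; apply/hK; apply: (orbit_closed hK i0 sg).
by apply/hK; exists [:: (1, [::])]; rewrite wact_nil_comb.
Qed.

(** When l lists all the indices, this is the cocharacter that defines [height]: by [sum_wt],
    conjugation multiplies the parameter of a root element by z to twice the height of the root. *)
Definition hh (l : seq 'I_n) (z : C) : 'End(spinor) :=
  foldr (fun i g => (torel (lshift n i) (z ^+ (n - i)) \o g)%VF) \1%VF l.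

Lemma spin_hh l z : z != 0 -> spin (hh l z).
Proof.
move=> z0; elim: l => [|i l IH] /=; first exact: spin1.
by apply: spinM => //; apply: spin_torel; rewrite expf_neq0.
Qed.

Lemma hh_rootel l z a b c : z != 0 ->
  (hh l z \o rootel a b c)%VF =
  (rootel a b (c * z ^ (2 * \sum_(i <- l) (n - i)%:Z * (wt i a + wt i b))) \o hh l z)%VF.
Proof.
move=> z0; elim: l => [|i l IH] /=.
  by rewrite big_nil mulr0 expr0z mulr1 comp_lfun1l comp_lfun1r.
rewrite -comp_lfunA IH comp_lfunA torel_rootel ?expf_neq0 // -comp_lfunA.
set g := (_ \o hh l z)%VF; apply: (congr1 (fun t => (rootel a b t \o g)%VF)).
rewrite big_cons -mulrA; congr (_ * _).
rewrite [in RHS]mulrDr [RHS]expfzDr // mulrC; congr (_ * _).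
by rewrite exprnP exprz_exp; congr (z ^ _); ring.
Qed.

Lemma sum_wt a : \sum_(i <- enum 'I_n) (n - i)%:Z * wt i a = height a.
Proof.
rewrite big_enum /=; case: (letterP a) => j; rewrite (bigD1 j) //= big1 ?addr0.
- by rewrite /wt eqxx eq_lrshift subr0 mulr1 height_l.
- by move=> i /negPf ij; rewrite /wt eq_lshift eq_lrshift eq_sym ij mulr0.
- by rewrite /wt eqxx eq_rlshift sub0r mulrN1 height_r.
- by move=> i /negPf ij; rewrite /wt eq_rshift eq_rlshift eq_sym ij mulr0.
Qed.

Lemma hh_v l z : z != 0 -> exists2 e, e != 0 & r (hh l z) v = e *: v.
Proof.
move=> z0; elim: l => [|i l [e e0 IH]] /=.
  by exists 1; rewrite ?oner_eq0 // r1 scale1r.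
have zn : z ^+ (n - i) != 0 by rewrite expf_neq0.
exists (e * (z ^+ (n - i)) ^ lam i); first by rewrite mulf_neq0 // expfz_neq0.
rewrite (rM v (spin_torel _ zn) (spin_hh l z0)) IH linearZ /=.
by case: hv => /(_ i _ zn)-> _; rewrite scalerA.
Qed.

(** The effect on a negative word of conjugation by [hh] at z^-1. The exponents are natural numbers,
    positive on negative pairs, so the formula makes sense at z = 0 and gives the trivial element
    there. *)
Definition scalew (z : C) (w : seq letters) : seq letters :=
  [seq (t.1.1, t.1.2, t.2 * z ^+ (2 * (absz (height t.1.1 + height t.1.2)%R))) | t <- w].

Lemma negword_scale z w : negword (scalew z w) = negword w.
Proof. by rewrite /negword all_map. Qed.

Lemma hh_wact z w : z != 0 -> negword w ->
  (hh (enum 'I_n) z^-1 \o wact w)%VF = (wact (scalew z w) \o hh (enum 'I_n) z^-1)%VF.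
Proof.
move=> z0; have z1 : z^-1 != 0 by rewrite invr_eq0.
elim: w => [_|[[a b] c] w IH] /=; first by rewrite comp_lfun1l comp_lfun1r.
case/andP=> /andP[ab h] /IH e.
rewrite comp_lfunA hh_rootel // -[LHS]comp_lfunA -[RHS]comp_lfunA e.
set g := (wact _ \o _)%VF; apply: (congr1 (fun t => (rootel a b t \o g)%VF)).
congr (_ * _).
under eq_bigr => i _ do rewrite mulrDr.
rewrite big_split /= !sum_wt /=.
have -> : 2 * (height a + height b) = - (2 * (absz (height a + height b)%R))%N%:Z by exact: double_neg.
by rewrite exprz_inv opprK.
Qed.

(* Conjugation by the one-parameter subgroup [hh] contracts the negative root
   subgroups to the identity as z tends to 0; a vanishing combination of
   translates of v thus degenerates to [aug l *: v = 0]. *)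
Lemma comb_eq0_aug l : v != 0 -> goodl l -> comb l = 0 -> aug l = 0.
Proof.
move=> v0 gl c0.
pose F z := \sum_(t <- l) t.1 *: r (wact (scalew z t.2)) v.
have Fz z : z != 0 -> F z = 0.
  move=> z0; have z1 : z^-1 != 0 by rewrite invr_eq0.
  have [e e0 he] := hh_v (enum 'I_n) z1.
  apply: (scalerI e0); rewrite scaler0.
  have <- : r (hh (enum 'I_n) z^-1) (comb l) = 0 by rewrite c0 linear0.
  rewrite /F /comb scaler_sumr linear_sum big_seq [RHS]big_seq; apply: eq_bigr => t tl.
  have nt : negword t.2 by exact: (allP gl).
  have nt' : negword (scalew z t.2) by rewrite negword_scale.
  have sh := spin_hh (enum 'I_n) z1.
  rewrite [RHS]linearZ /= -(rM v sh (spin_wact nt)) hh_wact // (rM v (spin_wact nt') sh).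
  by rewrite he [r _ (e *: v)]linearZ /= !scalerA mulrC.
have pw w : negword w -> pcurve (fun z => r (wact (scalew z w)) v).
  elim: w => [_|[[a b] c] w IH] /=; first exact: pcurve_const.
  case/andP=> ab hw; have rab : root_pair a b by case/andP: ab.
  have pr : pcurve (fun z => r (rootel a b (c * z ^+ (2 * (absz (height a + height b)%R))))).
    by apply: (@pcurve_reparam _ _ (fun c => r (rootel a b c))); case: hr => _ _; apply.
  apply: pcurve_ext (pcurve_apply pr (IH hw)) => z /=.
  by rewrite (rM v (spin_rootel _ rab) (spin_wact _)) ?negword_scale.
have pF : pcurve F.
  rewrite /F; elim: l gl {F Fz c0} => [_|t l IH /andP[ht hl]].
    by apply: pcurve_ext (pcurve_const 0) => z; rewrite big_nil.
  apply: pcurve_ext (pcurveD (pcurve_lin (t.1 *: \1%VF) (pw _ ht)) (IH hl)) => z.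
  by rewrite big_cons scale_lfunE id_lfunE.
have := pcurve_vanish pF Fz 0.
have w0 w : negword w -> wact (scalew 0 w) = \1%VF.
  elim: w => [//|[[a b] c] w IH] /= /andP[/andP[_ h] /IH->].
  have -> : (absz (height a + height b)%R) = ((absz (height a + height b)%R).-1).+1.
    by rewrite prednK // absz_gt0 lt_eqF.
  by rewrite mulnS expr0n mulr0 rootel0 comp_lfun1l.
rewrite /F big_seq (eq_bigr (fun t => t.1 *: v)).
  rewrite -big_seq -scaler_suml => /eqP; rewrite scaler_eq0 (negPf v0) orbF.
  by move/eqP.
by move=> t tl; rewrite w0 ?r1 //; exact: (allP gl).
Qed.

End Orbit.
End HighestWeight.

Section PolynomialCurves.
Variable C : numClosedFieldType.
Implicit Types (V W : vectType C).

Lemma pcurve_coord V (G : C -> V) :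
  (forall l : 'Hom(V, C^o), pcurve (fun c => l (G c) : C^o)) -> pcurve G.
Proof.
move=> h.
have e c : \sum_(i <- enum 'I_(\dim (fullv : {vspace V}))) coordl i (G c) *: (vbasis fullv)`_i = G c.
  by rewrite big_enum /= [RHS](coord_vbasis (memvf (G c))).
apply: (pcurve_ext e); apply: pcurve_sum => i.
have lE x : (linfun (fun y : V => coordl i y : C^o)) x = coordl i x.
  by rewrite linfunE // => c y z; rewrite /coordl linearP.
have hi := h (linfun (fun y : V => coordl i y : C^o)).
apply: pcurve_ext (pcurve_bilin (B := fun (c : C^o) (x : V) => c *: x) _ _ hi (pcurve_const (vbasis fullv)`_i)).
- by move=> c /=; rewrite lE.
- by move=> c a x y /=; rewrite scalerDr !scalerA mulrC.
- by move=> x a c d /=; rewrite scalerDl scalerA.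
Qed.

Lemma pcurve_hom V W (F : C -> 'Hom(V, W)) :
  (forall x, pcurve (fun c => F c x)) -> pcurve F.
Proof.
move=> h.
pose E i y : 'Hom(V, W) := linfun (fun x => coordl i x *: y).
have EE i y x : E i y x = coordl i x *: y.
  by rewrite /E linfunE // => c u w; rewrite /coordl linearP scalerDl scalerA.
have El i : linear (E i).
  move=> c y z; apply/lfunP=> x; rewrite add_lfunE scale_lfunE !EE.
  by rewrite scalerDr !scalerA mulrC.
have e c : \sum_(i <- enum 'I_(\dim (fullv : {vspace V}))) linfun (E i) (F c (vbasis fullv)`_i) = F c.
  apply/lfunP=> x; rewrite big_enum sum_lfunE /= {2}(coord_vbasis (memvf x)) linear_sum.
  by apply: eq_bigr => i _; rewrite linfunE // EE linearZ.
apply: (pcurve_ext e); apply: pcurve_sum => i; apply: pcurve_lin; exact: h.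
Qed.

Lemma polynomial_fun_pcurve V (p : V -> C) (F : C -> V) :
  polynomial_fun p -> pcurve F -> pcurve (fun c => p (F c) : C^o).
Proof.
move=> hp hF; elim: hp => {p} [c|l|p q _ hp _ hq|p q _ hp _ hq].
- exact: pcurve_const.
- exact: pcurve_lin.
- exact: pcurveD.
- apply: (pcurve_bilin (B := fun x y : C^o => x * y : C^o) _ _ hp hq).
  + by move=> c a x y /=; rewrite /GRing.scale /=; ring.
  + by move=> c a x y /=; rewrite /GRing.scale /=; ring.
Qed.

End PolynomialCurves.

(** * The companion linear form of an irreducible module *)

Section HighestWeightFunctional.
Variables (C : numClosedFieldType) (n : nat) (i0 : 'I_n).
Local Notation letter := 'I_(n + n).
Local Notation spinor := {ffun {set 'I_n} -> C^o}.
Implicit Types (a b p q : letter) (c d z : C) (g h k : 'End(spinor)).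

Lemma pcurve_rootel a b : pcurve (fun c => rootel a b c : 'End(spinor)).
Proof.
apply: pcurveD; first exact: pcurve_const.
apply: (pcurve_ext (F := fun c => c ^+ 1 *: _)) => //.
by apply: pcurve_scale; exact: pcurve_const.
Qed.

Lemma rational_is_rep (V : vectType C) (r : spin_action n V) :
  rational_representation r -> is_rep r.
Proof.
case=> r1 rM rP; split=> // a b ab; apply: pcurve_hom => x; apply: pcurve_coord => l.
have [p pp hp] := rP l x.
apply: pcurve_ext (polynomial_fun_pcurve pp (pcurve_rootel a b)) => c.
by rewrite hp //; exact: spin_rootel.
Qed.

Lemma highest_weight_hwv (V : vectType C) (r : spin_action n V) (lam : weight n) v :
  highest_weight_vector r lam v -> v != 0 /\ hwv r lam v.
Proof.
case=> v0 ht hr; split=> //; split.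
  by move=> i z z0; rewrite -torusE ht.
move=> a b c /andP[ab]; have [anb abb] := andP ab.
case: (letterP a) (letterP b) ab anb abb => i [] j ab anb abb.
- rewrite eq_lshift in anb => _.
  case: (ltngtP i j) => ij.
  + by rewrite -root_plusE; case: (hr i j c ij).
  + by rewrite rootelC // -root_plusE; case: (hr j i (- c) ij).
  + by move: anb; rewrite -val_eqE /= ij eqxx.
- rewrite height_l height_r => h; have ij : (i < j)%N.
    by have := ltn_ord i; have := ltn_ord j; move: h; clear; lia.
  by rewrite -root_minusE; case: (hr i j c ij).
- rewrite height_l height_r => h; have ij : (j < i)%N.
    by have := ltn_ord i; have := ltn_ord j; move: h; clear; lia.
  by rewrite rootelC // -root_minusE; case: (hr j i (- c) ij).
- rewrite !height_r => h; exfalso.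
  by have := ltn_ord i; have := ltn_ord j; move: h; clear; lia.
Qed.

Definition hw_functional (V : vectType C) (r : 'End(spinor) -> 'End(V))
    (lam : weight n) (l : 'Hom(V, C^o)) :=
  (forall a b c x, negpair a b -> l (r (rootel a b c) x) = l x) /\
  (forall i z x, z != 0 -> l (r (torel (lshift n i) z) x) = z ^ lam i *: l x).

Definition nondeg (V : vectType C) (r : 'End(spinor) -> 'End(V)) (l : 'Hom(V, C^o)) :=
  forall x, (forall g, spin g -> l (r g x) = 0) -> x = 0.

Lemma irreducible_datum (V : vectType C) (r : spin_action n V) (lam : weight n) :
  irreducible_of_highest_weight r lam ->
  exists (l : 'Hom(V, C^o)) (v : V), [/\ is_rep r, hwv r lam v, l v = 1, hw_functional r lam l & nondeg r l].
Proof.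
case=> /rational_is_rep hr [_ irr] [v /highest_weight_hwv[v0 hv]].
have rM g h x : spin g -> spin h -> r (g \o h)%VF x = r g (r h x).
  by case: hr => _ hM _ sg sh; rewrite hM // comp_lfunE.
have r1 x : r \1%VF x = x by case: hr => -> _ _; rewrite lfunE.
have [K hK] := orbit_space r v.
have vK : v \in K by apply/hK; exists [:: (1, [::])]; rewrite (wact_nil_comb _ hr).
have KT : K = fullv.
  have [||//] := irr K.
    move=> g sg; apply/subvP=> _ /memv_imgP[x xK ->].
    exact: (orbit_closed hr hv hK i0 sg).
  by move=> K0; move: vK; rewrite K0 memv0 (negPf v0).
(* Z is to lie in the kernel of l. It omits v: a combination of augmentation 0 equal to v,
   subtracted from v, would be a vanishing combination of augmentation 1. *)
have [Z hZ] : exists Z : {vspace V}, forall x, x \in Z <->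
    exists l, [/\ goodl l, x = comb r v l & aug l = 0].
  apply: subspace_vspace.
    by exists [::]; split=> //; rewrite /comb /aug big_nil.
  move=> c x y [l [gl -> al]] [m [gm -> am]].
  have [l' [gl' e a]] := comb_lin r v c gl gm.
  by exists l'; split=> //; rewrite a al am mulr0 addr0.
have vZ : v \notin Z.
  apply/negP=> /hZ[l [gl e al]].
  have g1 : goodl [:: (1 : C, [::] : seq (letters C n))] by [].
  have [l' [gl' e' a']] := comb_lin r v (-1) gl g1.
  have : aug l' = 0.
    apply: (comb_eq0_aug hr hv v0 gl').
    by rewrite e' (wact_nil_comb _ hr) -e scaleN1r addNr.
  by rewrite a' al mulr0 add0r /aug big_seq1 => /eqP; rewrite oner_eq0.
have [l [lv lZ]] := functional_sep vZ.
have lw w : negword w -> l (r (wact w) v) = 1.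
  move=> hw; rewrite -lv; apply/eqP; rewrite -subr_eq0 -linearB; apply/eqP/lZ/hZ.
  exists [:: (1, w); (-1, [::])]; split.
  - by rewrite /goodl /= hw.
  - by rewrite /comb !big_cons big_nil addr0 scale1r scaleN1r /= r1.
  - by rewrite /aug !big_cons big_nil addr0 subrr.
(* l is now the augmentation: prefixing words by a negative element does not change it, and the
   torus multiplies every coefficient by the same power. *)
have lcomb m : goodl m -> l (comb r v m) = aug m.
  move=> gm; rewrite /comb linear_sum /aug big_seq [RHS]big_seq.
  apply: eq_bigr => t tm; rewrite linearZ /= lw ?[_ *: _]mulr1 //.
  exact: (allP gm).
have allK x : exists m, goodl m /\ x = comb r v m by apply/hK; rewrite KT memvf.
exists l, v; split=> //.
  split.
    move=> a b c x nab; have [m [gm ->]] := allK x.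
    rewrite lcomb // /comb !linear_sum /aug big_seq [RHS]big_seq.
    apply: eq_bigr => t tm; rewrite !linearZ /=.
    have nt : negword t.2 by exact: (allP gm).
    have rab : root_pair a b by case/andP: nab.
    rewrite -(rM _ _ v (spin_rootel c rab) (spin_wact nt)).
    by rewrite (lw ((a, b, c) :: t.2)) ?[_ *: _]mulr1 //= nab.
  move=> i z x z0; have [m [gm ->]] := allK x.
  have -> : z ^ lam i *: l (comb r v m) = \sum_(t <- m) z ^ lam i * t.1.
    by rewrite lcomb // /aug -mulr_sumr.
  rewrite /comb !linear_sum big_seq [RHS]big_seq.
  apply: eq_bigr => t tm; rewrite !linearZ /=.
  have nt : negword t.2 by exact: (allP gm).
  have [w' nw' e] := torel_wact i z0 nt.
  have st := spin_torel (lshift n i) z0.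
  rewrite -(rM _ _ v st (spin_wact nt)) e (rM _ _ v (spin_wact nw') st).
  case: hv => -> // _; rewrite !linearZ /= lw //.
  by rewrite /GRing.scale /=; ring.
move=> x hx.
(* The vectors whose translates are all killed by l form a stable subspace; it omits v because l v =
   1, so irreducibility makes it zero. *)
have [D hD] : exists D : {vspace V}, forall x, x \in D <->
    forall g, spin g -> l (r g x) = 0.
  apply: subspace_vspace => [g _|c y z hy hz g sg]; first by rewrite !linear0.
  by rewrite linearP /= linearP /= hy // hz // scaler0 addr0.
have [g sg|D0|DT] := irr D.
- apply/subvP=> _ /memv_imgP[y /hD hy ->]; apply/hD => h sh.
  by rewrite -rM // hy //; exact: spinM.
- by move/hD: hx; rewrite D0 memv0 => /eqP.
- have /hD/(_ _ (spin1 _ _)) : v \in D by rewrite DT memvf.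
  by rewrite r1 lv => /eqP; rewrite oner_eq0.
Qed.

End HighestWeightFunctional.

(** * Equivariant maps determined by a highest weight vector *)

Section Intertwiner.
Variables (C : numClosedFieldType) (n : nat) (i0 : 'I_n).
Local Notation letter := 'I_(n + n).
Local Notation spinor := {ffun {set 'I_n} -> C^o}.
Implicit Types (a b p q : letter) (c d z : C) (g h k : 'End(spinor)).

Definition adjrep (T : finType) (s : 'End(spinor) -> 'End({ffun T -> C^o})) :=
  forall g g', spin g -> spin g' -> isadj g g' ->
    forall x y, herm (s g x) y = herm x (s g' y).

Section Pair.
Variables (V W : vectType C) (r : 'End(spinor) -> 'End(V)) (s : 'End(spinor) -> 'End(W)).

(** The pair (v, y0) is a highest weight vector of the direct sum, so [orbit_comb] writes g v and g
    y0 by one and the same combination of negative words. This compares l (g v) with the Hermitian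
    product of g y0 and y0. *)
Definition pair_act g : 'End((V * W)%type) :=
  linfun (fun p : V * W => (r g p.1, s g p.2)).

Lemma pair_actE g x y : pair_act g (x, y) = (r g x, s g y).
Proof.
rewrite /pair_act linfunE // => c [x1 y1] [x2 y2] /=.
by rewrite !linearP.
Qed.

Lemma pair_is_rep : is_rep r -> is_rep s -> is_rep pair_act.
Proof.
move=> [r1 rM rp] [s1 sM sp]; split.
- by apply/lfunP=> [[x y]]; rewrite pair_actE r1 s1 !lfunE.
- move=> g h sg sh; apply/lfunP=> [[x y]].
  by rewrite comp_lfunE !pair_actE rM // sM // !comp_lfunE.
- move=> a b ab; apply: pcurve_hom => [[x y]].
  have hx : pcurve (fun c => r (rootel a b c) x).
    by apply: pcurve_apply (rp _ _ ab) (pcurve_const _).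
  have hy : pcurve (fun c => s (rootel a b c) y).
    by apply: pcurve_apply (sp _ _ ab) (pcurve_const _).
  pose i1 : 'Hom(V, (V * W)%type) := linfun (fun u : V => (u, 0 : W)).
  pose i2 : 'Hom(W, (V * W)%type) := linfun (fun u : W => (0 : V, u)).
  have i1E u : i1 u = (u, 0).
    by rewrite /i1 linfunE // => c u1 u2; rewrite -[RHS]/(_, _) /= scaler0 addr0.
  have i2E u : i2 u = (0, u).
    by rewrite /i2 linfunE // => c u1 u2; rewrite -[RHS]/(_, _) /= scaler0 addr0.
  apply: pcurve_ext (pcurveD (pcurve_lin i1 hx) (pcurve_lin i2 hy)) => c.
  by rewrite pair_actE i1E i2E -[LHS]/(_, _) /= addr0 add0r.
Qed.

Lemma pair_hwv lam v w : hwv r lam v -> hwv s lam w -> hwv pair_act lam (v, w).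
Proof.
move=> [tr ur] [ts us]; split=> [i z z0|a b c ab]; rewrite pair_actE.
  by rewrite tr // ts.
by rewrite ur // us.
Qed.

Lemma comb_pair v w l :
  comb pair_act (v, w) l = (comb r v l, comb s w l).
Proof.
rewrite /comb; elim: l => [|t l IH]; first by rewrite !big_nil.
by rewrite !big_cons IH pair_actE.
Qed.
End Pair.

(** The adjoint of a negative root element is a positive one, which fixes y0. Hence the product with
    y0 plays on this module the part of l on V. *)
Lemma adj_neg_pos (T : finType) (s : 'End(spinor) -> 'End({ffun T -> C^o})) lam y0 :
  adjrep s -> hwv s lam y0 -> forall a b c x, negpair a b ->
  herm (s (rootel a b c) x) y0 = herm x y0.
Proof.
move=> sadj [_ hu] a b c x /andP[ab hneg].
have ab' : root_pair (bar b) (bar a).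
  have [h1 h2] := andP ab.
  by rewrite /root_pair !(inj_eq (@bar_inj n)) eq_sym h1 /= neq_barC.
rewrite (sadj _ _ (spin_rootel c ab) (spin_rootel _ ab') (rootel_adj a b c)) hu //.
by rewrite /pospair ab' !height_bar addrC -opprD oppr_gt0.
Qed.

(* [f x] is the vector v' such that [l (g v') = (g x, y0) / (y0, y0)] for all g
   in the group. The x for which it exists form a stable subspace containing
   y0, and v' = 0 does for the x orthogonal to that subspace. *)
Theorem hw_exists (V : vectType C) (r : 'End(spinor) -> 'End(V)) lam
    (l : 'Hom(V, C^o)) (v : V) (T : finType)
    (s : 'End(spinor) -> 'End({ffun T -> C^o})) (y0 : {ffun T -> C^o}) :
  is_rep r -> hwv r lam v -> l v = 1 -> hw_functional r lam l -> nondeg r l ->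
  is_rep s -> adjrep s -> hwv s lam y0 -> y0 != 0 ->
  exists f : 'Hom({ffun T -> C^o}, V),
    (forall g x, spin g -> f (s g x) = r g (f x)) /\ f y0 = v.
Proof.
move=> hr hv lv [lneg ltor] lnd hs sadj hy y00.
have rM g h x : spin g -> spin h -> r (g \o h)%VF x = r g (r h x).
  by case: hr => _ hM _ sg sh; rewrite hM // comp_lfunE.
have sM g h x : spin g -> spin h -> s (g \o h)%VF x = s g (s h x).
  by case: hs => _ hM _ sg sh; rewrite hM // comp_lfunE.
pose k := herm y0 y0; have k0 : k != 0 by rewrite /k herm_eq0.
pose P x v' := forall g, spin g -> l (r g v') = herm (s g x) y0 / k.
have Plin c x v1 y v2 : P x v1 -> P y v2 -> P (c *: x + y) (c *: v1 + v2).
  move=> h1 h2 g sg; rewrite !linearP /= h1 // h2 // hermDl /GRing.scale /=; ring.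
have Puniq x v1 v2 : P x v1 -> P x v2 -> v1 = v2.
  move=> h1 h2; apply/eqP; rewrite -subr_eq0; apply/eqP; apply: lnd => g sg.
  by rewrite !linearB /= h1 // h2 // subrr.
have lw w : negword w -> l (r (wact w) v) = 1.
  elim: w => [_|[[a b] c] w IH] /=; first by case: hr => -> _ _; rewrite lfunE.
  case/andP=> nab hw; have rab : root_pair a b by case/andP: nab.
  by rewrite (rM _ _ v (spin_rootel c rab) (spin_wact hw)) lneg ?IH.
have hw w : negword w -> herm (s (wact w) y0) y0 = k.
  elim: w => [_|[[a b] c] w IH] /=; first by case: hs => -> _ _; rewrite lfunE.
  case/andP=> nab hw; have rab : root_pair a b by case/andP: nab.
  by rewrite (sM _ _ y0 (spin_rootel c rab) (spin_wact hw)) (adj_neg_pos sadj hy) ?IH.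
have Py0 : P y0 v.
  move=> g sg.
  have [m [gm]] := orbit_comb (pair_is_rep hr hs) (pair_hwv hv hy) i0 sg.
  rewrite pair_actE comb_pair => [[-> ->]].
  rewrite /comb linear_sum herm_suml mulr_suml big_seq [RHS]big_seq.
  apply: eq_bigr => t tm; have nt : negword t.2 by exact: (allP gm).
  by rewrite linearZ /= lw // hermZl hw // mulfK //= [_ *: _]mulr1.
have [S hS] : exists S : {vspace {ffun T -> C^o}}, forall x, x \in S <-> exists v', P x v'.
  apply: subspace_vspace.
    by exists 0 => g sg; rewrite !linear0 herm0l mul0r.
  by move=> c x y [v1 h1] [v2 h2]; exists (c *: v1 + v2); exact: Plin.
have Sst g x : spin g -> x \in S -> s g x \in S.
  move=> sg /hS[v' h]; apply/hS; exists (r g v') => h' sh.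
  by rewrite -rM // -sM // h //; exact: spinM.
have St x : exists v', P x v'.
  apply/hS; have [p pS hp] := orth_proj S x.
  rewrite -(subrK p x) memvD //; apply/hS; exists 0 => g sg.
  have [g' sg' ad] := spin_adj sg.
  rewrite !linear0 (sadj _ _ sg sg' ad) hp ?mul0r //.
  by apply: Sst => //; apply/hS; exists v.
have [f hf] := boolp.choice St.
have flin : linear f.
  by move=> c x y; apply: (Puniq (c *: x + y)) => //; exact: Plin.
exists (linfun f); split=> [g x sg|]; rewrite !linfunE //; last exact: (Puniq y0).
apply: (Puniq (s g x)) => // h sh.
by rewrite -rM // -sM // hf //; exact: spinM.
Qed.

End Intertwiner.

(** * Highest weight vectors in tensor products *)

Section Tensor.
Variables (C : numClosedFieldType) (S T : finType).
Local Notation sp K := {ffun K -> C^o}.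

(** Functions on the product of the index sets model the tensor product; it keeps the shape, and the
    standard Hermitian form, that [hw_exists] requires. *)
Definition tens (x : sp S) (y : sp T) : sp (S * T)%type :=
  [ffun p => x p.1 * y p.2].

Definition dlt (K : finType) (k : K) : sp K := [ffun u => (u == k)%:R].

Lemma dlt_sum (K : finType) (x : sp K) : x = \sum_k x k *: dlt k.
Proof.
apply/ffunP=> u; rewrite sum_ffunE (bigD1 u) //= !ffunE eqxx /GRing.scale /= mulr1.
rewrite big1 ?addr0 // => v /negPf vu.
by rewrite !ffunE eq_sym vu /GRing.scale /= mulr0.
Qed.

Lemma tensDl c x x' y : tens (c *: x + x') y = c *: tens x y + tens x' y.
Proof. by apply/ffunP=> p; rewrite !ffunE /GRing.scale /=; ring. Qed.
Lemma tensDr c x y y' : tens x (c *: y + y') = c *: tens x y + tens x y'.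
Proof. by apply/ffunP=> p; rewrite !ffunE /GRing.scale /=; ring. Qed.

Lemma tens_suml (I : Type) (q : seq I) (e : I -> C) (F : I -> sp S) y :
  tens (\sum_(i <- q) e i *: F i) y = \sum_(i <- q) e i *: tens (F i) y.
Proof.
elim/big_rec2: _ => [|i a b _ <-]; last exact: tensDl.
by apply/ffunP=> p; rewrite !ffunE mul0r.
Qed.
Lemma tens_sumr (I : Type) (q : seq I) (e : I -> C) (F : I -> sp T) x :
  tens x (\sum_(i <- q) e i *: F i) = \sum_(i <- q) e i *: tens x (F i).
Proof.
elim/big_rec2: _ => [|i a b _ <-]; last exact: tensDr.
by apply/ffunP=> p; rewrite !ffunE mulr0.
Qed.

Lemma tens_dlt p : tens (dlt p.1) (dlt p.2) = dlt p.
Proof.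
by apply/ffunP=> -[u v]; case: p => p q; rewrite !ffunE /= -natrM mulnb xpair_eqE.
Qed.

Lemma tens_ind (P : sp (S * T)%type -> Prop) :
  (forall x y, P (tens x y)) -> (forall c z z', P z -> P z' -> P (c *: z + z')) ->
  forall z, P z.
Proof.
move=> Pt PD z; rewrite (dlt_sum z).
have P0 : P 0.
  by have := Pt 0 0; congr P; apply/ffunP=> p; rewrite !ffunE mul0r.
apply: (big_ind P) => // [a b Pa Pb|p _].
  by rewrite -[a]scale1r; exact: PD.
by rewrite -[_ *: _]addr0 -tens_dlt; exact: PD.
Qed.

Lemma tens_lfun_eq (V : vectType C) (f g : 'Hom(sp (S * T)%type, V)) :
  (forall x y, f (tens x y) = g (tens x y)) -> f = g.
Proof.
move=> h; apply/lfunP; apply: tens_ind => // c z z' e e'.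
by rewrite !linearP /= e e'.
Qed.

Lemma herm_tens x y x' y' :
  herm (tens x y) (tens x' y') = herm x x' * herm y y'.
Proof.
rewrite /herm big_distrlr /= pair_bigA /=; apply: eq_bigr => p _.
by rewrite !ffunE rmorphM /=; ring.
Qed.

Section Act.
Variable n : nat.
Local Notation spinor := (sp {set 'I_n}).
Variables (r : 'End(spinor) -> 'End(sp S)) (s : 'End(spinor) -> 'End(sp T)).
Implicit Types (g h : 'End(spinor)).

Definition tact g : 'End(sp (S * T)%type) :=
  linfun (fun z : sp (S * T)%type =>
    \sum_p z p *: tens (r g (dlt p.1)) (s g (dlt p.2))).

Lemma tactE g z : tact g z = \sum_p z p *: tens (r g (dlt p.1)) (s g (dlt p.2)).
Proof.
rewrite /tact linfunE // => c x y; rewrite scaler_sumr -big_split /=.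
by apply: eq_bigr => p _; rewrite !ffunE scalerDl scalerA.
Qed.

Lemma tact_tens g x y : tact g (tens x y) = tens (r g x) (s g y).
Proof.
have -> : tens (r g x) (s g y) =
   \sum_u \sum_v (x u * y v) *: tens (r g (dlt u)) (s g (dlt v)).
  rewrite {1}(dlt_sum x) {1}(dlt_sum y) !linear_sum /=.
  under eq_bigr do rewrite linearZ /=.
  rewrite tens_suml; apply: eq_bigr => u _.
  under eq_bigr do rewrite linearZ /=.
  by rewrite tens_sumr scaler_sumr; apply: eq_bigr => v _; rewrite scalerA.
rewrite tactE pair_bigA /=; apply: eq_bigr => p _; by rewrite ffunE.
Qed.

Lemma tact_is_rep : is_rep r -> is_rep s -> is_rep tact.
Proof.
move=> [r1 rM rp] [s1 sM sp_]; split.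
- by apply: tens_lfun_eq => x y; rewrite tact_tens r1 s1 !lfunE.
- move=> g h sg sh; apply: tens_lfun_eq => x y.
  by rewrite comp_lfunE !tact_tens rM // sM // !comp_lfunE.
- move=> a b ab; apply: pcurve_hom; apply: tens_ind => [x y|c z z' hz hz'].
    have hx : pcurve (fun c => r (rootel a b c) x).
      by apply: pcurve_apply (rp _ _ ab) (pcurve_const _).
    have hy : pcurve (fun c => s (rootel a b c) y).
      by apply: pcurve_apply (sp_ _ _ ab) (pcurve_const _).
    apply: pcurve_ext (pcurve_bilin (B := tens) _ _ hx hy).
    - by move=> c; rewrite tact_tens.
    - by move=> u c x1 y1; rewrite tensDr.
    - by move=> u c x1 y1; rewrite tensDl.
  apply: pcurve_ext (pcurveD (pcurve_lin (c *: \1%VF) hz) hz') => d.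
  by rewrite scale_lfunE id_lfunE linearP.
Qed.

Lemma tact_adjrep : adjrep r -> adjrep s -> adjrep tact.
Proof.
move=> ra sa g g' sg sg' ad; apply: tens_ind => [x y|c z z' hz hz'] w; last first.
  by rewrite linearP /= !hermDl hz hz'.
elim/tens_ind: w => [x' y'|c z z' hz hz'].
  by rewrite !tact_tens !herm_tens (ra _ _ sg sg' ad) (sa _ _ sg sg' ad).
by rewrite linearP /= !hermDr hz hz'.
Qed.
End Act.
End Tensor.

Section SpinorsAndForms.
Variables (C : numClosedFieldType) (n : nat) (i0 : 'I_n).
Local Notation letter := 'I_(n + n).
Local Notation spinor := {ffun {set 'I_n} -> C^o}.
Local Notation ext := {ffun {set 'I_(n + n)} -> C^o}.
Implicit Types (a b p q : letter) (c d z : C) (g h k : 'End(spinor)).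
Implicit Types (B : {set 'I_(n + n)}) (A : {set 'I_n}).

Definition sact g : 'End(spinor) := g.

Lemma sact_is_rep : is_rep sact.
Proof. by split=> // a b _; exact: pcurve_rootel. Qed.
Lemma sact_adjrep : adjrep sact.
Proof. by move=> g g' _ _ ad. Qed.

Definition eact g : 'End(ext) := ext_map (natural_act g).

Lemma eact_wedge g v x : eact g (wedge v x) = wedge (natural_act g v) (eact g x).
Proof. exact: ext_map_wedge. Qed.

Lemma eact_is_rep : is_rep eact.
Proof.
split.
- by rewrite /eact natural_act1 ext_map1.
- by move=> g h sg sh; rewrite /eact natural_actM // ext_map_comp.
- move=> a b ab; apply: pcurve_hom; apply: ext_ind => [|v x hx|c x y hx hy].
  + by apply: pcurve_ext (pcurve_const (ext_basis C set0)) => c; rewrite /eact ext_map0.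
  + pose w : 'rV[C]_(n + n) := v 0 (bar b) *: delta_mx 0 a - v 0 (bar a) *: delta_mx 0 b.
    have hv : pcurve (fun c => v + c ^+ 1 *: w).
      by apply: pcurveD; [exact: pcurve_const | apply: pcurve_scale; exact: pcurve_const].
    apply: pcurve_ext (pcurve_bilin (B := @wedge C (n + n)) _ _ hv hx).
    * by move=> c; rewrite eact_wedge natural_act_rootel.
    * by move=> u; exact: linearP.
    * by move=> u c v1 v2; rewrite wedgeDl.
  + apply: pcurve_ext (pcurveD (pcurve_lin (c *: \1%VF) hx) hy) => d.
    by rewrite scale_lfunE id_lfunE linearP.
Qed.

Lemma eact_adjrep : adjrep eact.
Proof.
move=> g g' sg _ ad; apply: ext_map_adj; exact: natural_act_adj.
Qed.

Lemma rootel_kill a b c x : root_pair a b -> cl a x = 0 \/ cl b x = 0 ->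
  rootel a b c x = x :> spinor.
Proof.
case/andP=> ab abb [] h; rewrite rootelE.
  by rewrite cl_anti // h cl0 oppr0 scaler0 addr0.
by rewrite h cl0 scaler0 addr0.
Qed.

Lemma cl_l i x : cl (lshift n i) x = wedge (delta_mx 0 i) x :> spinor.
Proof.
rewrite /cl cliffordE -vec_eE /vec_e row_mxKl row_mxKr.
by rewrite contract0l addr0.
Qed.
Lemma cl_r i x : cl (rshift n i) x = contract (delta_mx 0 i) x :> spinor.
Proof.
rewrite /cl cliffordE -vec_fE /vec_f row_mxKl row_mxKr.
by rewrite wedge0l add0r.
Qed.

Lemma torel_basis i z A : torel (lshift n i) z (ext_basis C A) =
  (if i \in A then z else z^-1) *: ext_basis C A.
Proof.
rewrite torelE bar_l !cl_l !cl_r; case: ifPn => iA.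
  rewrite wedge_basis_in // linear0 scaler0 addr0 contract_basis // linearZ /=.
  rewrite wedge_basis ?inE ?eqxx // setD1K // !scalerA ext_signD1 // ltnn expr0 mulr1.
  by rewrite -mulrA ext_sign_sqr mulr1.
rewrite contract_basis_notin // linear0 scaler0 add0r wedge_basis // linearZ /=.
rewrite contract_basis ?setU11 // setU1K // !scalerA ext_signU1 // ltnn expr0 mulr1.
by rewrite -mulrA ext_sign_sqr mulr1.
Qed.

Lemma ext_basis_D1 (a : letter) B : a \in B -> exists2 e : C, e != 0 &
  ext_basis C B = e *: wedge (delta_mx 0 a) (ext_basis C (B :\ a)).
Proof.
move=> aB; exists (ext_sign C a (B :\ a)); first exact: sgn_unit.
by rewrite wedge_basis ?inE ?eqxx // scalerA ext_sign_sqr scale1r setD1K.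
Qed.

Lemma natural_act_rootel_letter a b c p : root_pair a b ->
  natural_act (rootel a b c) (delta_mx 0 p) =
  delta_mx 0 p + c *: ((bar b == p)%:R *: delta_mx 0 a - (bar a == p)%:R *: delta_mx 0 b).
Proof. by move=> ab; rewrite natural_act_rootel // !mxE eqxx. Qed.

Lemma eact_basis_ind (g : 'End(spinor)) B :
  (forall p, p \in B -> natural_act g (delta_mx 0 p) = delta_mx 0 p) ->
  eact g (ext_basis C B) = ext_basis C B.
Proof.
elim: {B}#|B| {-2}B (erefl #|B|) => [|m IH] B e h.
  by rewrite (cards0_eq e) /eact ext_map0.
have [a aB] : exists a, a \in B by apply/card_gt0P; rewrite e.
have [k _ ->] := ext_basis_D1 aB.
rewrite linearZ /= eact_wedge h // IH //.
  by apply/eqP; rewrite -eqSS -e [in X in _ == X](cardsD1 a B) aB.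
by move=> p; rewrite inE => /andP[_]; exact: h.
Qed.

Lemma eact_fix a b c B : root_pair a b -> bar a \notin B -> bar b \notin B ->
  eact (rootel a b c) (ext_basis C B) = ext_basis C B.
Proof.
move=> ab aB bB; apply: eact_basis_ind => p pB.
rewrite natural_act_rootel_letter //.
have -> : (bar b == p) = false by apply: contraNF bB => /eqP->.
have -> : (bar a == p) = false by apply: contraNF aB => /eqP->.
by rewrite !scale0r subrr scaler0 addr0.
Qed.

(** The root element of (a, b) moves only the letters bar a and bar b, and sends bar b to bar b + c
    a. The scalar e brings the factor bar b to the front, so it does not depend on c. *)
Lemma eact_move a b B : root_pair a b -> bar a \notin B -> bar b \in B ->
  exists2 e : C, e != 0 & forall c, eact (rootel a b c) (ext_basis C B) =
    ext_basis C B + (c * e) *: wedge (delta_mx 0 a) (ext_basis C (B :\ bar b)).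
Proof.
move=> ab aB bB; have [e e0 he] := ext_basis_D1 bB.
exists e => // c; rewrite {1}he linearZ /= eact_wedge eact_fix //; last first.
- by rewrite !inE eqxx.
- by rewrite !inE (negPf aB) andbF.
rewrite natural_act_rootel_letter // eqxx scale1r.
have -> : (bar a == bar b) = false.
  by rewrite (inj_eq (@bar_inj n)); apply: negbTE; case/andP: ab.
rewrite scale0r subr0 -[delta_mx 0 (bar b)]scale1r wedgeDl !scale1r.
rewrite wedgeZl scalerDr -he scalerA.
by rewrite [e * c]mulrC.
Qed.

Lemma eact_move_kill a b c B : root_pair a b -> bar a \notin B -> a \in B ->
  eact (rootel a b c) (ext_basis C B) = ext_basis C B.
Proof.
move=> ab aB a_B; case: (boolP (bar b \in B)) => bB; last exact: eact_fix.
have [e _ ->] := eact_move ab aB bB.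
rewrite wedge_basis_in ?scaler0 ?addr0 // !inE a_B andbT.
by case/andP: ab.
Qed.

Definition eweight i B : int := (lshift n i \in B)%:Z - (rshift n i \in B)%:Z.

Lemma eact_torel i z B : z != 0 ->
  eact (torel (lshift n i) z) (ext_basis C B) = z ^ (2 * eweight i B) *: ext_basis C B.
Proof.
move=> z0; have -> : eweight i B = \sum_(a in B) wt i a.
  rewrite /eweight /wt sumrB; congr (_ - _).
    case: (boolP (_ \in B)) => h.
      rewrite (bigD1 _ h) /= eqxx big1 ?addr0 // => a /andP[_ /negPf->] //.
    by rewrite big1 // => a aB; case: eqP => // e; rewrite -e aB in h.
  case: (boolP (_ \in B)) => h.
    rewrite (bigD1 _ h) /= eqxx big1 ?addr0 // => a /andP[_ /negPf->] //.
  by rewrite big1 // => a aB; case: eqP => // e; rewrite -e aB in h.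
elim: {B}#|B| {-2}B (erefl #|B|) => [|m IH] B e.
  by rewrite (cards0_eq e) /eact ext_map0 big_set0 mulr0 expr0z scale1r.
have [a aB] : exists a, a \in B by apply/card_gt0P; rewrite e.
have [k _ ke] := ext_basis_D1 aB.
rewrite ke linearZ /= eact_wedge IH; last first.
  by apply/eqP; rewrite -eqSS -e [in X in _ == X](cardsD1 a B) aB.
have -> : natural_act (torel (lshift n i) z) (delta_mx 0 a) = z ^ (2 * wt i a) *: delta_mx 0 a.
  rewrite natural_act_torel //; apply/rowP=> p; rewrite !mxE eqxx /=.
  by case: eqP => [->|]; rewrite ?mulr0.
have wZ v t x : wedge v (t *: x) = t *: wedge v x :> ext by rewrite linearZ.
rewrite wedgeZl wZ !scalerA; congr (_ *: _).
have -> : 2 * (\sum_(a0 in B) wt i a0) =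
    2 * wt i a + 2 * (\sum_(a0 in B :\ a) wt i a0) :> int.
  by rewrite (big_setD1 a) //= mulrDr.
by rewrite expfzDr // mulrC.
Qed.

End SpinorsAndForms.

Section CanonicalTensor.
Variables (C : numClosedFieldType) (n : nat).
Local Notation natural := 'rV[C]_(n + n).
Variables (X : lmodType C) (F : natural -> natural -> X).
Hypotheses (Fl : forall w, linear (F^~ w)) (Fr : forall v, linear (F v)).

Let FDl v v' w : F (v + v') w = F v w + F v' w.
Proof. by have := Fl w 1 v v'; rewrite !scale1r. Qed.
Let FDr v v' w : F w (v + v') = F w v + F w v'.
Proof. by have := Fr w 1 v v'; rewrite !scale1r. Qed.
Let F0l w : F 0 w = 0.
Proof. by have := Fl w (-1) 0 0; rewrite scaler0 addr0 scaleN1r addNr. Qed.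
Let F0r w : F w 0 = 0.
Proof. by have := Fr w (-1) 0 0; rewrite scaler0 addr0 scaleN1r addNr. Qed.
Let FZl c v w : F (c *: v) w = c *: F v w.
Proof. by have := Fl w c v 0; rewrite F0l !addr0. Qed.
Let FZr c v w : F w (c *: v) = c *: F w v.
Proof. by have := Fr w c v 0; rewrite F0r !addr0. Qed.
Let FNl v w : F (- v) w = - F v w.
Proof. by rewrite -[- v]scaleN1r FZl scaleN1r. Qed.
Let FNr v w : F w (- v) = - F w v.
Proof. by rewrite -[- v]scaleN1r FZr scaleN1r. Qed.
Let Fsl w (G : 'I_(n + n) -> natural) : F (\sum_a G a) w = \sum_a F (G a) w.
Proof. by elim/big_rec2: _ => [|a u v _ <-]; [exact: F0l | exact: FDl]. Qed.
Let Fsr w (G : 'I_(n + n) -> natural) : F w (\sum_a G a) = \sum_a F w (G a).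
Proof. by elim/big_rec2: _ => [|a u v _ <-]; [exact: F0r | exact: FDr]. Qed.

(* The canonical tensor of the quadratic form is orthogonally invariant. *)
Lemma refl_canonical (w : natural) : quad w = 1 ->
  \sum_a F (refl w (delta_mx 0 (bar a))) (refl w (delta_mx 0 a)) =
  \sum_a F (delta_mx 0 (bar a)) (delta_mx 0 a).
Proof.
move=> w1.
have rE a : refl w (delta_mx 0 a) = w 0 (bar a) *: w - delta_mx 0 a.
  by rewrite /refl bilC bil_delta.
have e a : F (refl w (delta_mx 0 (bar a))) (refl w (delta_mx 0 a)) =
    (w 0 a * w 0 (bar a)) *: F w w - F w (w 0 a *: delta_mx 0 a)
    - F (w 0 (bar a) *: delta_mx 0 (bar a)) w + F (delta_mx 0 (bar a)) (delta_mx 0 a).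
  rewrite !rE barK FDl FNl !FDr !FNr opprD opprK addrA.
  by rewrite !(FZl, FZr) scalerA.
under eq_bigr do rewrite e.
rewrite big_split /= !sumrB -scaler_suml -Fsr -Fsl -row_sum_delta.
have -> : \sum_a w 0 (bar a) *: (delta_mx 0 (bar a) : natural) = w.
  by rewrite [RHS]row_sum_delta [RHS](reindex_inj (@bar_inj n)).
have -> : \sum_a w 0 a * w 0 (bar a) = 2 by rewrite -/(bil w w) bil_quad w1 mulr1.
by rewrite scaler_nat mulr2n addrK subrr add0r.
Qed.
End CanonicalTensor.

(** Induction on the product of reflections, with F arbitrary so that each reflection can be
    absorbed into it. *)
Lemma spin_canonical (C : numClosedFieldType) n (X : lmodType C)
    (F : 'rV[C]_(n + n) -> 'rV[C]_(n + n) -> X) (g : 'End({ffun {set 'I_n} -> C^o})) :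
  (forall w, linear (F^~ w)) -> (forall v, linear (F v)) -> spin g ->
  \sum_a F (natural_act g (delta_mx 0 (bar a))) (natural_act g (delta_mx 0 a)) =
  \sum_a F (delta_mx 0 (bar a)) (delta_mx 0 a).
Proof.
move=> Fl Fr [s [us os ->]]; rewrite -/(prodcl s).
under eq_bigr do rewrite !natural_act_prodcl //.
elim: s F Fl Fr us {os} => [//|w s IH] F Fl Fr /= /andP[/eqP w1 us].
have rl : linear (refl w) by move=> c u v; rewrite /refl bilDr scalerDl -scalerA scalerBr opprD addrACA.
rewrite (IH (fun u v => F (refl w u) (refl w v))) //.
- exact: refl_canonical.
- by move=> u c v v'; rewrite rl Fl.
- by move=> u c v v'; rewrite rl Fr.
Qed.

(** * Explicit highest weight vectors *)

Section HighestVectors.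
Variables (C : numClosedFieldType) (n : nat).
Local Notation letter := 'I_(n + n).
Local Notation spinor := {ffun {set 'I_n} -> C^o}.
Local Notation ext := {ffun {set 'I_(n + n)} -> C^o}.
Implicit Types (a b p q : letter) (c d z : C) (g h k : 'End(spinor)).
Implicit Types (B : {set 'I_(n + n)}) (A : {set 'I_n}) (i j : 'I_n).

Lemma pospair_ind (P : letter -> letter -> Prop) :
  (forall a b, P a b -> P b a) ->
  (forall i j, (i < j)%N -> P (lshift n i) (lshift n j)) ->
  (forall i j, (i < j)%N -> P (lshift n i) (rshift n j)) ->
  forall a b, pospair a b -> P a b.
Proof.
move=> Ps Pe Pf a b /andP[ab]; have [anb _] := andP ab.
case: (letterP a) (letterP b) ab anb => i [] j ab anb.
- rewrite eq_lshift in anb => _.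
  case: (ltngtP i j) => ij; [exact: Pe | exact/Ps/Pe | ].
  by move: anb; rewrite -val_eqE /= ij eqxx.
- rewrite height_l height_r => h; apply: Pf.
  by have := ltn_ord i; have := ltn_ord j; move: h; clear; lia.
- rewrite height_l height_r => h; apply/Ps/Pf.
  by have := ltn_ord i; have := ltn_ord j; move: h; clear; lia.
- rewrite !height_r => h; exfalso.
  by have := ltn_ord i; have := ltn_ord j; move: h; clear; lia.
Qed.

Lemma pospair_root a b : pospair a b -> root_pair a b.
Proof. by case/andP. Qed.

Lemma pospair_fix (V : vectType C) (r : 'End(spinor) -> 'End(V)) (x : V) :
  (forall i j c, (i < j)%N -> r (rootel (lshift n i) (lshift n j) c) x = x) ->
  (forall i j c, (i < j)%N -> r (rootel (lshift n i) (rshift n j) c) x = x) ->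
  forall a b c, pospair a b -> r (rootel a b c) x = x.
Proof.
move=> he hf a b c ab; move: (pospair_root ab) c.
elim/pospair_ind: ab => [p q IH pq c|i j ij _ c|i j ij _ c].
- rewrite root_pairC in pq; have [_ h] := andP pq.
  by rewrite rootelC ?IH // neq_barC.
- exact: he.
- exact: hf.
Qed.

Lemma root_pair_ee i j : (i < j)%N -> root_pair (lshift n i) (lshift n j).
Proof.
by move=> ij; rewrite /root_pair bar_l eq_lrshift eq_lshift -val_eqE /= ltn_eqF.
Qed.
Lemma root_pair_ef i j : (i < j)%N -> root_pair (lshift n i) (rshift n j).
Proof.
by move=> ij; rewrite /root_pair bar_r eq_lrshift eq_lshift -val_eqE /= ltn_eqF.
Qed.

(** Its basis vector is e_0 /\ ... /\ e_{m-1}, the highest weight vector of the m-th exterior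
    power. *)
Definition eset (m : nat) : {set letter} := [set lshift n i | i : 'I_n & (i < m)%N].
Lemma eset_l m i : (lshift n i \in eset m) = (i < m)%N.
Proof.
apply/imsetP/idP => [[j]|im]; last by exists i; rewrite ?inE.
by rewrite inE => jm /eqP; rewrite eq_lshift => /eqP->.
Qed.
Lemma eset_r m i : (rshift n i \in eset m) = false.
Proof. by apply/imsetP => [[j _ /eqP]]; rewrite eq_rlshift. Qed.

Lemma eset_hwv m : hwv (@eact C n) (fun i => 2 * (i < m)%N%:Z) (ext_basis C (eset m)).
Proof.
split=> [i z z0|]; first by rewrite eact_torel // /eweight eset_l eset_r subr0.
apply: pospair_fix => i j c ij.
  by apply: eact_fix; rewrite ?bar_l ?eset_r //; exact: root_pair_ee.
case: (ltnP i m) => im.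
  by apply: eact_move_kill; rewrite ?bar_l ?eset_r ?eset_l //; exact: root_pair_ef.
apply: eact_fix; rewrite ?bar_l ?bar_r ?eset_r ?eset_l //; first exact: root_pair_ef.
by rewrite -leqNgt (leq_trans im) // ltnW.
Qed.

Lemma cl_l_basis_in i A : i \in A -> cl (lshift n i) (ext_basis C A) = 0.
Proof. by move=> iA; rewrite cl_l wedge_basis_in. Qed.

Section Psi.
Variables (m : nat) (L : 'I_n).
Hypothesis hL : L = n.-1 :> nat.

Let ltL i j : (i < j)%N -> i != L.
Proof.
by move=> ij; rewrite -val_eqE /= hL; have := ltn_ord j; move: ij; clear; lia.
Qed.

(** The highest weight vector of the other half-spin module Delta_-; one Clifford multiplication
    brings it into Delta_+. *)
Definition eta : spinor := ext_basis C (~: [set L]).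

Lemma eta_hwv : hwv (@sact C n) (fun i => if i == L then -1 else 1) eta.
Proof.
split=> [i z z0|].
  by rewrite /sact torel_basis !inE; case: eqP.
apply: pospair_fix => i j c ij; apply: rootel_kill;
  try (left; apply: cl_l_basis_in; rewrite !inE; exact: ltL ij).
  exact: root_pair_ee.
exact: root_pair_ef.
Qed.

(** The canonical tensor of W acts, its first factor on x by Clifford multiplication and its second
    on y by exterior multiplication; invariance of that tensor makes Phi equivariant. *)
Definition Phi (x : spinor) (y : ext) : {ffun ({set 'I_n} * {set letter})%type -> C^o} :=
  \sum_a tens (clifford (delta_mx 0 (bar a)) x) (wedge (delta_mx 0 a) y).

Lemma Phi_equiv g x y : spin g ->
  tact (@sact C n) (@eact C n) g (Phi x y) = Phi (sact g x) (eact g y).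
Proof.
move=> sg; rewrite /Phi linear_sum /=.
rewrite -(spin_canonical (F := fun v w => tens (clifford v (sact g x)) (wedge w (eact g y))) _ _ sg).
- by apply: eq_bigr => a _; rewrite tact_tens /sact natural_act_apply // eact_wedge.
- by move=> w c u v /=; rewrite cliffordD cliffordZ tensDl.
- by move=> u c v w /=; rewrite wedgeDl tensDr.
Qed.

Lemma PhiZ c d x y : Phi (c *: x) (d *: y) = (c * d) *: Phi x y.
Proof.
rewrite /Phi scaler_sumr; apply: eq_bigr => a _.
have wZ : wedge (delta_mx 0 a) (d *: y) = d *: wedge (delta_mx 0 a) y by rewrite linearZ.
rewrite clvZ wZ; apply/ffunP=> p; rewrite !ffunE /GRing.scale /=; ring.
Qed.

Definition phi0 := Phi eta (ext_basis C (eset m)).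

Lemma phi0_hwv : hwv (tact (@sact C n) (@eact C n))
  (fun i => 2 * (i < m)%N%:Z + (if i == L then -1 else 1)) phi0.
Proof.
have [et eu] := eta_hwv; have [pt pu] := eset_hwv m.
split=> [i z z0|a b c ab].
  rewrite /phi0 (Phi_equiv _ _ (spin_torel _ z0)).
  have -> : sact (torel (lshift n i) z) eta = _ := et i z z0.
  rewrite pt // PhiZ.
  by rewrite expfzDr // mulrC.
rewrite /phi0 (Phi_equiv _ _ (spin_rootel c (pospair_root ab))).
have -> : sact (rootel a b c) eta = _ := eu a b c ab.
by rewrite pu.
Qed.

Lemma phi0_neq0 : phi0 != 0.
Proof.
(* A coordinate to which only the term a = f_L contributes: there e_L completes eta to the full
   product. *)
apply/eqP => /ffunP /(_ (setT, rshift n L |: eset m)).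
rewrite /phi0 /Phi sum_ffunE (bigD1 (rshift n L)) //= big1 ?addr0; last first.
  move=> a aL; rewrite ffunE /=.
  case: (boolP (a \in eset m)) => ae.
    by rewrite wedge_basis_in // ffunE mulr0.
  rewrite wedge_basis // !ffunE.
  case: eqP => [e|_]; last by rewrite /GRing.scale /= !mulr0.
  have : a \in rshift n L |: eset m by rewrite e setU11.
  by rewrite !inE (negPf aL) (negPf ae).
rewrite bar_r wedge_basis ?eset_r // clE cl_l wedge_basis ?inE ?eqxx //.
have -> : L |: ~: [set L] = setT by apply/setP=> j; rewrite !inE orbN.
rewrite !ffunE !eqxx /GRing.scale /= !mulr1 => /eqP.
by rewrite mulf_eq0 !(negPf (sgn_unit _ _ _)).
Qed.

End Psi.
End HighestVectors.

Section Theta.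
Variables (C : numClosedFieldType) (n : nat).
Local Notation letter := 'I_(n + n).
Local Notation spinor := {ffun {set 'I_n} -> C^o}.
Implicit Types (a b p q : letter) (c d z : C) (f g h k : 'End(spinor)) (x y : spinor).
Implicit Types (A B : {set 'I_n}) (i j : 'I_n).

Definition parity : 'End(spinor) :=
  linfun (fun x : spinor => [ffun A : {set 'I_n} => (-1) ^+ #|A| * x A] : spinor).

Lemma parityE x A : parity x A = (-1) ^+ #|A| * x A.
Proof.
rewrite /parity linfunE ?ffunE // => c y z; apply/ffunP=> B.
by rewrite !ffunE /GRing.scale /=; ring.
Qed.

Lemma parity_basis A : parity (ext_basis C A) = (-1) ^+ #|A| *: ext_basis C A.
Proof.
apply/ffunP=> B; rewrite parityE !ffunE /GRing.scale /=.
by case: eqP => [->|]; rewrite ?mulr0.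
Qed.

Lemma parity_clifford w x : parity (clifford w x) = - clifford w (parity x).
Proof.
have hw v y : parity (wedge v y) = - wedge v (parity y).
  apply/ffunP=> A; rewrite parityE !ffunE mulr_sumr -sumrN; apply: eq_bigr => i iA.
  rewrite parityE [in LHS](cardsD1 i A) iA exprS; ring.
have hc v y : parity (contract v y) = - contract v (parity y).
  apply/ffunP=> A; rewrite parityE !ffunE mulr_sumr -sumrN; apply: eq_bigr => i iA.
  by rewrite parityE cardsU1 -in_setC iA exprS; ring.
by rewrite !cliffordE raddfD /= hw hc opprD.
Qed.

Lemma clvN w x : clifford w (- x) = - clifford w x.
Proof. exact: linearN. Qed.

Lemma parity_rootel a b c x : parity (rootel a b c x) = rootel a b c (parity x).
Proof.
by rewrite !rootelE linearD linearZ /= /cl !parity_clifford clvN opprK.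
Qed.
Lemma parity_torel a z x : parity (torel a z x) = torel a z (parity x).
Proof.
by rewrite !torelE linearD !linearZ /= /cl !parity_clifford !clvN !opprK.
Qed.

Definition plist (l : seq letter) : 'End(spinor) :=
  foldr (fun a h => (clifford (delta_mx 0 a) \o h)%VF) \1%VF l.
Lemma plist_cons a l x : plist (a :: l) x = cl a (plist l x).
Proof. by rewrite /= comp_lfunE. Qed.

Lemma plist_cl l a x : bar a \notin l ->
  plist l (cl a x) = (-1) ^+ size l *: cl a (plist l x).
Proof.
elim: l => [_|b l IH]; first by rewrite !lfunE /= scale1r.
rewrite inE negb_or => /andP[ab al]; rewrite !plist_cons IH // clZ cl_anti.
  by rewrite scalerN -scaleNr /= exprS mulN1r.
by rewrite eq_sym.
Qed.

Definition isotropic (l : seq letter) := forall a b, a \in l -> b \in l -> a != bar b.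

Lemma cl_plist l a x : isotropic l -> a \in l -> cl a (plist l x) = 0.
Proof.
elim: l => //= b l IH iso; rewrite -/(plist (b :: l)) plist_cons inE.
case: (eqVneq a b) => [->|ab] /= al; first by rewrite cl_sq.
rewrite cl_anti ?IH ?cl0 //; last by apply: iso; rewrite inE ?eqxx ?al ?orbT.
- by apply/eqP; rewrite oppr_eq0.
- by move=> p q pl ql; apply: iso; rewrite inE ?pl ?ql orbT.
Qed.

Lemma plist_cl0 l a x : isotropic l -> a \in l -> plist l (cl a x) = 0.
Proof.
move=> iso al; rewrite plist_cl ?cl_plist ?scaler0 //.
by apply/negP=> bl; have := iso _ _ bl al; rewrite eqxx.
Qed.

Lemma plist_torel l i z x : z != 0 ->
  torel (lshift n i) z (plist l x) =
  z ^ (2 * \sum_(a <- l) wt i a) *: plist l (torel (lshift n i) z x).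
Proof.
move=> z0; elim: l => [|a l IH]; first by rewrite big_nil mulr0 expr0z scale1r !lfunE.
rewrite !plist_cons torel_wt // IH clZ scalerA big_cons.
by rewrite -expfzDr // -mulrDr.
Qed.

Definition elist (m : nat) : seq letter := [seq lshift n i | i <- enum 'I_n & (i < m)%N].

Lemma elist_l m i : (lshift n i \in elist m) = (i < m)%N.
Proof.
apply/mapP/idP => [[j]|im]; last by exists i; rewrite // mem_filter im mem_enum.
by rewrite mem_filter => /andP[jm _] /eqP; rewrite eq_lshift => /eqP->.
Qed.
Lemma elist_r m i : (rshift n i \in elist m) = false.
Proof. by apply/mapP => [[j _ /eqP]]; rewrite eq_rlshift. Qed.
Lemma elist_iso m : isotropic (elist m).
Proof.
move=> a b; case: (letterP a) (letterP b) => i [] j; rewrite ?elist_r // => _ _.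
by rewrite bar_l eq_lrshift.
Qed.
Lemma elist_wt m i : \sum_(a <- elist m) wt i a = (i < m)%N%:Z.
Proof.
rewrite big_map big_filter big_enum_cond /=.
case: (ltnP i m) => im.
  rewrite (bigD1 i) //= big1 ?addr0; first by rewrite /wt eqxx eq_lrshift subr0.
  by move=> j /andP[_ /negPf ji]; rewrite /wt eq_lshift eq_lrshift ji.
rewrite big1 // => j jm; rewrite /wt eq_lshift eq_lrshift.
by case: eqP => // e; move: jm; rewrite e ltnNge im.
Qed.

(* The sign of the invariant bilinear form on spinors, which pairs e_B with
   e_(~: B); [theta] is the resulting identification of End(S) with S (x) S. *)
Definition sgnB B : C := (-1) ^+ (\sum_(j in B) j).

(** The indices below i lie in B or in its complement, so the exponents of the two ordering signs
    add up to i, which is what i contributes to [sgnB]. *)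
Lemma sgnB_U1 i B : i \notin B ->
  sgnB (i |: B) * ext_sign C i (~: (i |: B)) = sgnB B * ext_sign C i B.
Proof.
move=> iB; rewrite /sgnB big_setU1 //= exprD /ext_sign.
have e : (#|[set j in B | (j < i)%N]| + #|[set j in ~: (i |: B) | (j < i)%N]|)%N = i.
  rewrite -cardsUI [X in (_ + X)%N](_ : _ = 0%N); last first.
    apply/eqP; rewrite cards_eq0; apply/eqP/setP=> j; rewrite !inE.
    by case: (j \in B); rewrite ?orbT ?andbF.
  rewrite addn0 -[RHS](card_ord i).
  have -> : [set j in B | (j < i)%N] :|: [set j in ~: (i |: B) | (j < i)%N] =
     [set widen_ord (ltnW (ltn_ord i)) j | j : 'I_i].
    apply/setP=> j; rewrite !inE; apply/idP/imsetP => [h|[k _ ->]].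
      have ji : (j < i)%N by case/orP: h => /andP[].
      by exists (Ordinal ji) => //; apply: val_inj.
    rewrite /= ltn_ord !andbT negb_or.
    case: (boolP (_ \in B)) => //= _; rewrite andbT -val_eqE /= ltn_eqF ?ltn_ord //.
  by rewrite card_imset // => j k /(congr1 val) /= /val_inj.
rewrite -{1}e exprD -!mulrA; set u := _ ^+ #|_|; set v := _ ^+ #|_|; set w := _ ^+ _.
have vv : v * v = 1 by rewrite -expr2 sqrr_sign.
by rewrite [w * v]mulrC [v * (v * w)]mulrA vv mul1r mulrC.
Qed.

Definition theta h : {ffun ({set 'I_n} * {set 'I_n})%type -> C^o} :=
  \sum_(B : {set 'I_n}) sgnB B *: tens (h (ext_basis C B)) (ext_basis C (~: B)).

Definition rmap f := tact (fun _ : 'End(spinor) => \1%VF : 'End(spinor)) (fun _ => f) \1%VF.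
Lemma rmap_tens f x y : rmap f (tens x y) = tens x (f y).
Proof. by rewrite /rmap tact_tens lfunE. Qed.

Lemma tensZl c x y : tens (c *: x) y = c *: tens x y.
Proof. by apply/ffunP=> p; rewrite !ffunE /GRing.scale /=; ring. Qed.
Lemma tensZr c x y : tens x (c *: y) = c *: tens x y.
Proof. by apply/ffunP=> p; rewrite !ffunE /GRing.scale /=; ring. Qed.

(** Letters are self-adjoint for the pairing behind [theta], so acting on the right factor amounts
    to composing h with the letter first. The sums match after insertion of i into B. *)
Lemma theta_letter a h :
  rmap (clifford (delta_mx 0 a)) (theta h) = theta (h \o clifford (delta_mx 0 a))%VF.
Proof.
rewrite /theta linear_sum /=; under eq_bigr do rewrite linearZ /= rmap_tens clE.
under [RHS]eq_bigr do rewrite comp_lfunE clE.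
have t0 x : tens x (0 : spinor) = 0 by apply/ffunP=> p; rewrite !ffunE mulr0.
have t0' y : tens (0 : spinor) y = 0 by apply/ffunP=> p; rewrite !ffunE mul0r.
case: (letterP a) => i.
  rewrite (bigID (fun B => i \in B)) /= [X in _ + X]big1 ?addr0; last first.
    by move=> B iB; rewrite cl_l_basis_in ?inE // t0 scaler0.
  rewrite [RHS](bigID (fun B => i \in B)) /= [X in _ = X + _]big1 ?add0r; last first.
    by move=> B iB; rewrite cl_l_basis_in // linear0 t0' scaler0.
  rewrite (reindex_onto (fun B => i |: B) (fun B => B :\ i)) /=; last first.
    by move=> B iB; rewrite setD1K.
  apply: eq_big => [B|B /andP[_ /eqP e]].
    rewrite setU11 /=; apply/eqP/idP => [<-|iB]; last by rewrite setU1K.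
    by rewrite !inE eqxx.
  have iB : i \notin B by rewrite -e !inE eqxx.
  rewrite !cl_l !wedge_basis ?inE ?eqxx // linearZ /= tensZl tensZr !scalerA.
  rewrite sgnB_U1 //; congr (_ *: tens _ (ext_basis C _)).
  by apply/setP=> j; rewrite !inE; case: eqP => [->|].
rewrite (bigID (fun B => i \in B)) /= [X in X + _]big1 ?add0r; last first.
  by move=> B iB; rewrite cl_r contract_basis_notin ?inE ?iB // t0 scaler0.
rewrite [RHS](bigID (fun B => i \in B)) /= [X in _ = _ + X]big1 ?addr0; last first.
  by move=> B iB; rewrite cl_r contract_basis_notin // linear0 t0' scaler0.
rewrite [RHS](reindex_onto (fun B => i |: B) (fun B => B :\ i)) /=; last first.
  by move=> B iB; rewrite setD1K.
apply: eq_big => [B|B iB].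
  rewrite setU11 /=; apply/idP/eqP => [iB|<-]; first by rewrite setU1K.
  by rewrite !inE eqxx.
rewrite !cl_r !contract_basis ?inE ?eqxx // linearZ /= tensZl tensZr !scalerA.
have -> : (~: B) :\ i = ~: (i |: B) by apply/setP=> j; rewrite !inE negb_or.
rewrite setU1K // ext_signU1 // ltnn expr0 mulr1; congr (_ *: _).
have -> : ext_sign C i (~: B) = ext_sign C i (~: (i |: B)).
  have -> : ~: (i |: B) = (~: B) :\ i by apply/setP=> j; rewrite !inE negb_or.
  by rewrite ext_signD1 ?inE // ltnn mulr1.
have := sgnB_U1 iB; set s1 := sgnB _; set s2 := ext_sign C i _; set s3 := sgnB _.
set s4 := ext_sign C i B => e.
have s22 : s2 * s2 = 1 by exact: ext_sign_sqr.
have s44 : s4 * s4 = 1 by exact: ext_sign_sqr.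
transitivity ((s3 * s4) * s4 * s2); first by rewrite -[s3 * s4 * s4]mulrA s44 mulr1.
by rewrite -e -!mulrA [s4 * s2]mulrC [s2 * (s2 * s4)]mulrA s22 mul1r.
Qed.

Lemma theta_lin c f g : theta (c *: f + g) = c *: theta f + theta g.
Proof.
rewrite /theta scaler_sumr -big_split /=; apply: eq_bigr => B _.
by rewrite add_lfunE scale_lfunE tensDl scalerDr !scalerA mulrC.
Qed.

Lemma theta0f : theta 0 = 0.
Proof.
by rewrite /theta big1 // => B _; apply/ffunP=> p; rewrite !ffunE lfunE ffunE mul0r scaler0.
Qed.

Lemma theta_sum (I : Type) (q : seq I) (e : I -> C) (F : I -> 'End(spinor)) :
  theta (\sum_(i <- q) e i *: F i) = \sum_(i <- q) e i *: theta (F i).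
Proof.
by elim/big_rec2: _ => [|i a b _ <-]; [exact: theta0f | exact: theta_lin].
Qed.

Lemma theta_clifford w h :
  rmap (clifford w) (theta h) = theta (h \o clifford w)%VF.
Proof.
have e1 : clifford w = \sum_a w 0 a *: clifford (delta_mx 0 a).
  by apply/lfunP=> x; rewrite clifford_sum sum_lfunE; apply: eq_bigr => a _; rewrite scale_lfunE.
have rl : forall x y, rmap (clifford w) (tens x y) = \sum_a w 0 a *: rmap (clifford (delta_mx 0 a)) (tens x y).
  move=> x y; rewrite rmap_tens clifford_sum tens_sumr; apply: eq_bigr => a _.
  by rewrite rmap_tens clE.
have -> : rmap (clifford w) = \sum_a w 0 a *: rmap (clifford (delta_mx 0 a)).
  apply: tens_lfun_eq => x y; rewrite rl sum_lfunE; apply: eq_bigr => a _.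
  by rewrite scale_lfunE.
have -> : (h \o clifford w)%VF = \sum_a w 0 a *: (h \o clifford (delta_mx 0 a))%VF.
  apply/lfunP=> x; rewrite e1 comp_lfunE !sum_lfunE linear_sum; apply: eq_bigr => a _.
  by rewrite !scale_lfunE comp_lfunE linearZ.
rewrite sum_lfunE theta_sum; apply: eq_bigr => a _.
by rewrite scale_lfunE theta_letter.
Qed.

(** The right factor g turns into composition with the reversed product, which is g^-1 because the
    vectors have norm 1. Thus S (x) S becomes End(S) under conjugation. *)
Lemma tact_theta g h : spin g ->
  tact (@sact C n) (@sact C n) g (theta h) = theta (g \o h \o g^-1)%VF.
Proof.
case=> s [us os ->]; rewrite -/(prodcl s).
have us' : all (fun w : 'rV[C]_(n + n) => quad w == 1) (rev s) by rewrite all_rev.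
have e2 := prodcl_revK us'; rewrite revK in e2.
rewrite (inv_lfun_uniq (prodcl_revK us) e2).
have R t f : rmap (prodcl t) (theta f) = theta (f \o prodcl (rev t))%VF.
  elim: t f => [|w t IH] f /=.
    rewrite comp_lfun1r; have -> : rmap \1%VF = \1%VF.
      by apply: tens_lfun_eq => x y; rewrite rmap_tens !lfunE.
    by rewrite lfunE.
  have -> : rmap (clifford w \o prodcl t)%VF = (rmap (clifford w) \o rmap (prodcl t))%VF.
    by apply: tens_lfun_eq => x y; rewrite comp_lfunE !rmap_tens comp_lfunE.
  rewrite comp_lfunE IH theta_clifford rev_cons -cats1 prodcl_cat /= comp_lfun1r.
  by rewrite comp_lfunA.
rewrite -R; rewrite /theta !linear_sum; apply: eq_bigr => B _.
by rewrite !linearZ /= tact_tens rmap_tens comp_lfunE.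
Qed.

Lemma thetaE h A B : theta h (A, B) = sgnB (~: B) * h (ext_basis C (~: B)) A.
Proof.
rewrite /theta sum_ffunE (bigD1 (~: B)) //= big1 ?addr0 => [|D /negPf DB].
  by rewrite !ffunE /= setCK eqxx mulr1.
by rewrite !ffunE /= -(inj_eq (@setC_inj _)) setCK eq_sym DB /GRing.scale /= !mulr0.
Qed.

Section Vector.
Variable m : nat.

(** The product of the first m letters e_i has the wanted weight. The factor with [parity] kills the
    odd part, and for n = m + 4 this places the tensor in Delta_+ (x) Delta_+ ([theta0_odd]). *)
Definition projm : 'End(spinor) := (plist (elist m) \o (\1 + parity))%VF.
Lemma projmE x : projm x = plist (elist m) (x + parity x).
Proof. by rewrite /projm comp_lfunE add_lfunE id_lfunE. Qed.

Definition theta0 := theta projm.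

Lemma theta0_hwv : hwv (tact (@sact C n) (@sact C n)) (fun i => 2 * (i < m)%N%:Z) theta0.
Proof.
split=> [i z z0|].
  rewrite /theta0 (tact_theta _ (spin_torel _ z0)).
  have [_ e1 _] := spinV (spin_torel (lshift n i) z0).
  have -> : (torel (lshift n i) z \o projm \o (torel (lshift n i) z)^-1)%VF =
     z ^ (2 * (i < m)%N%:Z) *: projm.
    have -> : (torel (lshift n i) z \o projm)%VF =
        (z ^ (2 * (i < m)%N%:Z) *: projm \o torel (lshift n i) z)%VF.
      apply/lfunP=> x; rewrite comp_lfunE [in RHS]comp_lfunE scale_lfunE !projmE.
      by rewrite plist_torel // elist_wt linearD /= parity_torel.
    by rewrite -comp_lfunA e1 comp_lfun1r.
  by have := theta_lin (z ^ (2 * (i < m)%N%:Z)) projm 0; rewrite theta0f !addr0.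
have key a b c : root_pair a b ->
    (forall x, plist (elist m) (cl a (cl b x)) = cl a (cl b (plist (elist m) x))) ->
    tact (@sact C n) (@sact C n) (rootel a b c) theta0 = theta0.
  move=> ab h; rewrite /theta0 (tact_theta _ (spin_rootel c ab)); congr theta.
  have [_ e1 _] := spinV (spin_rootel c ab).
  have -> : (rootel a b c \o projm)%VF = (projm \o rootel a b c)%VF.
    apply/lfunP=> x; rewrite comp_lfunE [in RHS]comp_lfunE !projmE parity_rootel.
    have -> : rootel a b c x + rootel a b c (parity x) = rootel a b c (x + parity x).
      by rewrite linearD.
    by rewrite !rootelE [RHS]linearD [X in _ = _ + X]linearZ /= h.
  by rewrite -comp_lfunA e1 comp_lfun1r.
apply: pospair_fix => i j c ij.
  apply: key => [|x]; first exact: root_pair_ee.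
  rewrite !plist_cl ?bar_l ?elist_r // clZ scalerA -expr2 sqrr_sign scale1r //.
apply: key => [|x]; first exact: root_pair_ef.
(* For j < m both composites vanish. Otherwise neither e_i nor f_j is dual to a factor of the
   product, and the two pass through it with the same sign. *)
case: (ltnP j m) => jm.
  have im := ltn_trans ij jm.
  rewrite plist_cl0 ?elist_l //; last exact: elist_iso.
  rewrite cl_anti ?bar_r ?eq_lshift -?val_eqE /= ?ltn_eqF // cl_plist ?elist_l //.
    by rewrite cl0; apply/eqP; rewrite eq_sym oppr_eq0.
  exact: elist_iso.
rewrite plist_cl ?bar_l ?elist_r // plist_cl ?bar_r ?elist_l ?ltnNge ?jm //.
by rewrite clZ scalerA -expr2 sqrr_sign scale1r.
Qed.

End Vector.

Section VectorCoordinates.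
Variable m : nat.
Hypothesis hm : n = (m + 4)%N.
Local Notation I := ([set i : 'I_n | (i < m)%N]).

Lemma plist_sorted (l : seq 'I_n) B : sorted (fun i j => (i < j)%N) l ->
  (forall i j, i \in l -> j \in B -> (i < j)%N) ->
  plist [seq lshift n i | i <- l] (ext_basis C B) = ext_basis C ([set i in l] :|: B).
Proof.
elim: l => [|i l IH] /=.
  move=> _ _; rewrite lfunE; congr (ext_basis C _).
  by apply/setP=> j; rewrite !inE.
move=> pl hl; have il : all (fun j => (i < j)%N) l.
  by apply: order_path_min pl => a b c; exact: ltn_trans.
rewrite -/(plist _) comp_lfunE IH ?(path_sorted pl) //; last first.
  by move=> a b al; apply: hl; rewrite inE al orbT.
rewrite clE cl_l wedge_basis; last first.
  rewrite !inE negb_or; apply/andP; split.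
    by apply/negP=> /(allP il); rewrite ltnn.
  by apply/negP=> iB; have := hl i i (mem_head _ _) iB; rewrite ltnn.
have -> : ext_sign C i ([set i in l] :|: B) = 1.
  rewrite /ext_sign (_ : [set j in _ | _] = set0) ?cards0 //.
  apply/setP=> j; rewrite !inE; apply/negP => /andP[/orP[jl|jB]].
    by rewrite ltnNge ltnW //; exact: (allP il).
  by rewrite ltnNge ltnW // hl ?mem_head.
by rewrite scale1r; congr (ext_basis C _); apply/setP=> j; rewrite !inE orbA.
Qed.

Lemma plist_elist B : plist (elist m) (ext_basis C B) =
  if [disjoint I & B] then ext_basis C (I :|: B) else 0.
Proof.
case: ifPn => [dIB|].
  rewrite plist_sorted.
  - by congr (ext_basis C _); apply/setP=> j; rewrite !inE mem_filter mem_enum andbT.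
  - apply: sorted_filter; first by move=> a b c; exact: ltn_trans.
    by have := iota_ltn_sorted 0 n; rewrite -val_enum_ord sorted_map.
  - move=> i j; rewrite mem_filter => /andP[im _] jB.
    have jm : ~~ (j < m)%N.
      by apply/negP=> jm; have := disjointFl dIB jB; rewrite inE jm.
    by rewrite -leqNgt in jm; exact: leq_trans im jm.
rewrite -setI_eq0 => /set0Pn; case=> i; rewrite !inE => /andP[im iB].
have -> : ext_basis C B = ext_sign C i (B :\ i) *: cl (lshift n i) (ext_basis C (B :\ i)).
  rewrite cl_l wedge_basis ?inE ?eqxx // scalerA ext_sign_sqr scale1r setD1K //.
by rewrite linearZ /= plist_cl0 ?scaler0 ?elist_l //; exact: elist_iso.
Qed.

Let cond A B := [&& ~~ odd #|~: B|, I \subset B & A == I :|: ~: B].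

Lemma theta0E A B : theta0 m (A, B) = if cond A B then 2 * sgnB (~: B) else 0.
Proof.
rewrite /theta0 thetaE projmE parity_basis -{1}[ext_basis C _]scale1r -scalerDl linearZ /=.
rewrite plist_elist disjoints_subset setCK /cond -signr_odd.
case: (odd _) => /=; first by rewrite expr1 subrr scale0r ffunE mulr0.
rewrite expr0; case: (I \subset B) => /=; last by rewrite scaler0 ffunE mulr0.
rewrite !ffunE /GRing.scale /=; case: eqP => _; last by rewrite !mulr0.
by rewrite mulr1 mulrC.
Qed.

Let sum_last : (\sum_(i in ~: I) i = 4 * m + 6)%N.
Proof.
have -> : (\sum_(i in ~: I) i = \sum_(i < n | (m <= i)%N) i)%N.
  by apply: eq_bigl => i; rewrite !inE -leqNgt.
rewrite hm big_split_ord /= big1 ?add0n; last by move=> i; rewrite leqNgt ltn_ord.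
under eq_bigl => i do rewrite leq_addr.
rewrite !big_ord_recl big_ord0 /= /bump /=; lia.
Qed.

Let card_last : #|~: I| = 4%N.
Proof.
have -> : ~: I = [set i : 'I_n | (m <= i)%N] by apply/setP=> i; rewrite !inE -leqNgt.
rewrite -sum1_card.
have -> : (\sum_(i in [set i : 'I_n | (m <= i)%N]) 1 = \sum_(i < n | (m <= i)%N) 1)%N.
  by apply: eq_bigl => i; rewrite inE.
rewrite hm big_split_ord /= big1 ?add0n; last by move=> i; rewrite leqNgt ltn_ord.
under eq_bigl => i do rewrite leq_addr.
by rewrite sum1_card card_ord.
Qed.

(** The complements of A and B partition the last four indices. Their number 4 is even, so both
    complements have even size; their sum 4 m + 6 is even, so the signs of (A, B) and (B, A) agree.
    This is why the tensor is symmetric and not alternating. *)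
Let condP A B : cond A B ->
  [/\ cond B A, sgnB (~: A) = sgnB (~: B), odd #|A| = odd n & odd #|B| = odd n].
Proof.
case/and3P=> ev IB /eqP AE.
have IA : I \subset A by rewrite AE subsetUl.
have dj : [disjoint ~: A & ~: B].
  by rewrite disjoints_subset setCK AE; apply/subsetP=> i; rewrite !inE negb_or negbK => /andP[].
have un : (~: A) :|: (~: B) = ~: I.
  apply/setP=> i; have := subsetP IB i; rewrite AE !inE.
  by case: (i < m)%N; case: (i \in B) => //= h; have := h isT.
have cc : (#|~: A| + #|~: B| = 4)%N.
  by rewrite -card_last -un cardsU (disjoint_setI0 dj) cards0 subn0.
have evA : ~~ odd #|~: A| by move: (congr1 odd cc); rewrite oddD (negPf ev) addbF => ->.
have par (D : {set 'I_n}) : ~~ odd #|~: D| -> odd #|D| = odd n.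
  move=> eD; have h : (#|D| + #|~: D| = n)%N by rewrite cardsC card_ord.
  by move: (congr1 odd h); rewrite oddD (negPf eD) addbF.
split; [ | | exact: par | exact: par].
- rewrite /cond evA IA /=; apply/eqP/setP=> i; have := subsetP IB i; rewrite AE !inE.
  by case: (i < m)%N; case: (i \in B) => //= h; have := h isT.
- have := congr1 (fun e : nat => (-1 : C) ^+ e) sum_last.
  rewrite -un (eq_bigl [predU ~: A & ~: B]); last by move=> i; rewrite !inE.
  rewrite bigU //= exprD -!/(sgnB _) => e.
  have {}e : sgnB (~: A) * sgnB (~: B) = 1.
    rewrite e (_ : (4 * m + 6 = 2 * (2 * m + 3))%N); last by lia.
    by rewrite exprM sqrrN !expr1n.
  have sq D : sgnB D * sgnB D = 1 by rewrite -expr2 sqrr_sign.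
  by rewrite -[LHS]mulr1 -(sq (~: B)) mulrA e mul1r.
Qed.

Lemma theta0_sym A B : theta0 m (A, B) = theta0 m (B, A).
Proof.
rewrite !theta0E; case: ifP => [/condP[-> -> _ _]//|nc].
by case: ifP => // /condP[]; rewrite nc.
Qed.

Lemma theta0_odd A B : theta0 m (A, B) != 0 -> odd #|A| = odd n /\ odd #|B| = odd n.
Proof. by rewrite theta0E; case: ifP => [/condP[]|]; rewrite ?eqxx. Qed.

Lemma theta0_neq0 : theta0 m != 0.
Proof.
apply/eqP=> /ffunP/(_ (I, setT)); rewrite theta0E ffunE /cond setCT cards0 subsetT setU0 eqxx /=.
by move/eqP; rewrite mulf_eq0 pnatr_eq0 signr_eq0.
Qed.

End VectorCoordinates.
End Theta.

(** * Exterior powers of degree below n are generated by their highest weight vector *)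

Section Generated.
Variables (C : numClosedFieldType) (n k : nat).
Hypothesis kn : (k < n)%N.
Local Notation letter := 'I_(n + n).
Local Notation ext := {ffun {set 'I_(n + n)} -> C^o}.
Implicit Types (a b p q : letter) (c d z : C) (B R : {set 'I_(n + n)}) (x y : ext).

Variable Z : ext -> Prop.
Hypothesis Zlin : forall c x y, Z x -> Z y -> Z (c *: x + y).
Hypothesis Zst : forall a b c x, root_pair a b -> Z x -> Z (eact (rootel a b c) x).
Hypothesis Z0 : Z (ext_basis C (eset n k)).

Let Zzero : Z 0.
Proof. by rewrite -(addNr (ext_basis C (eset n k))) -scaleN1r; exact: Zlin. Qed.
Let Zscale c x : Z x -> Z (c *: x).
Proof. by move=> h; rewrite -[_ *: _]addr0; apply: Zlin h Zzero. Qed.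
Let Zscale_inv c x : c != 0 -> Z (c *: x) -> Z x.
Proof. by move=> c0 /(Zscale c^-1); rewrite scalerA mulVf // scale1r. Qed.
Let Zsub x y : Z x -> Z y -> Z (x - y).
Proof. by move=> hx hy; rewrite addrC -scaleN1r; exact: Zlin. Qed.

(** Subtracting the basis vector from its translate by the root element of (q, bar p) leaves a
    nonzero multiple of the vector with p replaced by q. *)
Lemma ext_move B p q : p \in B -> q \notin B -> bar q \notin B -> q != bar p ->
  Z (ext_basis C B) -> Z (ext_basis C (q |: (B :\ p))).
Proof.
move=> pB qB bqB qbp ZB.
have rp : root_pair q (bar p).
  by rewrite /root_pair qbp barK; apply: contraNneq qB => ->.
have pB' : bar (bar p) \in B by rewrite barK.
have [e e0 h] := eact_move C rp bqB pB'.
have := Zst 1 rp ZB; rewrite h mul1r barK.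
move/Zsub/(_ ZB); rewrite addrAC addrN add0r.
rewrite wedge_basis ?inE ?(negPf qB) ?andbF //.
by move/(Zscale_inv e0)/(Zscale_inv (sgn_unit _ _ _)).
Qed.

Let idx a : 'I_n := match split a with inl i => i | inr i => i end.
Let idx_l i : idx (lshift n i) = i.
Proof. by rewrite /idx (unsplitK (inl i)). Qed.
Let idx_r i : idx (rshift n i) = i.
Proof. by rewrite /idx (unsplitK (inr i)). Qed.

Lemma free_index B : (#|B| < n)%N ->
  exists q, q \notin B /\ bar q \notin B.
Proof.
move=> Bn; have : ~~ ([set: 'I_n] \subset [set idx a | a in B]).
  apply: contraL Bn => /subset_leq_card; rewrite cardsT card_ord -leqNgt => h.
  exact: leq_trans h (leq_imset_card _ _).
case/subsetPn => i _ hi; exists (lshift n i); rewrite bar_l; split.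
  by apply: contra hi => h; apply/imsetP; exists (lshift n i); rewrite ?idx_l.
by apply: contra hi => h; apply/imsetP; exists (rshift n i); rewrite ?idx_r.
Qed.

Let nopair B := forall p, p \in B -> bar p \notin B.

Let card_swap B p q : p \in B -> q \notin B -> #|q |: (B :\ p)| = #|B|.
Proof.
by move=> pB qB; rewrite cardsU1 !inE (negPf qB) andbF (cardsD1 p B) pB.
Qed.

Let swapK B p q : p \in B -> q \notin B -> p |: ((q |: (B :\ p)) :\ q) = B.
Proof.
move=> pB qB; rewrite setU1K ?setD1K //.
by rewrite !inE (negPf qB) andbF.
Qed.

Lemma card_eset : #|eset n k| = k.
Proof.
rewrite /eset card_imset; last by move=> i j /eqP; rewrite eq_lshift => /eqP.
rewrite -[RHS](card_ord k).
have -> : [set i : 'I_n | (i < k)%N] = [set widen_ord (ltnW kn) j | j : 'I_k].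
  apply/setP=> i; rewrite inE; apply/idP/imsetP => [ik|[j _ ->]]; last exact: (ltn_ord j).
  by exists (Ordinal ik) => //; apply: val_inj.
by rewrite card_imset // => i j /(congr1 val) /= /val_inj.
Qed.

(** Induction on the number of letters of B outside [eset n k]: B is reached by moves from a set
    with one more letter c of [eset n k]. *)
Lemma ext_gen_nopair B : #|B| = k -> nopair B -> Z (ext_basis C B).
Proof.
elim: {B}_.+1 {-2}B (ltnSn #|B :\: eset n k|) => // N IH B lt Bk nB.
case: (set_0Vmem (B :\: eset n k)) => [e|[a]].
  have BE : B \subset eset n k by rewrite -setD_eq0 e.
  have : B == eset n k by rewrite eqEcard BE Bk card_eset leqnn.
  by move/eqP->.
rewrite inE => /andP[aE aB].
have [c] : exists c : letter, c \in eset n k :\: B.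
  apply/set0Pn; rewrite setD_eq0; apply: contraL aB => EB.
  have : eset n k == B by rewrite eqEcard EB Bk card_eset leqnn.
  by move/eqP=> <-.
rewrite inE => /andP[cB cE].
have less p : p \in B -> p \notin eset n k -> (#|(c |: (B :\ p)) :\: eset n k| < N)%N.
  move=> pB pE; rewrite -ltnS (leq_trans _ lt) // ltnS; apply: proper_card.
  apply/properP; split.
    apply/subsetP=> x; rewrite !inE => /andP[xE /orP[/eqP xc|/andP[_ xB]]].
      by rewrite xc cE in xE.
    by rewrite xE xB.
  exists p; rewrite !inE ?pB ?pE ?eqxx //=.
  by rewrite orbF; apply: contraNneq cB => <-.
case: (boolP (bar c \in B)) => bcB; last first.
  have ZB'' : Z (ext_basis C (c |: (B :\ a))).
    apply: IH; [exact: less | by rewrite card_swap |].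
    move=> p; rewrite !inE => /orP[/eqP->|/andP[pa pB]].
      by rewrite negb_or bar_neq negb_and bcB orbT.
    rewrite negb_or negb_and (nB _ pB) orbT andbT bar_eq.
    by apply: contraNneq bcB => <-.
  rewrite -(swapK aB cB); apply: ext_move ZB''.
  - by rewrite !inE eqxx.
  - by rewrite !inE eqxx /= orbF; apply: contraNneq cB => <-.
  - rewrite !inE negb_or negb_and (nB _ aB) orbT andbT bar_eq.
    by apply: contraNneq bcB => <-.
  - by apply: contraNneq bcB => <-.
have bcE : bar c \notin eset n k.
  by move: cE; case: (letterP c) => i; rewrite ?eset_r // bar_l eset_r.
pose B2 := c |: (B :\ bar c).
have B2k : #|B2| = k by rewrite card_swap.
have ZB2 : Z (ext_basis C B2).
  apply: IH; [exact: less | by [] |].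
  move=> p; rewrite !inE => /orP[/eqP->|/andP[pa pB]].
    by rewrite negb_or bar_neq eqxx.
  by rewrite negb_or negb_and (nB _ pB) orbT andbT bar_eq.
(* No root element takes c to its dual, so the move goes through a letter d whose index does not
   occur in B2; k < n provides one. *)
have [d [dB bdB]] : exists q, q \notin B2 /\ bar q \notin B2 by apply: free_index; rewrite B2k.
have cB2 : c \in B2 by rewrite !inE eqxx.
have bcB2 : bar c \notin B2 by rewrite !inE eqxx orbF bar_neq.
have dc : d != c by apply: contraNneq dB => ->.
have bdc : bar d != c by apply: contraNneq bdB => ->.
have ZB3 : Z (ext_basis C (d |: (B2 :\ c))).
  by apply: ext_move ZB2 => //; rewrite -bar_eq.
have -> : B = bar c |: ((d |: (B2 :\ c)) :\ d).
  rewrite setU1K; last by rewrite inE (negPf dB) andbF.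
  by rewrite /B2 setU1K ?setD1K // !inE (negPf cB) andbF.
apply: ext_move ZB3.
- by rewrite !inE eqxx.
- by rewrite in_setU1 in_setD1 negb_or negb_and bcB2 orbT andbT bar_eq eq_sym.
- by rewrite barK !inE eqxx /= orbF eq_sym.
- by rewrite (inj_eq (@bar_inj n)) eq_sym.
Qed.

Let npairs B := #|[set p in B | bar p \in B]|.

Lemma basis_two B p q : p \in B -> q \in B -> p != q ->
  exists2 e : C, e != 0 & ext_basis C B =
    e *: wedge (delta_mx 0 p) (wedge (delta_mx 0 q) (ext_basis C (B :\ p :\ q))).
Proof.
move=> pB qB pq; have [e1 h1 ->] := ext_basis_D1 C pB.
have [|e2 h2 ->] := @ext_basis_D1 C n q (B :\ p); first by rewrite !inE eq_sym pq.
exists (e1 * e2); first by rewrite mulf_neq0.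
have wZ v t x : wedge v (t *: x) = t *: wedge v x :> ext by rewrite linearZ.
by rewrite wZ scalerA.
Qed.

(* q /\ p' /\ R generates p /\ p' /\ R - q /\ q' /\ R, where p' = bar p and q' = bar q. *)
Lemma ext_pair_diff R p q : p \notin R -> bar p \notin R -> q \notin R -> bar q \notin R ->
  p != q -> p != bar q ->
  Z (ext_basis C (q |: (bar p |: R))) ->
  Z (wedge (delta_mx 0 p) (wedge (delta_mx 0 (bar p)) (ext_basis C R))
     - wedge (delta_mx 0 q) (wedge (delta_mx 0 (bar q)) (ext_basis C R))).
Proof.
move=> pR bpR qR bqR pq pbq ZB.
have rp : root_pair p (bar q) by rewrite /root_pair barK pbq pq.
have [|||e e0 he] := @basis_two (q |: (bar p |: R)) q (bar p).
- by rewrite !inE eqxx.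
- by rewrite !inE eqxx orbT.
- by rewrite eq_sym bar_eq.
have RR : (q |: (bar p |: R)) :\ q :\ bar p = R.
  rewrite setU1K ?setU1K // !inE negb_or qR andbT eq_sym bar_eq //.
rewrite RR in he.
have ZW : Z (wedge (delta_mx 0 q) (wedge (delta_mx 0 (bar p)) (ext_basis C R))).
  by apply: (Zscale_inv e0); rewrite -he.
have h c : eact (rootel p (bar q) c) (wedge (delta_mx 0 q) (wedge (delta_mx 0 (bar p)) (ext_basis C R)))
   = wedge (delta_mx 0 q + c *: delta_mx 0 p) (wedge (delta_mx 0 (bar p) - c *: delta_mx 0 (bar q)) (ext_basis C R)).
  rewrite !eact_wedge eact_fix ?barK // !natural_act_rootel_letter // barK !eqxx.
  have -> : (bar p == q) = false by rewrite bar_eq; apply: negbTE.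
  have -> : (q == bar p) = false by rewrite eq_sym bar_eq; apply: negbTE.
  by rewrite !scale0r !scale1r subr0 sub0r scalerN.
have wP u t x y : wedge u (t *: x + y) = t *: wedge u x + wedge u y by exact: linearP.
have {}h c : eact (rootel p (bar q) c) (wedge (delta_mx 0 q) (wedge (delta_mx 0 (bar p)) (ext_basis C R))) =
   c *: ((- c) *: wedge (delta_mx 0 p) (wedge (delta_mx 0 (bar q)) (ext_basis C R))
         + wedge (delta_mx 0 p) (wedge (delta_mx 0 (bar p)) (ext_basis C R)))
   + ((- c) *: wedge (delta_mx 0 q) (wedge (delta_mx 0 (bar q)) (ext_basis C R))
         + wedge (delta_mx 0 q) (wedge (delta_mx 0 (bar p)) (ext_basis C R))).
  rewrite h; have -> : delta_mx 0 (bar p) - c *: delta_mx 0 (bar q) =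
      (- c) *: delta_mx 0 (bar q) + delta_mx 0 (bar p) :> 'rV[C]_(n + n).
    by rewrite addrC scaleNr.
  have -> : delta_mx 0 q + c *: delta_mx 0 p = c *: delta_mx 0 p + delta_mx 0 q :> 'rV[C]_(n + n).
    by rewrite addrC.
  by rewrite wedgeDl wedgeDl !wP.
have z1 := Zst 1 rp ZW; rewrite h in z1.
have z2 := Zst (-1) rp ZW; rewrite h in z2.
have := Zsub z1 z2 => {z1 z2}.
move: (wedge (delta_mx 0 p) (wedge (delta_mx 0 (bar p)) (ext_basis C R))) => x1.
move: (wedge (delta_mx 0 q) (wedge (delta_mx 0 (bar q)) (ext_basis C R))) => x2.
move: (wedge (delta_mx 0 p) _) (wedge (delta_mx 0 q) _) => x3 x4 hz.
have n2 : (2 : C) != 0 by rewrite pnatr_eq0.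
apply: (Zscale_inv n2); move: hz; congr Z.
apply/ffunP=> A; rewrite !ffunE /GRing.scale /=; ring.
Qed.

(** Induction on the dual pairs in B. For a pair p, bar p and a free letter q, [ext_pair_diff] with
    q gives a difference; with bar q the second term changes sign, so the two add up to twice the
    wanted vector. *)
Lemma ext_gen B : #|B| = k -> Z (ext_basis C B).
Proof.
elim: {B}_.+1 {-2}B (ltnSn (npairs B)) => // N IH B lt Bk.
have [nB|] := boolP [forall p, (p \in B) ==> (bar p \notin B)].
  by apply: ext_gen_nopair => // p pB; exact: (implyP (forallP nB p)).
rewrite negb_forall => /existsP[p]; rewrite negb_imply negbK => /andP[pB bpB].
have [q [qB bqB]] : exists q, q \notin B /\ bar q \notin B by apply: free_index; rewrite Bk.
have pq : p != q by apply: contraNneq qB => <-.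
have pbq : p != bar q by apply: contraNneq bqB => <-.
pose R := B :\ p :\ bar p.
have bpp : bar p != p by exact: bar_neq.
have pR : p \notin R by rewrite !inE eqxx andbF.
have bpR : bar p \notin R by rewrite !inE eqxx.
have qR : q \notin R by rewrite !inE (negPf qB) !andbF.
have bqR : bar q \notin R by rewrite !inE (negPf bqB) !andbF.
have BR : B = p |: (bar p |: R) by rewrite /R !setD1K // !inE bpp.
have Rk (x : letter) : x \notin B -> #|x |: (bar p |: R)| = k.
  move=> xB; have xbp : x != bar p by apply: contraNneq xB => ->.
  have xR : x \notin R by rewrite !inE (negPf xB) !andbF.
  rewrite cardsU1 in_setU1 (negPf xbp) (negPf xR) /= -Bk [in RHS]BR [in RHS]cardsU1.
  by rewrite in_setU1 eq_sym (negPf bpp) (negPf pR).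
have small (x : letter) : x \notin B -> bar x \notin B -> (npairs (x |: (bar p |: R)) < N)%N.
  move=> xB bxB; rewrite -ltnS (leq_trans _ lt) // ltnS; apply: proper_card.
  have xp : x != p by apply: contraNneq xB => ->.
  have xbp : x != bar p by apply: contraNneq xB => ->.
  have inR (y : letter) : (y \in R) -> y \in B by rewrite !inE => /and3P[].
  have sub (y : letter) : y \in x |: (bar p |: R) -> y != x -> y \in B.
    by rewrite !inE => /orP[->//|/orP[/eqP->//|/andP[_ /andP[_ ->]]]].
  apply/properP; split.
    apply/subsetP=> y; rewrite inE => /andP[y1 y2].
    have yx : y != x.
      apply: contraNneq bxB => e; rewrite e in y2; apply: sub y2 _; exact: bar_neq.
    have byx : bar y != x.
      by apply: contraNneq bxB => e; rewrite -e barK; exact: sub.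
    by rewrite inE !sub.
  exists p; first by rewrite inE pB.
  by rewrite inE !in_setU1 eq_sym (negPf xp) eq_sym (negPf bpp) (negPf pR).
have Z1 := ext_pair_diff pR bpR qR bqR pq pbq (IH _ (small _ qB bqB) (Rk _ qB)).
have bbq : bar (bar q) \notin B by rewrite barK.
have bbqR : bar (bar q) \notin R by rewrite barK.
have pbbq : p != bar (bar q) by rewrite barK.
have Z2 := ext_pair_diff pR bpR bqR bbqR pbq pbbq (IH _ (small _ bqB bbq) (Rk _ bqB)).
rewrite barK (wedge_anticomm (delta_mx 0 (bar q))) opprK in Z2.
have pbp : p != bar p by rewrite eq_sym.
have [e e0 ->] := basis_two pB bpB pbp.
rewrite -/R; apply: Zscale.
have n2 : (2 : C) != 0 by rewrite pnatr_eq0.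
apply: (Zscale_inv n2); have := Zlin 1 Z1 Z2.
set x1 := wedge (delta_mx 0 p) _; set x2 := wedge (delta_mx 0 q) _.
clearbody x1 x2; congr Z; apply/ffunP=> A; rewrite !ffunE /GRing.scale /=; ring.
Qed.

End Generated.

(** * Equivariant morphisms *)

Lemma mem_basis_span (C : numClosedFieldType) (K : finType) (P : {pred K})
    (x : {ffun K -> C^o}) :
  x \in <<[seq dlt C k | k in P]>>%VS <-> (forall k, k \notin P -> x k = 0).
Proof.
split=> [xs k kP|h].
  have := coord_span (X := in_tuple [seq dlt C k | k in P]) xs => ->.
  rewrite sum_ffunE big1 // => i _; rewrite !ffunE.
  have := mem_nth 0 (ltn_ord i) => /imageP[j jP ->].
  by rewrite ffunE; case: eqP => [e|_]; [rewrite e jP in kP | rewrite scaler0].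
rewrite (dlt_sum x) memv_suml // => k _.
case: (boolP (k \in P)) => kP; last by rewrite h // scale0r mem0v.
by apply/memvZ/memv_span/image_f.
Qed.

Section SubRep.
Variables (C : numClosedFieldType) (n : nat) (V : vectType C)
  (r : 'End({ffun {set 'I_n} -> C^o}) -> 'End(V)) (U : {vspace V}).
Hypothesis hU : forall g x, spin g -> x \in U -> r g x \in U.

Lemma sub_actE g u : spin g -> vsval (@sub_act C n V r U g u) = r g (vsval u).
Proof.
move=> sg; rewrite /sub_act linfunE; first by rewrite vsprojK // hU // subvsP.
by move=> c x y; rewrite !linearP.
Qed.

Lemma sub_is_rep : is_rep r -> is_rep (@sub_act C n V r U).
Proof.
move=> [r1 rM rp]; split.
- by apply/lfunP=> u; apply: val_inj; rewrite /= sub_actE ?r1 ?lfunE //; exact: spin1.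
- move=> g h sg sh; apply/lfunP=> u; apply: val_inj => /=.
  rewrite sub_actE; last exact: spinM.
  by rewrite rM // !comp_lfunE !sub_actE.
- move=> a b ab; apply: pcurve_hom => u.
  have h : pcurve (fun c => r (rootel a b c) (vsval u)).
    by apply: pcurve_apply (rp _ _ ab) (pcurve_const _).
  apply: pcurve_ext (pcurve_lin (linfun (@vsproj _ V U)) h) => c.
  by rewrite lfunE /= -sub_actE ?vsvalK //; exact: spin_rootel.
Qed.
End SubRep.

Section Submodules.
Variables (C : numClosedFieldType) (n : nat).
Local Notation letter := 'I_(n + n).
Local Notation spinor := {ffun {set 'I_n} -> C^o}.
Local Notation ext := {ffun {set 'I_(n + n)} -> C^o}.
Implicit Types (a b p q : letter) (c d z : C) (g h : 'End(spinor)).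
Implicit Types (B : {set 'I_(n + n)}) (A : {set 'I_n}) (i j : 'I_n).

Local Notation D := (Delta_plus C n).
Local Notation actD := (Delta_plus_act C n).

Lemma half_spinP (x : spinor) :
  x \in half_spin_plus C n <-> (forall A, odd #|A| != odd n -> x A = 0).
Proof.
rewrite /half_spin_plus; split=> [/mem_basis_span h A oA|h].
  by apply: h; rewrite inE.
by apply/mem_basis_span => A; rewrite inE => /h.
Qed.

Lemma parity_spin g x : spin g -> parity C n (g x) = g (parity C n x).
Proof.
case=> s [_ os ->]; rewrite -/(prodcl s).
have e y : parity C n (prodcl s y) = (-1) ^+ odd (size s) *: prodcl s (parity C n y).
  elim: s {os} => [|w s IH] /=; first by rewrite !lfunE scale1r.
  by rewrite !comp_lfunE parity_clifford IH clvZ signrN scaleNr.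
by rewrite e (negPf os) scale1r.
Qed.

(** Being an eigenspace of an operator that commutes with the group, Delta_+ is stable. *)
Lemma half_spin_parity (x : spinor) :
  x \in half_spin_plus C n <-> parity C n x = (-1) ^+ n *: x.
Proof.
split=> [/half_spinP h|e]; [apply/ffunP=> A | apply/half_spinP=> A oA].
  rewrite parityE ffunE /GRing.scale /= -signr_odd -[(-1) ^+ n]signr_odd.
  by case: (eqVneq (odd #|A|) (odd n)) => [->//|/h->]; rewrite !mulr0.
have /ffunP/(_ A) := e; rewrite parityE ffunE /GRing.scale /= -signr_odd -[(-1) ^+ n]signr_odd.
have n2 : (2 : C) != 0 by rewrite pnatr_eq0.
have fin : 2 * x A = 0 -> x A = 0 by move/eqP; rewrite mulf_eq0 (negPf n2) => /eqP.
move: (x A) fin oA => t fin.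
case: (odd _); case: (odd _) => //= _; rewrite ?expr0 ?expr1 mulN1r mul1r => h; apply: fin.
  by rewrite mulr_natl mulr2n -{1}h addNr.
by rewrite mulr_natl mulr2n {1}h addNr.
Qed.

Lemma half_spin_stable g x : spin g -> x \in half_spin_plus C n -> g x \in half_spin_plus C n.
Proof.
move=> sg /half_spin_parity e; apply/half_spin_parity.
by rewrite parity_spin // e linearZ.
Qed.

Lemma actDE g (u : D) : spin g -> vsval (actD g u) = g (vsval u).
Proof. exact: (sub_actE (r := @sact C n) half_spin_stable). Qed.

Definition goodA A := odd #|A| == odd n.
(** The intended basis vector only under [goodA A]; for the other parity it projects a vector lying
    outside Delta_+. *)
Definition sD A : D := vsproj (half_spin_plus C n) (ext_basis C A).
Lemma sDE A : goodA A -> vsval (sD A) = ext_basis C A.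
Proof.
move=> gA; rewrite vsprojK //; apply/half_spinP => A' oA'.
by rewrite ffunE; case: eqP => // e; move: gA; rewrite /goodA -e (negPf oA').
Qed.

Lemma D_sum (u : D) : u = \sum_(A | goodA A) vsval u A *: sD A.
Proof.
apply: val_inj; rewrite /= linear_sum /=.
rewrite {1}(ext_basis_sum (vsval u)) (bigID goodA) /= [X in _ + X]big1 ?addr0; last first.
  by move=> A gA; rewrite (_ : vsval u A = 0) ?scale0r //; exact: ((half_spinP (vsval u)).1 (subvsP u) A gA).
by apply: eq_bigr => A gA; rewrite sDE.
Qed.

Variable k : nat.
Local Notation U := (wedge_natural C n k).
Local Notation actU := (wedge_natural_act C n k).

Lemma ext_powerP (x : ext) :
  x \in ext_power C (n + n) k <-> (forall B, #|B| != k -> x B = 0).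
Proof.
rewrite /ext_power; split=> [/mem_basis_span h B oB|h].
  by apply: h; rewrite inE.
by apply/mem_basis_span => B; rewrite inE => /h.
Qed.

Lemma wedges_card (s : seq 'rV[C]_(n + n)) B : #|B| != size s -> wedges s B = 0.
Proof.
elim: s B => [|v s IH] B /=.
  by rewrite ffunE cards_eq0 => /negPf->.
move=> hB; rewrite ffunE big1 // => i iB; rewrite IH ?mulr0 //.
by move: hB; rewrite (cardsD1 i B) iB.
Qed.

Lemma ext_power_stable g x : spin g -> x \in ext_power C (n + n) k ->
  eact g x \in ext_power C (n + n) k.
Proof.
move=> _ /ext_powerP h; apply/ext_powerP => B hB.
rewrite /eact ext_mapE sum_ffunE big1 // => B' _.
rewrite ffunE; case: (eqVneq #|B'| k) => [e|/h->]; last by rewrite scale0r.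
by rewrite wedges_card ?scaler0 // size_map -cardE e.
Qed.

Lemma actUE g (u : U) : spin g -> vsval (actU g u) = eact g (vsval u).
Proof. exact: (sub_actE (r := @eact C n) ext_power_stable). Qed.

Lemma U_is_rep : is_rep actU.
Proof. exact: (sub_is_rep (r := @eact C n) ext_power_stable (eact_is_rep C n)). Qed.

Definition wU B : U := vsproj (ext_power C (n + n) k) (ext_basis C B).
Lemma wUE B : #|B| = k -> vsval (wU B) = ext_basis C B.
Proof.
move=> gB; rewrite vsprojK //; apply/ext_powerP => B' oB'.
by rewrite ffunE; case: eqP => // e; move: oB'; rewrite e gB eqxx.
Qed.

Lemma U_sum (u : U) : u = \sum_(B : {set letter} | #|B| == k) vsval u B *: wU B.
Proof.
apply: val_inj; rewrite /= linear_sum /=.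
rewrite {1}(ext_basis_sum (vsval u)) (bigID (fun B : {set letter} => #|B| == k)) /= [X in _ + X]big1 ?addr0; last first.
  by move=> B gB; rewrite (_ : vsval u B = 0) ?scale0r //; exact: ((ext_powerP (vsval u)).1 (subvsP u) B gB).
by apply: eq_bigr => B /eqP gB; rewrite wUE.
Qed.

Definition lU : 'Hom(U, C^o) := linfun (fun u : U => vsval u (eset n k) : C^o).
Lemma lUE u : lU u = vsval u (eset n k).
Proof. by rewrite /lU linfunE // => c x y; rewrite linearP /= !ffunE. Qed.

Hypothesis kn : (k < n)%N.

(** What [irreducible_datum] provides for V, here with an explicit form. Irreducibility is not a
    hypothesis here, and nondegeneracy comes from [ext_gen]. *)
Lemma U_datum : [/\ is_rep actU, hwv actU (fun i => 2 * (i < k)%N%:Z) (wU (eset n k)),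
  lU (wU (eset n k)) = 1, hw_functional actU (fun i => 2 * (i < k)%N%:Z) lU & nondeg actU lU].
Proof.
have ce : #|eset n k| = k by exact: card_eset.
have hB (x : ext) : x (eset n k) = herm x (ext_basis C (eset n k)).
  by rewrite hermC herm_basis conjCK.
have he := eset_hwv C n k; have [ht hu] := he.
split.
- exact: U_is_rep.
- split=> [i z z0|a b c ab]; apply: val_inj; rewrite /=.
    rewrite actUE ?wUE //; last exact: spin_torel.
    by rewrite ht // linearZ /= wUE.
  rewrite actUE ?wUE //; last exact/spin_rootel/pospair_root.
  by rewrite hu.
- by rewrite lUE wUE // ffunE eqxx.
- split=> [a b c x nab|i z x z0]; rewrite !lUE !hB.
    rewrite actUE; last by apply: spin_rootel; case/andP: nab.
    exact: (adj_neg_pos (@eact_adjrep C n) he).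
  have zc0 : z^* != 0 by rewrite conjC_eq0.
  rewrite actUE; last exact: spin_torel.
  rewrite (eact_adjrep (spin_torel _ z0) (spin_torel _ zc0) (torel_adj _ _)).
  rewrite ht // hermZr; congr (_ * _).
  by case: (2 * _) => N; rewrite /exprz ?fmorphV !rmorphXn /= conjCK.
- move=> x hx; apply: val_inj => /=.
  (* The orthogonal of the orbit of x, stable because adjoints stay in the group. It contains the
     highest weight vector by assumption on x, hence every basis vector of degree k. *)
  pose Z (w : ext) := forall g, spin g -> herm (eact g (vsval x)) w = 0.
  have ZB B : #|B| = k -> Z (ext_basis C B).
    apply: ext_gen => //.
    + by move=> c y y' h h' g sg; rewrite hermDr h // h' // mulr0 addr0.
    + move=> a b c y ab h g sg.
      have sr := spin_rootel c ab.
      have [g' sg' ad] := spin_adj sr.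
      rewrite -(eact_adjrep sg' sr (isadj_sym ad)).
      have [_ hM _] := eact_is_rep C n.
      by have := h _ (spinM sg' sg); rewrite hM // comp_lfunE.
    + by move=> g sg; rewrite -hB -actUE // -lUE hx.
  apply/ffunP=> B; rewrite [RHS]ffunE.
  case: (eqVneq #|B| k) => [/ZB/(_ _ (spin1 _ _))|]; last exact: ((ext_powerP (vsval x)).1 (subvsP x) B).
  have [e1 _ _] := eact_is_rep C n.
  by rewrite e1 lfunE /= hermC herm_basis conjCK.
Qed.

End Submodules.

Section Equivariance.
Variables (C : numClosedFieldType) (n : nat).
Local Notation spinor := {ffun {set 'I_n} -> C^o}.
Implicit Types (g h : 'End(spinor)).

Lemma exp2z_inj (e1 e2 : int) : (2 : C) ^ e1 = 2 ^ e2 -> e1 = e2.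
Proof.
have n2 : (2 : C) != 0 by rewrite pnatr_eq0.
have nat0 (N : nat) : (2 : C) ^+ N = 1 -> N = 0%N.
  move/eqP; rewrite -natrX -[1]/(1%:R) eqr_nat; case: N => // N.
  by rewrite expnS; case: (2 ^ N)%N => // t; rewrite mulnS.
have key (e : int) : (2 : C) ^ e = 1 -> e = 0.
  case: e => N; first by move/nat0->.
  by rewrite /exprz => /(congr1 GRing.inv); rewrite invrK invr1 => /nat0.
move=> e; apply/eqP; rewrite -subr_eq0; apply/eqP/key.
by rewrite expfzDr // e -expfzDr // subrr.
Qed.

(** Evaluation at z = 2 is enough, as the integral powers of 2 are distinct. *)
Lemma weight_eq (e1 e2 : int) (t : C) : t != 0 ->
  (forall z : C, z != 0 -> z ^ e1 * t = z ^ e2 * t) -> e1 = e2.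
Proof.
move=> t0 h; apply: exp2z_inj; apply: (mulIf t0); apply: h.
by rewrite pnatr_eq0.
Qed.

Lemma hwv_ext (V : vectType C) (r : 'End(spinor) -> 'End(V)) (lam mu : weight n) v :
  (forall i, lam i = mu i) -> hwv r lam v -> hwv r mu v.
Proof. by move=> e [h1 h2]; split=> // i z z0; rewrite -e h1. Qed.

Lemma hw_functional_ext (V : vectType C) (r : 'End(spinor) -> 'End(V)) (lam mu : weight n) l :
  (forall i, lam i = mu i) -> hw_functional r lam l -> hw_functional r mu l.
Proof. by move=> e [h1 h2]; split=> // i z x z0; rewrite -e h2. Qed.

Section Hom.
Variables (U V W : vectType C) (s : 'End(spinor) -> 'End(U))
  (r : 'End(spinor) -> 'End(V)) (t : 'End(spinor) -> 'End(W)).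
Hypothesis hr : is_rep r.

Lemma rep_inv g : spin g -> (r g \o r g^-1)%VF = \1%VF /\ (r g)^-1%VF = r g^-1%VF.
Proof.
move=> sg; have [sg' e1 e2] := spinV sg; case: hr => r1 rM _.
have h1 : (r g \o r g^-1)%VF = \1%VF by rewrite -rM // e1 r1.
have h2 : (r g^-1 \o r g)%VF = \1%VF by rewrite -rM // e2 r1.
by split=> //; exact: inv_lfun_uniq.
Qed.

Lemma hom_equivariantP (psi : 'Hom(U, 'Hom(V, W))) :
  equivariant s (@hom_act C n V W r t) psi <->
  forall g, spin g -> forall u x, psi (s g u) (r g x) = t g (psi u x).
Proof.
have haE g (f : 'Hom(V, W)) : hom_act r t g f = (t g \o f \o (r g)^-1)%VF.
  rewrite /hom_act linfunE // => c f1 f2.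
  by rewrite comp_lfunDr comp_lfunDl -comp_lfunZr -comp_lfunZl.
split=> [h g sg u x|h g sg u].
  rewrite h // haE !comp_lfunE; have [_ ->] := rep_inv sg.
  have [sg' _ e2] := spinV sg; case: hr => r1 rM _.
  by rewrite -[r _ (r g x)]comp_lfunE -rM // e2 r1 lfunE.
rewrite haE; apply/lfunP=> x; rewrite !comp_lfunE.
have [e ->] := rep_inv sg.
by rewrite -h // -[r g (r _ x)]comp_lfunE e lfunE.
Qed.

Lemma equivariant_nondeg (f : U -> V) (l : 'Hom(V, C^o)) :
  nondeg r l -> (forall g u, spin g -> f (s g u) = r g (f u)) ->
  (forall u, l (f u) = 0) -> forall u, f u = 0.
Proof. by move=> nd h l0 u; apply: nd => g sg; rewrite -h // l0. Qed.
End Hom.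
End Equivariance.

Section Morphisms.
Variables (C : numClosedFieldType) (n : nat).
Hypothesis hn : (5 <= n)%N.
Local Notation letter := 'I_(n + n).
Local Notation spinor := {ffun {set 'I_n} -> C^o}.
Implicit Types (a b p q : letter) (c d z : C) (g h : 'End(spinor)).
Implicit Types (B : {set 'I_(n + n)}) (A : {set 'I_n}) (i j : 'I_n).

Let ltL : (n.-1 < n)%N. Proof. by case: n hn. Qed.
Definition lastI : 'I_n := Ordinal ltL.
Local Notation L := lastI.
Let m := (n - 5)%N.
Let k := (n - 4)%N.
Let kn : (k < n)%N. Proof. by rewrite /k; move: hn; clear; lia. Qed.
Let kE : k = m.+1. Proof. by rewrite /k /m; move: hn; clear; lia. Qed.
Let hLE : L = n.-1 :> nat. Proof. by []. Qed.

Local Notation D := (Delta_plus C n).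
Local Notation actD := (Delta_plus_act C n).
Local Notation U := (wedge_natural C n (n - 4)).
Local Notation actU := (wedge_natural_act C n (n - 4)).

Definition lamV : weight n := fun i => 2 * (i < m)%N%:Z + (if i == L then -1 else 1).

Variables (V : vectType C) (rho : spin_action n V) (l : 'Hom(V, C^o)) (v : V).
Hypotheses (hr : is_rep rho) (hv : hwv rho lamV v) (lv : l v = 1)
  (hl : hw_functional rho lamV l) (nd : nondeg rho l).

(** Restrict the map from S (x) /\W to Delta_+ and degree n - 4. Each term of [phi0] lies in that
    part, so a zero restriction would send [phi0] to 0 and not to v. *)
Lemma psi_exists : exists psi : 'Hom(D, 'Hom(U, V)), psi != 0 /\
  equivariant actD (hom_act actU rho) psi.
Proof.
have [f [fE f0]] := hw_exists L hr hv lv hl nd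
  (tact_is_rep (sact_is_rep C n) (eact_is_rep C n))
  (tact_adjrep (sact_adjrep (C := C) (n := n)) (@eact_adjrep C n))
  (phi0_hwv C m hLE) (phi0_neq0 C m L).
pose F (u : D) : 'Hom(U, V) := linfun (fun x : U => f (tens (vsval u) (vsval x))).
have FE u x : F u x = f (tens (vsval u) (vsval x)).
  by rewrite /F linfunE // => c y z; rewrite linearP /= tensDr linearP.
pose psi : 'Hom(D, 'Hom(U, V)) := linfun F.
have pE u x : psi u x = f (tens (vsval u) (vsval x)).
  rewrite /psi linfunE ?FE // => c y z; apply/lfunP=> t.
  by rewrite add_lfunE scale_lfunE !FE linearP /= tensDl linearP.
exists psi; split; last first.
  apply/(hom_equivariantP _ _ (U_is_rep C n (n - 4))) => g sg u x.
  by rewrite !pE actDE // actUE // -fE // tact_tens.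
apply/negP=> /eqP p0.
have : v = 0.
  rewrite -f0 /phi0 /Phi linear_sum big1 // => a _.
  have dD : clifford (delta_mx 0 (bar a)) (eta C L) \in half_spin_plus C n.
    apply/half_spin_parity; rewrite parity_clifford parity_basis clvZ -scaleNr.
    congr (_ *: _); rewrite -signr_odd -[in RHS]signr_odd.
    have : (#|[set L]| + #|~: [set L]| = n)%N by rewrite cardsC card_ord.
    rewrite cards1 => /(congr1 odd) <-; rewrite oddD /=.
    by case: (odd _); rewrite ?expr1 ?expr0 ?opprK.
  have wU_ : wedge (delta_mx 0 a) (ext_basis C (eset n m)) \in ext_power C (n + n) (n - 4).
    apply/ext_powerP => B hB; case: (boolP (a \in eset n m)) => am.
      by rewrite wedge_basis_in // ffunE.
    rewrite wedge_basis // ffunE [X in _ *: X]ffunE; case: eqP => [e|_]; last by rewrite scaler0.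
    move: hB; rewrite e cardsU1 am (@card_eset n m).
      by rewrite -[(n - 4)%N]/k kE eqxx.
    by rewrite /m; move: hn; clear; lia.
  have := pE (vsproj (half_spin_plus C n) (clifford (delta_mx 0 (bar a)) (eta C L)))
    (vsproj (ext_power C (n + n) (n - 4)) (wedge (delta_mx 0 a) (ext_basis C (eset n m)))).
  by rewrite (vsprojK dD) (vsprojK wU_) p0 !zero_lfunE => h; exact: (esym h).
by move=> v0; move: lv; rewrite v0 linear0 => /eqP; rewrite eq_sym oner_eq0.
Qed.

(** Symmetrize the map from S (x) S. As [theta0] is symmetric and supported on Delta_+ (x) Delta_+,
    a zero symmetrization would annihilate twice its image, the highest weight vector of U. *)
Lemma a_exists : exists a : 'Hom(D, 'Hom(D, U)), a != 0 /\ sym2_equivariant actD actU a.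
Proof.
have [ur uv ul uf und] := U_datum C kn.
have nk4 : n = (k + 4)%N by rewrite /k; move: hn; clear; lia.
have [f [fE f0]] := hw_exists L ur uv ul uf und
  (tact_is_rep (sact_is_rep C n) (sact_is_rep C n))
  (tact_adjrep (sact_adjrep (C := C) (n := n)) (sact_adjrep (C := C) (n := n)))
  (theta0_hwv C n k) (theta0_neq0 C n k).
pose S (u w : D) : U := f (tens (vsval u) (vsval w)) + f (tens (vsval w) (vsval u)).
have Sl w : linear (S^~ w).
  move=> c x y; rewrite /S !linearP /= tensDl tensDr !linearP /= scalerDr.
  by rewrite addrACA.
have Sr u : linear (S u).
  move=> c x y; rewrite /S !linearP /= tensDl tensDr !linearP /= scalerDr.
  by rewrite addrACA.
pose a : 'Hom(D, 'Hom(D, U)) := linfun (fun u => linfun (S u)).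
have aE u w : a u w = S u w.
  rewrite /a linfunE; first by rewrite linfunE.
  move=> c x y; apply/lfunP=> t; rewrite add_lfunE scale_lfunE !linfunE //.
  exact: Sl.
exists a; split; last first.
  split=> [u w|g sg u w]; rewrite !aE /S; first by rewrite addrC.
  by rewrite !actDE // linearD /= -!fE // !tact_tens.
apply/negP=> /eqP a0.
have S0 u w : S u w = 0 by rewrite -aE a0 !zero_lfunE.
have n2 : (2 : C) != 0 by rewrite pnatr_eq0.
have : f (theta0 C n k) = 0.
  apply: (scalerI n2); rewrite scaler0 scaler_nat mulr2n.
  have e1 : f (theta0 C n k) = \sum_p theta0 C n k p *: f (tens (dlt C p.1) (dlt C p.2)).
    rewrite {1}(dlt_sum (theta0 C n k)) linear_sum; apply: eq_bigr => p _.
    by rewrite linearZ tens_dlt.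
  have e2 : f (theta0 C n k) = \sum_p theta0 C n k p *: f (tens (dlt C p.2) (dlt C p.1)).
    rewrite e1 (reindex_inj (inv_inj (_ : involutive (fun p : {set 'I_n} * {set 'I_n} => (p.2, p.1))))) /=.
      by apply: eq_bigr => -[A A'] _ /=; rewrite (theta0_sym C nk4).
    by case.
  rewrite {1}e1 e2 -big_split big1 //= => -[A A'] _ /=; rewrite -scalerDr.
  case: (eqVneq (theta0 C n k (A, A')) 0) => [->|/(theta0_odd nk4)[oA oA']]; first by rewrite scale0r.
  have := S0 (sD C A) (sD C A'); rewrite /S !sDE /goodA ?oA ?oA' // => ->.
  by rewrite scaler0.
rewrite f0 => /(congr1 (lU C n k)); rewrite ul linear0 => /eqP.
by rewrite oner_eq0.
Qed.

End Morphisms.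

(** * Uniqueness and the cubic identity *)

Section SpinorBasis.
Variables (C : numClosedFieldType) (n : nat).
Local Notation letter := 'I_(n + n).
Local Notation spinor := {ffun {set 'I_n} -> C^o}.
Implicit Types (a b : letter) (c z : C) (g : 'End(spinor)).
Implicit Types (A B : {set 'I_n}) (i j : 'I_n).
Local Notation D := (Delta_plus C n).
Local Notation actD := (Delta_plus_act C n).
Local Notation s_ A := (ext_basis C A : spinor).

Lemma cl_l_notin i A : i \notin A -> cl (lshift n i) (s_ A) = ext_sign C i A *: s_ (i |: A).
Proof. by move=> iA; rewrite cl_l wedge_basis. Qed.
Lemma cl_r_in i A : i \in A -> cl (rshift n i) (s_ A) = ext_sign C i A *: s_ (A :\ i).
Proof. by move=> iA; rewrite cl_r contract_basis. Qed.
Lemma cl_r_notin i A : i \notin A -> cl (rshift n i) (s_ A) = 0.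
Proof. by move=> iA; rewrite cl_r contract_basis_notin. Qed.

(** The root vector of the Lie algebra acting on Delta_+; root elements are exactly 1 + c [lower],
    with no term of higher order. *)
Definition lower a b (u : D) : D := vsproj (half_spin_plus C n) (cl a (cl b (vsval u))).

Lemma actD_rootel a b c u : root_pair a b ->
  actD (rootel a b c) u = u + c *: lower a b u.
Proof.
move=> ab; apply: val_inj; rewrite /= actDE ?rootelE; last exact: spin_rootel.
rewrite /lower vsprojK //; apply/half_spin_parity.
rewrite /cl !parity_clifford clvN opprK.
by have /half_spin_parity-> := subvsP u; rewrite !clvZ.
Qed.

Lemma lower_rr i j A : goodA A -> i \in A -> j \in A -> i != j ->
  exists2 e : C, e != 0 & lower (rshift n i) (rshift n j) (sD C A) = e *: sD C (A :\ j :\ i)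
     /\ goodA (A :\ j :\ i).
Proof.
move=> gA iA jA ij; have iAj : i \in A :\ j by rewrite !inE ij.
have gA' : goodA (A :\ j :\ i).
  by move: gA; rewrite /goodA (cardsD1 j A) jA (cardsD1 i (A :\ j)) iAj /= negbK.
exists (ext_sign C j A * ext_sign C i (A :\ j)); first by rewrite mulf_neq0 // sgn_unit.
by split=> //; rewrite /lower sDE // cl_r_in // clZ cl_r_in // scalerA linearZ.
Qed.

Lemma lower_rr0 i j A : goodA A -> i != j -> (i \notin A) || (j \notin A) ->
  lower (rshift n i) (rshift n j) (sD C A) = 0.
Proof.
move=> gA ij h; rewrite /lower sDE //; case: (boolP (j \in A)) h => jA; last first.
  by rewrite cl_r_notin // cl0 linear0.
rewrite orbF => iA; rewrite cl_r_in // clZ cl_r_notin ?scaler0 ?linear0 //.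
by rewrite !inE (negPf iA) andbF.
Qed.

Lemma lower_lr i j A : goodA A -> i \notin A -> j \in A -> i != j ->
  exists2 e : C, e != 0 & lower (lshift n i) (rshift n j) (sD C A) = e *: sD C (i |: (A :\ j))
     /\ goodA (i |: (A :\ j)).
Proof.
move=> gA iA jA ij; have iAj : i \notin A :\ j by rewrite !inE negb_and iA orbT.
have gA' : goodA (i |: (A :\ j)).
  by move: gA; rewrite /goodA cardsU1 iAj (cardsD1 j A) jA.
exists (ext_sign C j A * ext_sign C i (A :\ j)); first by rewrite mulf_neq0 // sgn_unit.
by split=> //; rewrite /lower sDE // cl_r_in // clZ cl_l_notin // scalerA linearZ.
Qed.

Lemma lower_lr0 i j A : goodA A -> i != j -> (i \in A) || (j \notin A) ->
  lower (lshift n i) (rshift n j) (sD C A) = 0.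
Proof.
move=> gA ij h; rewrite /lower sDE //; case: (boolP (j \in A)) h => jA; last first.
  by rewrite cl_r_notin // cl0 linear0.
rewrite orbF => iA; rewrite cl_r_in // clZ cl_l_basis_in ?scaler0 ?linear0 //.
by rewrite !inE ij.
Qed.

Lemma negpair_rr i j : i != j -> negpair (rshift n i) (rshift n j).
Proof.
move=> ij; rewrite /negpair /root_pair bar_r eq_rshift eq_rlshift ij /= !height_r.
by have := ltn_ord i; have := ltn_ord j; clear; lia.
Qed.

Lemma negpair_lr i j : (j < i)%N -> negpair (lshift n i) (rshift n j).
Proof.
move=> ij; rewrite /negpair /root_pair bar_r eq_lrshift eq_lshift -val_eqE /= gtn_eqF //=.
rewrite height_l height_r; have := ltn_ord i; have := ltn_ord j; move: ij; clear; lia.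
Qed.

Definition swt A i : int := if i \in A then 1 else -1.

Lemma actD_torel i z A : z != 0 -> goodA A ->
  actD (torel (lshift n i) z) (sD C A) = z ^ swt A i *: sD C A.
Proof.
move=> z0 gA; apply: val_inj; rewrite /= actDE ?sDE //; last exact: spin_torel.
by rewrite torel_basis /swt; case: ifP.
Qed.

(** The values at 1 and -1 add up to 2 y, and 8 times the value at 1 minus the value at 2 is 6 x + 4
    y. *)
Lemma linear_coeff (x y t : C) : (forall c, c * x + c ^+ 2 * y + c ^+ 3 * t = 0) -> x = 0.
Proof.
move=> h; have h1 := h 1; have h2 := h (-1); have h3 := h 2.
have n2 : (2 : C) != 0 by rewrite pnatr_eq0.
have n6 : (6 : C) != 0 by rewrite pnatr_eq0.
have y0 : y = 0.
  apply: (mulfI n2); rewrite mulr0 -[RHS](addr0 0) -{1}h1 -h2; ring.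
apply: (mulfI n6); rewrite mulr0.
transitivity (8 * (1 * x + 1 ^+ 2 * y + 1 ^+ 3 * t)
   - (2 * x + 2 ^+ 2 * y + 2 ^+ 3 * t)); first by rewrite y0; ring.
by rewrite h1 h3 mulr0 subr0.
Qed.

Section Trilinear.
Variable T : D -> D -> D -> C.
Implicit Types x y : D.
Hypotheses (T1 : forall c x x' y (z : D), T (x + c *: x') y z = T x y z + c * T x' y z)
  (Tcyc : forall x y (z : D), T x y z = T y z x) (Tsym : forall x y (z : D), T x y z = T x z y).
Hypothesis Tneg : forall a b c x y (z : D), negpair a b ->
  T (actD (rootel a b c) x) (actD (rootel a b c) y) (actD (rootel a b c) z) = T x y z.

Let T2 c x x' y (z : D) : T y (x + c *: x') z = T y x z + c * T y x' z.
Proof. by rewrite (Tcyc y) T1 -(Tcyc y) -(Tcyc y). Qed.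
Let T3 c x x' y (z : D) : T y z (x + c *: x') = T y z x + c * T y z x'.
Proof. by rewrite -(Tcyc _ y z) T1 (Tcyc x) (Tcyc x'). Qed.

(** Infinitesimal invariance: the coefficient of c in the invariance under the root element of
    parameter c. *)
Lemma tri_lower a b x y (z : D) : negpair a b ->
  T (lower a b x) y z + T x (lower a b y) z + T x y (lower a b z) = 0.
Proof.
move=> nab; have ab : root_pair a b by case/andP: nab.
pose y2 := T (lower a b x) (lower a b y) z + T (lower a b x) y (lower a b z)
  + T x (lower a b y) (lower a b z).
apply: (@linear_coeff _ y2 (T (lower a b x) (lower a b y) (lower a b z))) => c.
have := Tneg c x y z nab; rewrite !actD_rootel // !(T1, T2, T3) /y2.
move/eqP; rewrite -subr_eq0 => /eqP e; rewrite -[RHS]e; ring.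
Qed.

Lemma triZ1 c x y (z : D) : T (c *: x) y z = c * T x y z.
Proof.
have h0 : T 0 y z = 0.
  have := T1 1 0 0 y z; rewrite scale1r addr0 mul1r => /eqP.
  by rewrite -subr_eq0 opprD addrA subrr add0r oppr_eq0 => /eqP.
by rewrite -[c *: x]add0r T1 h0 add0r.
Qed.
Lemma tri0 y (z : D) : T 0 y z = 0.
Proof. by rewrite -(scale0r (0 : D)) triZ1 mul0r. Qed.
Lemma triZ2 c x y (z : D) : T y (c *: x) z = c * T y x z.
Proof. by rewrite (Tcyc y) triZ1 -(Tcyc y). Qed.
Lemma triZ3 c x y (z : D) : T y z (c *: x) = c * T y z x.
Proof. by rewrite -(Tcyc _ y z) triZ1 Tcyc. Qed.
Lemma tri30 x y : T x y 0 = 0. Proof. by rewrite -(Tcyc 0) tri0. Qed.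

Lemma tri_perm x y (z : D) : T x y z = T y x z.
Proof. by rewrite Tcyc Tsym. Qed.

End Trilinear.
End SpinorBasis.

(** * Vanishing of the symmetric trilinear form *)

Section Cubic.
Variables (C : numClosedFieldType) (n : nat).
Hypothesis hn : (5 <= n)%N.
Implicit Types (A B : {set 'I_n}) (i j : 'I_n).
Local Notation D := (Delta_plus C n).
Local Notation actD := (Delta_plus_act C n).
Local Notation L := (lastI hn).
Local Notation m := (n - 5)%N.

Variable T : D -> D -> D -> C.
Hypotheses (T1 : forall c x x' y z, T (x + c *: x') y z = T x y z + c * T x' y z)
  (Tcyc : forall x y z, T x y z = T y z x) (Tsym : forall x y z, T x y z = T x z y).
Hypothesis Tneg : forall a b c x y z, negpair a b ->
  T (actD (rootel a b c) x) (actD (rootel a b c) y) (actD (rootel a b c) z) = T x y z.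
Hypothesis Ttor : forall i (c : C) x y z, c != 0 ->
  T (actD (torel (lshift n i) c) x) (actD (torel (lshift n i) c) y)
    (actD (torel (lshift n i) c) z) = c ^ lamV hn i * T x y z.
Local Notation s := (sD C).

Let lower_rel := tri_lower T1 Tcyc Tneg.
Let Z1 := triZ1 T1. Let Z2 := triZ2 T1 Tcyc. Let Z3 := triZ3 T1 Tcyc.
Let O1 := tri0 T1. Let O3 := tri30 T1 Tcyc.
Let perm := tri_perm Tcyc Tsym.

Lemma tri_weight A B E i : goodA A -> goodA B -> goodA E ->
  T (s A) (s B) (s E) != 0 -> swt A i + swt B i + swt E i = lamV hn i.
Proof.
move=> gA gB gE t0; apply: (weight_eq t0) => c c0.
rewrite -(Ttor i _ _ _ c0) !actD_torel // Z1 Z2 Z3 !mulrA.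
by rewrite !expfzDr.
Qed.

(** For j < i, apply [tri_lower] with (e_i, f_j) to X, X, E, where X omits i and L: the root vector
    replaces j by i, which sends X to the complement of j and L and kills E. What remains is twice
    the wanted value. *)
Lemma tri_case1 i j E : goodA (~: [set i; L]) -> goodA (~: [set j; L]) -> goodA E ->
  i != j -> i != L -> j != L -> i \in E -> j \in E ->
  T (s (~: [set i; L])) (s (~: [set j; L])) (s E) = 0.
Proof.
move=> gi gj gE ij iL jL iE jE.
wlog lt : i j gi gj ij iL jL iE jE / (j < i)%N.
  move=> h; case: (ltngtP j i) => ji; first exact: h.
    by rewrite perm; apply: h => //; rewrite eq_sym.
  by move: ij; rewrite -val_eqE /= ji eqxx.
have nij := negpair_lr lt.
have iX : i \notin ~: [set i; L] by rewrite !inE eqxx.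
have jX : j \in ~: [set i; L] by rewrite !inE negb_or eq_sym ij jL.
have [e e0 [he gY]] := lower_lr C gi iX jX ij.
have Y : i |: ((~: [set i; L]) :\ j) = ~: [set j; L].
  apply/setP=> t; rewrite !inE !negb_or.
  case: (eqVneq t i) => [->|ti] /=; first by rewrite ij iL.
  by rewrite andbC.
rewrite Y in he.
have := lower_rel (s (~: [set i; L])) (s (~: [set i; L])) (s E) nij.
rewrite he (lower_lr0 C gE ij) ?iE // O3 Z1 Z2 addr0 perm -mulr2n => /eqP.
by rewrite mulrn_eq0 /= mulf_eq0 (negPf e0) => /eqP.
Qed.

(** Apply [tri_lower] with (f_j, f_L): the first spinor is killed, B loses j and L, and the full set
    becomes the complement of j and L. The other surviving term is an instance of [tri_case1]. *)
Lemma tri_case2 i j B : goodA (~: [set i; L]) -> goodA B -> goodA [set: 'I_n] ->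
  i != j -> i != L -> j != L -> i \in B -> j \in B -> L \in B ->
  T (s (~: [set i; L])) (s (B :\ L :\ j)) (s [set: 'I_n]) = 0.
Proof.
move=> gi gB gT ij iL jL iB jB LB.
have [e e0 [he gY]] := lower_rr C gB jB LB jL.
have [e' e0' [he' gX]] := lower_rr C gT (in_setT j) (in_setT L) jL.
have X : [set: 'I_n] :\ L :\ j = ~: [set j; L].
  by apply/setP=> t; rewrite !inE negb_or andbT.
rewrite X in he' gX.
have := lower_rel (s (~: [set i; L])) (s B) (s [set: 'I_n]) (negpair_rr jL).
rewrite (lower_rr0 C gi jL) ?inE ?eqxx ?orbT // O1 add0r he he' Z2 Z3.
rewrite [T _ (s B) _]Tsym tri_case1 // mulr0 addr0 => /eqP.
by rewrite mulf_eq0 (negPf e0) => /eqP.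
Qed.

Lemma goodA_compl A : goodA A = ~~ odd #|~: A|.
Proof.
have h : (#|A| + #|~: A| = n)%N by rewrite cardsC card_ord.
rewrite /goodA -[in odd n]h oddD; by case: (odd #|A|); case: (odd _).
Qed.

Local Notation M := [set i : 'I_n | (m <= i < n.-1)%N].

Let card_M : #|M| = 4%N.
Proof.
have lt (j : 'I_4) : (m + j < n)%N by have := ltn_ord j; move: hn; clear; lia.
have -> : M = [set Ordinal (lt j) | j : 'I_4].
  apply/setP=> i; rewrite inE; apply/andP/imsetP => [[mi iL]|[j _ ->]] /=.
    have hj : (i - m < 4)%N by move: mi iL hn; clear; lia.
    by exists (Ordinal hj) => //; apply: val_inj => /=; rewrite subnKC.
  by rewrite leq_addr; split=> //; have := ltn_ord j; move: hn; clear; lia.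
by rewrite card_imset ?card_ord // => i j /(congr1 val) /= /addnI /val_inj.
Qed.

(* Weights leave only the case where A, B and E are the complements of
   [a + {L}], [b + {L}] and c, for a partition a + b + c of the four indices of
   [M] into sets of odd, odd and even size. *)
Lemma tri_last A B E : goodA A -> goodA B -> goodA E ->
  L \notin A -> L \notin B -> L \in E -> T (s A) (s B) (s E) = 0.
Proof.
move=> gA gB gE LA LB LE; apply/eqP; apply: contraT => t0.
have hw i := tri_weight i gA gB gE t0.
have low i : (i < m)%N -> [/\ i \in A, i \in B & i \in E].
  move=> im; have := hw i; rewrite /lamV im /swt.
  have -> : (i == L) = false.
    by rewrite -val_eqE /=; apply/negbTE; move: im hn; clear; lia.
  by case: (i \in A); case: (i \in B); case: (i \in E).
have mid i : i \in M -> ((i \notin A) + (i \notin B) + (i \notin E) = 1)%N.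
  rewrite inE => /andP[im iL]; have := hw i; rewrite /lamV ltnNge im /swt.
  have -> : (i == L) = false by rewrite -val_eqE /=; apply/negbTE; move: iL; clear; lia.
  by case: (i \in A); case: (i \in B); case: (i \in E).
have trich i : [|| (i < m)%N, i \in M | i == L].
  rewrite inE -val_eqE /=; have := ltn_ord i; move: hn; clear.
  by case: (ltnP i m) => //= im hn' ltn_; case: (ltngtP i n.-1) => //; lia.
pose a := ~: A :\ L; pose b := ~: B :\ L.
have inM (X : {set 'I_n}) i : (forall j, (j < m)%N -> j \in X) -> i \in ~: X :\ L -> i \in M.
  move=> hX; rewrite !inE => /andP[iL iX]; have := trich i.
  rewrite (negPf iL) orbF inE => /orP[/hX|//]; by rewrite (negPf iX).
have aM i : i \in a -> i \in M by apply: inM => j /low[].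
have bM i : i \in b -> i \in M by apply: inM => j /low[].
have cM i : i \in ~: E -> i \in M.
  move=> iE; have := trich i; case/or3P => [/low[_ _]|//|/eqP e].
    by move: iE; rewrite inE => /negPf->.
  by move: iE; rewrite e inE LE.
have cA : #|~: A| = #|a|.+1 by rewrite (cardsD1 L (~: A)) inE LA.
have cB : #|~: B| = #|b|.+1 by rewrite (cardsD1 L (~: B)) inE LB.
have oa : odd #|a| by move: gA; rewrite goodA_compl cA /= negbK.
have ob : odd #|b| by move: gB; rewrite goodA_compl cB /= negbK.
have ina i : i \in M -> (i \in a) = (i \notin A).
  by rewrite !inE -val_eqE /= => /andP[_ h]; rewrite ltn_eqF.
have inb i : i \in M -> (i \in b) = (i \notin B).
  by rewrite !inE -val_eqE /= => /andP[_ h]; rewrite ltn_eqF.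
have dab i : i \in a -> i \notin b.
  move=> ia; have iM := aM _ ia; have := mid _ iM.
  by rewrite (inb _ iM) -(ina _ iM) ia; case: (i \notin B).
have dac i : i \in a -> i \in E.
  move=> ia; have iM := aM _ ia; have := mid _ iM.
  by rewrite -(ina _ iM) ia; case: (i \in E) => //; case: (i \notin B).
have dbc i : i \in b -> i \in E.
  move=> ia; have iM := bM _ ia; have := mid _ iM.
  by rewrite -(inb _ iM) ia; case: (i \in E) => //; case: (i \notin A).
have cabc : (#|a| + #|b| + #|~: E| = 4)%N.
  rewrite -card_M.
  have -> : M = (a :|: b) :|: ~: E.
    apply/setP=> i; apply/idP/idP => [iM|].
      rewrite !in_setU (ina _ iM) (inb _ iM) in_setC; have := mid _ iM.
      by case: (i \in A); case: (i \in B); case: (i \in E).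
    by rewrite !in_setU => /orP[/orP[/aM|/bM]|/cM].
  rewrite cardsU [(a :|: b) :&: _](_ : _ = set0); last first.
    apply/setP=> i; rewrite inE in_setU in_setC in_set0.
    by apply/negP => /andP[/orP[/dac|/dbc] ->].
  rewrite cards0 subn0 cardsU [a :&: b](_ : _ = set0) ?cards0 ?subn0 //.
  by apply/setP=> i; rewrite inE in_set0; apply/negP => /andP[/dab/negPf->].
have LX (X : {set 'I_n}) (LX' : L \notin X) i : ~: X :\ L = [set i] -> X = ~: [set i; L] /\ i != L.
  move=> e; split; last by have := set11 i; rewrite -e in_setD1 => /andP[].
  apply/setP=> t; rewrite !inE negb_or; have /setP/(_ t) := e; rewrite !inE => <-.
  case: (eqVneq t L) => [->|tL] /=; first by rewrite (negPf LX').
  by rewrite negbK andbT.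
have swap3 (X Y : {set 'I_n}) : goodA X -> goodA Y -> L \notin X -> L \notin Y ->
    #|~: X :\ L| = 1%N -> (2 < #|~: Y :\ L|)%N -> #|~: E| = 0%N ->
    (forall i, i \in ~: X :\ L -> i \notin ~: Y :\ L) -> T (s X) (s Y) (s E) = 0.
  move=> gX gY LX' LY /eqP/cards1P[i ei] cY /eqP cE dis.
  have [XE iL] := LX _ LX' _ ei.
  have ET : E = [set: 'I_n].
    by move: cE; rewrite cards_eq0 => /eqP e; rewrite -[E]setCK e setC0.
  have [j jY] : exists j, j \in ~: Y :\ L by apply/card_gt0P; apply: leq_trans cY.
  have jL : j != L by move: jY; rewrite !inE => /andP[].
  have jnY : j \notin Y by move: jY; rewrite !inE => /andP[].
  have ij : i != j.
    apply: contraTneq jY => <-; apply: dis; by rewrite ei set11.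
  have iY : i \in Y.
    have := dis i; rewrite ei set11 => /(_ isT); by rewrite !inE iL /= negbK.
  pose B0 := j |: (L |: Y).
  have LB0 : L \notin j |: Y by rewrite !inE negb_or eq_sym jL.
  have B0E : B0 = L |: (j |: Y) by rewrite /B0 setUCA.
  have YE : Y = B0 :\ L :\ j by rewrite B0E setU1K // setU1K.
  have gB0 : goodA B0.
    by move: gY; rewrite /goodA B0E cardsU1 LB0 cardsU1 jnY /= negbK.
  rewrite XE YE ET; apply: tri_case2 => //.
  - by rewrite -XE.
  - by rewrite -ET.
  - by rewrite !inE iY !orbT.
  - by rewrite !inE eqxx.
  - by rewrite !inE eqxx orbT.
have dba i : i \in b -> i \notin a by move=> ib; apply/negP=> /dab; rewrite ib.
have big3 (x : nat) : odd x -> (x != 1)%N -> (2 < x)%N by case: x => [|[|[|x]]].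
(* Two odd sizes and an even one with sum 4: the triple is (1, 1, 2), settled by [tri_case1], or (1,
   3, 0) or (3, 1, 0), settled by [swap3]. *)
case: (eqVneq #|a| 1%N) => a1.
  case: (eqVneq #|b| 1%N) => b1; last first.
    have b3 := big3 _ ob b1.
    move: t0; rewrite swap3 ?eqxx //.
    by move: cabc; rewrite a1; move: b3; clear; lia.
  have /eqP/cards1P[i ei] := a1; have /eqP/cards1P[j ej] := b1.
  have [AE iL] := LX _ LA _ ei; have [BE jL] := LX _ LB _ ej.
  have ia : i \in a by rewrite ei set11.
  have jb : j \in b by rewrite ej set11.
  move: t0; rewrite AE BE tri_case1 ?eqxx -?AE -?BE //; [|exact: dac|exact: dbc].
  by apply: contraTneq jb => <-; exact: dab.
have a3 := big3 _ oa a1.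
move: t0; rewrite perm swap3 ?eqxx //.
  by move: cabc ob a3; case: #|b| => [|[|[|x]]] //; clear; lia.
by move: cabc ob a3; case: #|b| => // x; clear; lia.
Qed.

Lemma tri_basis A B E : goodA A -> goodA B -> goodA E -> T (s A) (s B) (s E) = 0.
Proof.
move=> gA gB gE; apply/eqP; apply: contraT => t0.
(* The weight at L is -1, so exactly one of the three sets contains L; symmetry moves it to the last
   place. *)
have := tri_weight L gA gB gE t0; rewrite /lamV eqxx /swt.
have -> : (L < m)%N = false by apply/negbTE; rewrite -leqNgt /=; move: hn; clear; lia.
case: (boolP (L \in A)) => LA; case: (boolP (L \in B)) => LB;
  case: (boolP (L \in E)) => LE //= _; move: t0.
- by rewrite Tcyc tri_last ?eqxx.
- by rewrite Tsym tri_last ?eqxx.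
- by rewrite tri_last ?eqxx.
Qed.

Lemma tri_vanish x : T x x x = 0.
Proof.
have lin1 (F : {set 'I_n} -> C) y z : T (\sum_(A | goodA A) F A *: s A) y z =
    \sum_(A | goodA A) F A * T (s A) y z.
  elim/big_rec2: _ => [|A u w _ <-]; first exact: O1.
  by rewrite addrC T1 addrC.
have red y z : (forall A, goodA A -> T (s A) y z = 0) -> T x y z = 0.
  move=> h; rewrite [x]D_sum (lin1 (fun A => vsval x A)) big1 // => A gA.
  by rewrite h // mulr0.
apply: (red) => A gA; rewrite Tcyc; apply: (red) => B gB; rewrite Tcyc; apply: (red) => E gE.
exact: tri_basis.
Qed.

End Cubic.

Section BilinearMaps.
Variables (C : fieldType) (X Y Z : vectType C) (f : 'Hom(X, 'Hom(Y, Z))).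
Lemma hom2Dl u v x : f (u + v) x = f u x + f v x.
Proof. by rewrite raddfD add_lfunE. Qed.
Lemma hom2Zl c u x : f (c *: u) x = c *: f u x.
Proof. by rewrite -scale_lfunE; congr (fun_of_lfun _ x); exact: linearZ. Qed.
Lemma hom2Dr u x y : f u (x + y) = f u x + f u y.
Proof. by rewrite linearD. Qed.
Lemma hom2Zr c u x : f u (c *: x) = c *: f u x.
Proof. by rewrite linearZ. Qed.
Variable l : 'Hom(Z, C^o).
Lemma lfunD x y : l (x + y) = l x + l y :> C.
Proof. by rewrite linearD. Qed.
Lemma lfunZ c x : l (c *: x) = c * l x :> C.
Proof. by rewrite linearZ. Qed.
End BilinearMaps.

(** * Uniqueness of psi *)

Section Uniqueness.
Variables (C : numClosedFieldType) (n : nat).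
Hypothesis hn : (5 <= n)%N.
Local Notation letter := 'I_(n + n).
Implicit Types (a b p q : letter) (c d z : C).
Implicit Types (B : {set 'I_(n + n)}) (A : {set 'I_n}) (i j : 'I_n).
Local Notation L := (lastI hn).
Local Notation m := (n - 5)%N.
Local Notation k := (n - 4)%N.
Local Notation D := (Delta_plus C n).
Local Notation actD := (Delta_plus_act C n).
Local Notation U := (wedge_natural C n (n - 4)).
Local Notation actU := (wedge_natural_act C n (n - 4)).
Local Notation s := (sD C).
Local Notation w := (wU C (n - 4)).

Let kE : k = m.+1. Proof. by move: hn; clear; lia. Qed.
Let mn : (m < n)%N. Proof. by move: hn; clear; lia. Qed.
Let kn : (k < n)%N. Proof. by move: hn; clear; lia. Qed.

Lemma goodT : goodA [set: 'I_n].
Proof. by rewrite goodA_compl setCT cards0. Qed.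

Lemma actU_torel i z B : z != 0 -> #|B| = k ->
  actU (torel (lshift n i) z) (w B) = z ^ (2 * eweight i B) *: w B.
Proof.
move=> z0 gB; apply: val_inj; rewrite /= actUE ?wUE //; last exact: spin_torel.
by rewrite eact_torel.
Qed.

Section Psi.
Variables (V : vectType C) (rho : spin_action n V) (l : 'Hom(V, C^o)).
Hypotheses (hl : hw_functional rho (lamV hn) l) (nd : nondeg rho l).
Variable psi : 'Hom(D, 'Hom(U, V)).
Hypothesis pe : forall g, spin g -> forall u x,
  psi (actD g u) (actU g x) = rho g (psi u x).

Lemma psi_weight A B i : goodA A -> #|B| = k -> l (psi (s A) (w B)) != 0 ->
  swt A i + 2 * eweight i B = lamV hn i.
Proof.
move=> gA gB t0; apply: (weight_eq t0) => z z0.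
have [_ ht] := hl; have := ht i z (psi (s A) (w B)) z0.
rewrite -pe; last exact: spin_torel.
rewrite actD_torel // actU_torel // hom2Zl hom2Zr !lfunZ mulrA => e.
by rewrite expfzDr.
Qed.

(** The weight 3 at the indices below m forces A and B to contain them all, which leaves a single
    further letter in B. If it is some e_j, the weights at j and L make A omit both; if it is some
    f_j, then j = L and A is full. *)
Lemma psi_support A B : goodA A -> #|B| = k -> l (psi (s A) (w B)) != 0 ->
  (A = [set: 'I_n] /\ B = rshift n L |: eset n m) \/
  exists j, [/\ (m <= j)%N, j != L, A = ~: [set j; L] & B = lshift n j |: eset n m].
Proof.
move=> gA gB t0; have hw i := psi_weight i gA gB t0.
have Lm i : (i < m)%N -> (i == L) = false.
  by move=> im; rewrite -val_eqE /=; apply/negbTE; move: im hn; clear; lia.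
have low i : (i < m)%N -> [/\ i \in A, lshift n i \in B & rshift n i \notin B].
  move=> im; have := hw i; rewrite /lamV im Lm // /swt /eweight.
  by case: (i \in A); case: (_ \in B); case: (_ \in B).
have sub : eset n m \subset B.
  by apply/subsetP=> a; case: (letterP a) => i; rewrite ?eset_r // eset_l => /low[].
have c1 : #|B :\: eset n m| = 1%N.
  by rewrite cardsD (setIidPr sub) gB (card_eset mn) kE subSnn.
have /eqP/cards1P[a ea] := c1.
have BE : B = a |: eset n m by rewrite -ea setUC -[in LHS](setID B (eset n m)) (setIidPr sub).
have aE : a \notin eset n m.
  have : a \in B :\: eset n m by rewrite ea set11.
  by rewrite inE => /andP[].
have inB x : x \in B = (x == a) || (x \in eset n m) by rewrite BE in_setU1.
have mem i : (m <= i)%N ->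
    swt A i + 2 * ((lshift n i == a)%:Z - (rshift n i == a)%:Z) = (if i == L then -1 else 1).
  move=> mi; have := hw i; rewrite /lamV ltnNge mi /eweight !inB eset_l eset_r ltnNge mi !orbF.
  by rewrite add0r.
have mL : (m <= L)%N by rewrite /=; move: hn; clear; lia.
case: (letterP a) aE ea BE inB mem => j aE ea BE inB mem.
  right; exists j; rewrite eset_l -leqNgt in aE.
  have jL : j != L.
    by apply/eqP => e; have := mem _ mL; rewrite eqxx e eqxx eq_rlshift /swt; case: (L \in A).
  split=> //; apply/setP=> i; rewrite !inE negb_or.
  case: (ltnP i m) => im.
    have [-> _ _] := low _ im; rewrite (negbT (Lm _ im)) andbT; apply/esym.
    by apply: contraTneq im => ->; rewrite -leqNgt.
  have := mem _ im; rewrite eq_lshift eq_rlshift /swt.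
  by case: (i \in A); case: (i == j); case: (i == L).
left.
have jL : j = L.
  apply/eqP; apply: contraT => jL.
  have jm : (m <= j)%N.
    rewrite leqNgt; apply/negP => /low[_ _]; by rewrite inB eqxx.
  by have := mem _ jm; rewrite (negPf jL) eq_lrshift eqxx /swt; case: (j \in A).
split; last by rewrite BE jL.
apply/setP=> i; rewrite inE; case: (ltnP i m) => im; first by have [] := low _ im.
have := mem _ im; rewrite eq_lrshift eq_rshift jL /swt.
by case: (i \in A); case: (i == L).
Qed.

(** Invariance of l under the root element of (f_L, f_j), applied to the full spinor and to e_j /\
    [eset n m], has a linear term that relates the coefficient of index j to the distinguished
    one. *)
Lemma psi_unique0 : l (psi (s [set: 'I_n]) (w (rshift n L |: eset n m))) = 0 -> psi = 0.
Proof.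
move=> b0.
have lz u x : l (psi u x) = 0 -> forall c, l (psi (c *: u) x) = 0.
  by move=> e c; rewrite hom2Zl lfunZ e mulr0.
have bas A B : goodA A -> #|B| = k -> l (psi (s A) (w B)) = 0.
  move=> gA gB; apply/eqP; apply: contraT => t0.
  case: (psi_support gA gB t0) => [[AE BE]|[j [mj jL AE BE]]].
    by rewrite AE BE b0 eqxx in t0.
  have rp : negpair (rshift n L) (rshift n j) by apply: negpair_rr; rewrite eq_sym.
  have rp' : root_pair (rshift n L) (rshift n j) by case/andP: rp.
  have Lj : L != j by rewrite eq_sym.
  have [e e0 [he gX]] := lower_rr C goodT (in_setT L) (in_setT j) Lj.
  have X : [set: 'I_n] :\ j :\ L = A.
    by rewrite AE; apply/setP=> t; rewrite !inE negb_or andbT andbC.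
  have h1 : bar (rshift n L) \notin B.
    rewrite bar_r BE in_setU1 eq_lshift (negPf Lj) /= eset_l -leqNgt /=.
    by move: hn; clear; lia.
  have h2 : bar (rshift n j) \in B by rewrite bar_r BE setU11.
  have [e' e0' he'] := eact_move C rp' h1 h2.
  have BE' : B :\ bar (rshift n j) = eset n m.
    by rewrite bar_r BE setU1K // eset_l -leqNgt.
  have gB' : #|rshift n L |: eset n m| = k by rewrite cardsU1 eset_r (card_eset mn) kE.
  rewrite BE' wedge_basis ?eset_r // in he'.
  pose e2 := e' * ext_sign C (rshift n L) (eset n m).
  have hU c : actU (rootel (rshift n L) (rshift n j) c) (w B) =
      w B + (c * e2) *: w (rshift n L |: eset n m).
    apply: val_inj; rewrite /= actUE ?wUE //; last exact: spin_rootel.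
    by rewrite he' scalerA mulrA.
  have [hneg _] := hl.
  have inv c : l (psi (s setT + (c * e) *: s A) (w B + (c * e2) *: w (rshift n L |: eset n m)))
      = l (psi (s setT) (w B)).
    rewrite -[RHS](hneg _ _ c _ rp) -pe; last exact: spin_rootel.
    by rewrite hU actD_rootel // he X scalerA.
  have ex c : l (psi (s setT + (c * e) *: s A) (w B + (c * e2) *: w (rshift n L |: eset n m)))
     = l (psi (s setT) (w B)) + c * e * l (psi (s A) (w B))
       + c ^+ 2 * (e * e2 * l (psi (s A) (w (rshift n L |: eset n m)))).
    by rewrite hom2Dl !hom2Dr !hom2Zl !hom2Zr !lfunD !lfunZ b0; ring.
  have /eqP : e * l (psi (s A) (w B)) = 0.
    apply: (@linear_coeff _ _ (e * e2 * l (psi (s A) (w (rshift n L |: eset n m)))) 0) => c.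
    have := inv c; rewrite ex => /eqP; rewrite -subr_eq0 => /eqP h; rewrite -[RHS]h; ring.
  by rewrite mulf_eq0 (negPf e0) /= (negPf t0).
have all u x : l (psi u x) = 0.
  rewrite (D_sum u) linear_sum sum_lfunE linear_sum big1 // => A gA.
  rewrite hom2Zl /= lfunZ (U_sum x) !linear_sum big1 ?mulr0 // => B /eqP gB.
  by rewrite /= hom2Zr lfunZ bas // mulr0.
apply/lfunP=> u; apply/lfunP=> x; rewrite !zero_lfunE; apply: nd => g sg.
by rewrite -pe.
Qed.
End Psi.
End Uniqueness.

(** * Uniqueness of a, the cubic identity and the kernels *)

Section Final.
Variables (C : numClosedFieldType) (n : nat).
Hypothesis hn : (5 <= n)%N.
Local Notation letter := 'I_(n + n).
Implicit Types (a b p q : letter) (c d : C).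
Implicit Types (A B : {set 'I_n}) (i j : 'I_n).
Local Notation L := (lastI hn).
Local Notation m := (n - 5)%N.
Local Notation k := (n - 4)%N.
Local Notation D := (Delta_plus C n).
Local Notation actD := (Delta_plus_act C n).
Local Notation U := (wedge_natural C n (n - 4)).
Local Notation actU := (wedge_natural_act C n (n - 4)).
Local Notation s := (sD C).
Local Notation I := [set i : 'I_n | (i < k)%N].

Let kn : (k < n)%N. Proof. by move: hn; clear; lia. Qed.

Section Quadratic.
Variable a : 'Hom(D, 'Hom(D, U)).
Hypothesis ha : sym2_equivariant actD actU a.
Let l := lU C n k.

Let hl : hw_functional actU (fun i => 2 * (i < k)%N%:Z) l.
Proof. by have [] := U_datum C kn. Qed.
Let nd : nondeg actU l.
Proof. by have [] := U_datum C kn. Qed.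
Let asym u u' : a u u' = a u' u. Proof. by case: ha. Qed.
Let ae g u u' : spin g -> a (actD g u) (actD g u') = actU g (a u u').
Proof. by case: ha => _ h /h. Qed.

Lemma a_weight A B i : goodA A -> goodA B -> l (a (s A) (s B)) != 0 ->
  swt A i + swt B i = 2 * (i < k)%N%:Z.
Proof.
move=> gA gB t0; apply: (weight_eq t0) => z z0.
have [_ ht] := hl; have := ht i z (a (s A) (s B)) z0.
rewrite -ae; last exact: spin_torel.
rewrite !actD_torel // hom2Zl hom2Zr !lfunZ mulrA => e.
by rewrite expfzDr.
Qed.

(** Induction on the size of the complement of B. If B is full, the weight forces A = I. Otherwise
    two indices i, j missing from B lie in A, and invariance under (f_i, f_j), applied to A and B +
    {i, j}, relates the coefficient of (A, B) to one with a smaller complement. *)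
Lemma a_unique0 : l (a (s I) (s [set: 'I_n])) = 0 -> a = 0.
Proof.
move=> b0.
have bas : forall N A B, (#|~: B| < N)%N -> goodA A -> goodA B -> l (a (s A) (s B)) = 0.
  elim=> // N IH A B lt gA gB; apply/eqP; apply: contraT => t0.
  have hw i := a_weight i gA gB t0.
  have [i iB] : exists i, i \notin B.
    apply/existsP; apply: contraT; rewrite negb_exists => /forallP h.
    have BT : B = [set: 'I_n] by apply/setP=> i; rewrite inE; have := h i; rewrite negbK.
    have AI : A = I.
      apply/setP=> i; have := hw i; rewrite BT /swt !inE.
      by case: (i \in A); case: (i < k)%N.
    by rewrite AI BT b0 eqxx in t0.
  (* The complement of B has even size, so a second index is missing. *)
  have [j] : exists j, j \in ~: B :\ i.
    apply/card_gt0P; move: gB; rewrite goodA_compl (cardsD1 i) inE iB /= negbK.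
    by case: #|_|.
  rewrite !inE => /andP[ji jB].
  have inA x : x \notin B -> x \in A.
    move=> xB; have := hw x; rewrite /swt (negPf xB).
    by case: (x \in A) => //; case: (x < k)%N.
  have [iA jA] := (inA _ iB, inA _ jB).
  have ij : i != j by rewrite eq_sym.
  pose B0 := i |: (j |: B).
  have iB0 : i \in B0 by rewrite setU11.
  have jB0 : j \in B0 by rewrite !inE eqxx orbT.
  have injB : i \notin j |: B by rewrite !inE negb_or ij.
  have gB0 : goodA B0.
    by move: gB; rewrite /goodA /B0 cardsU1 injB cardsU1 jB /= negbK.
  have B0E : B0 :\ j :\ i = B.
    by rewrite /B0 setUCA setU1K ?setU1K // !inE negb_or eq_sym ij.
  have [e e0 [he gA']] := lower_rr C gA iA jA ij.
  have [e' e0' [he' _]] := lower_rr C gB0 iB0 jB0 ij.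
  rewrite B0E in he'.
  have nij := negpair_rr ij; have rij : root_pair (rshift n i) (rshift n j) by case/andP: nij.
  have b1 : l (a (s (A :\ j :\ i)) (s B0)) = 0.
    apply: IH => //; rewrite -ltnS (leq_trans _ lt) // ltnS; apply: proper_card.
    apply/properP; split; first by rewrite setCS /B0 setUA subsetUr.
    by exists i; rewrite inE ?iB0.
  have [hneg _] := hl.
  have /eqP : e' * l (a (s A) (s B)) = 0.
    apply: (@linear_coeff _ _ (e * e' * l (a (s (A :\ j :\ i)) (s B))) 0) => c.
    have := hneg _ _ c (a (s A) (s B0)) nij; rewrite -ae; last exact: spin_rootel.
    rewrite !actD_rootel // he he' hom2Dl !hom2Dr !hom2Zl !hom2Zr !lfunD !lfunZ b1.
    by move/eqP; rewrite -subr_eq0 => /eqP h; rewrite -[RHS]h; ring.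
  by rewrite mulf_eq0 (negPf e0') (negPf t0).
have all u u' : l (a u u') = 0.
  rewrite (D_sum u) linear_sum sum_lfunE linear_sum big1 // => A gA.
  rewrite hom2Zl /= lfunZ (D_sum u') !linear_sum big1 ?mulr0 // => B gB.
  by rewrite /= hom2Zr lfunZ (bas _ _ _ (ltnSn _)) // mulr0.
apply/lfunP=> u; apply/lfunP=> u'; rewrite !zero_lfunE; apply: nd => g sg.
by rewrite -ae.
Qed.

End Quadratic.

Lemma a_unique : unique_up_to_scale (fun a : 'Hom(D, 'Hom(D, U)) => sym2_equivariant actD actU a).
Proof.
have [a0 [a00 ha0]] := a_exists C hn.
exists a0; split=> // a ha.
pose b (a : 'Hom(D, 'Hom(D, U))) := lU C n k (a (s I) (s [set: 'I_n])).
have b0 : b a0 != 0 by apply: contraNneq a00 => /(a_unique0 ha0)->.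
exists (b a / b a0); apply/eqP; rewrite -subr_eq0; apply/eqP.
apply: a_unique0.
  have [s1 e1] := ha; have [s2 e2] := ha0.
  split=> [u u'|g sg u u'].
    by rewrite -scaleNr !(add_lfunE, scale_lfunE) s1 s2.
  rewrite -scaleNr !(add_lfunE, scale_lfunE) e1 // e2 //.
  by rewrite linearD linearZ.
rewrite -scaleNr !(add_lfunE, scale_lfunE) lfunD lfunZ -!/(b _).
by rewrite mulNr mulfVK // subrr.
Qed.

Section Psi.
Variables (V : vectType C) (rho : spin_action n V) (l : 'Hom(V, C^o)) (v : V).
Hypotheses (hr : is_rep rho) (hv : hwv rho (lamV hn) v) (lv : l v = 1)
  (hl : hw_functional rho (lamV hn) l) (nd : nondeg rho l).
Local Notation is_psi psi := (equivariant actD (hom_act actU rho) psi).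

Let peP (psi : 'Hom(D, 'Hom(U, V))) := hom_equivariantP actD rho (U_is_rep C n k) psi.

Lemma psi_unique : unique_up_to_scale (fun psi : 'Hom(D, 'Hom(U, V)) => is_psi psi).
Proof.
have [p0 [p00 hp0]] := psi_exists hr hv lv hl nd.
exists p0; split=> // p hp.
pose b (p : 'Hom(D, 'Hom(U, V))) := l (p (s [set: 'I_n]) (wU C k (rshift n L |: eset n m))).
have b0 : b p0 != 0.
  by apply: contraNneq p00 => e; apply/eqP; exact: (psi_unique0 hl nd ((peP p0).1 hp0)).
exists (b p / b p0); apply/eqP; rewrite -subr_eq0; apply/eqP.
apply: (psi_unique0 hl nd).
  move=> g sg u x; rewrite -scaleNr !(add_lfunE, scale_lfunE).
  by rewrite ((peP p).1 hp) // ((peP p0).1 hp0) // linearD linearZ.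
rewrite -scaleNr !(add_lfunE, scale_lfunE) lfunD lfunZ -!/(b _).
by rewrite mulNr mulfVK // subrr.
Qed.

Lemma psi_a_eq0 (psi : 'Hom(D, 'Hom(U, V))) (a : 'Hom(D, 'Hom(D, U))) :
  is_psi psi -> sym2_equivariant actD actU a -> forall u, psi u (a u u) = 0.
Proof.
move=> /peP pe [asym ae].
pose T x y z : C := l (psi x (a y z)) + l (psi y (a z x)) + l (psi z (a x y)).
have T0 x : T x x x = 0.
  apply: (@tri_vanish C n hn T) => {x}.
  - move=> c x x' y z; rewrite /T !(hom2Dl, hom2Dr, hom2Zl, hom2Zr, lfunD, lfunZ); ring.
  - by move=> x y z; rewrite /T -addrA addrC.
  - by move=> x y z; rewrite /T (asym z y) (asym y x) (asym x z) addrAC.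
  - move=> b d c x y z bd; have sr : spin (rootel b d c : 'End({ffun {set 'I_n} -> C^o})).
      by apply: spin_rootel; case/andP: bd.
    have [hneg _] := hl.
    by rewrite /T !ae // !pe // !hneg.
  - move=> i c x y z c0; have st := spin_torel (lshift n i) c0.
    have [_ htor] := hl.
    by rewrite /T !ae // !pe // !htor // !mulrDr.
apply: (equivariant_nondeg (s := actD) nd) => [g u sg|u].
  by rewrite ae // pe.
(* On the diagonal the three terms of T coincide, so T u u u is three times the wanted value. *)
have := T0 u; rewrite /T -mulr2n -mulrSr => /eqP.
by rewrite mulrn_eq0 /= => /eqP.
Qed.

Lemma polarization (a : 'Hom(D, 'Hom(D, U))) : a != 0 -> (forall u u', a u u' = a u' u) ->
  exists u, a u u != 0.
Proof.
move=> a0 sy; have [//|h] := boolp.EM (exists u, a u u != 0).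
have z u : a u u = 0 by apply/eqP; apply: contraT => e; case: h; exists u.
case/negP: a0; apply/eqP/lfunP=> u; apply/lfunP=> u'; rewrite !zero_lfunE.
have := z (u + u'); rewrite hom2Dl !hom2Dr !z add0r addr0 (sy u') -mulr2n -scaler_nat.
by move/eqP; rewrite scaler_eq0 pnatr_eq0 /= => /eqP.
Qed.

Lemma linear_coeffv (W : vectType C) (x y t : W) :
  (forall c, c *: x + c ^+ 2 *: y + c ^+ 3 *: t = 0) -> x = 0 /\ y = 0.
Proof.
move=> h; have x0 : x = 0.
  apply: coordl_eq0 => i.
  apply: (@linear_coeff _ _ (coordl i y) (coordl i t)) => c.
  have := congr1 (coordl i) (h c); rewrite /coordl !linearD !linearZ /= linear0.
  exact.
split=> //; have n2 : (2 : C) != 0 by rewrite pnatr_eq0.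
have h1 := h 1; have h2 := h (-1); rewrite x0 !scaler0 !add0r in h1 h2.
apply: (scalerI n2); rewrite scaler0 scaler_nat mulr2n.
rewrite expr1n scale1r expr1n scale1r in h1.
rewrite sqrrN expr1n scale1r exprS sqrrN expr1n mulr1 scaleN1r in h2.
have -> : y + y = (y + t) + (y - t) by rewrite addrACA subrr addr0.
by rewrite h1 h2 addr0.
Qed.

Lemma psi_lker (psi : 'Hom(D, 'Hom(U, V))) : is_psi psi -> forall u, lker (psi u) != 0%VS.
Proof.
move=> hp u; apply/negP=> k0.
have [a [a0 ha]] := a_exists C hn.
have [w w0] := polarization a0 ha.1.
have hz := psi_a_eq0 hp ha.
pose h := ((psi u)^-1)%VF.
have hK x : h (psi u x) = x by rewrite -comp_lfunE lker0_compVf // lfunE.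
have hD y z : h (y + z) = h y + h z by exact: linearD.
have hZ c y : h (c *: y) = c *: h y by exact: linearZ.
pose H x := h (psi w x).
have x0 : a u u = 0 by rewrite -[LHS]hK hz linear0.
(* The cubic identity at u + c w, carried back to U by the left inverse of psi u. The coefficient of
   c makes a u w + a w u vanish, and then that of c ^+ 2 reduces to a w w. *)
have key c : c *: (a u w + a w u) + c ^+ 2 *: (a w w + H (a u w + a w u)) + c ^+ 3 *: H (a w w) = 0.
  have e : a (u + c *: w) (u + c *: w) = c *: (a u w + a w u) + c ^+ 2 *: a w w.
    rewrite hom2Dl !hom2Dr !hom2Zl !hom2Zr x0 add0r scalerA -expr2.
    by rewrite addrA scalerDr.
  have := hz (u + c *: w); rewrite e hom2Dl hom2Zl => /(congr1 h).
  rewrite linear0 hD hK hZ -/(H _).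
  have -> : H (c *: (a u w + a w u) + c ^+ 2 *: a w w) =
     c *: H (a u w + a w u) + c ^+ 2 *: H (a w w).
    by rewrite /H hom2Dr !hom2Zr hD !hZ.
  by rewrite !scalerDr !scalerA -exprS -expr2 !addrA.
have [e1 e2] := linear_coeffv key.
case/eqP: w0; move: e2; rewrite e1 /H linear0 linear0 addr0.
exact.
Qed.
End Psi.
End Final.

Theorem proposition32 (R : realType) (n : nat) (hn : (5 <= n)%N)
  (V : vectType R[i]) (rho : spin_action n V)
  (hV : irreducible_of_highest_weight rho
          (add_weight (fundamental_weight n (n - 5))
                      (fundamental_weight n (n - 1)))) :
  let D := Delta_plus R[i] n in
  let actD := Delta_plus_act R[i] n in
  let U := wedge_natural R[i] n (n - 4) in
  let actU := wedge_natural_act R[i] n (n - 4) in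
  let is_psi (psi : 'Hom(D, 'Hom(U, V))) :=
    equivariant actD (hom_act actU rho) psi in
  let is_a (a : 'Hom(D, 'Hom(D, U))) := sym2_equivariant actD actU a in
  [/\ unique_up_to_scale is_psi,
      unique_up_to_scale is_a
    & forall psi : 'Hom(D, 'Hom(U, V)), psi != 0 -> is_psi psi ->
        (forall delta : D, lker (psi delta) != 0%VS) /\
        (forall a : 'Hom(D, 'Hom(D, U)), a != 0 -> is_a a ->
           forall delta : D, psi delta (a delta delta) = 0)].
Proof.
have [l [v [hr hv lv hl nd]]] := irreducible_datum (lastI hn) hV.
have lamE i : add_weight (fundamental_weight n (n - 5)) (fundamental_weight n (n - 1)) i =
    lamV hn i.
  rewrite /add_weight /lamV /fundamental_weight.
  have -> : (n - 5 == n)%N = false by apply/negbTE; move: hn; clear; lia.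
  have -> : (n - 5 == n.-1)%N = false by apply/negbTE; move: hn; clear; lia.
  have -> : (n - 1 == n)%N = false by apply/negbTE; move: hn; clear; lia.
  by rewrite subn1 eqxx -val_eqE /=; case: (i < n - 5)%N.
move/(hwv_ext lamE): hv => hv; move/(hw_functional_ext lamE): hl => hl.
move=> D actD U actU is_psi is_a; split.
- exact: psi_unique hr hv lv hl nd.
- exact: a_unique.
- move=> psi _ hp; split=> [u|a _ ha u]; first exact (psi_lker hl nd hp u).
  exact (psi_a_eq0 hl nd hp ha u).
Qed.
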